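(* Let $d,\ell,k$ be positive integers with $k\le\ell$, let $a\in\mathbb{R}^d$ have positive coordinates with $\sum_{j=1}^d a_j=d$, let $\Omega\colon S^{d-1}\to G(\ell,k)$ be Hölder continuous, and let $B(\zeta)$, $\zeta\in S^{d-1}$, be a Hölder continuous family of linear functionals $B(\zeta)\colon\Omega(\zeta)\to\mathbb{C}$. For $0<\varepsilon<R$ and $f\in W_1^{\Omega,a}$ put $$\mathbb{B}_{\varepsilon,R}[f]=\mathcal{F}^{-1}\Big[\chi_{\{\varepsilon\le\eta(\xi)\le R\}}\,\eta(\xi)^{-d}\,B\big(\mathrm{Dil}_{\eta(\xi)}(\xi)\big)\big[\hat f(\xi)\big]\Big].$$ Then the operators $\mathbb{B}_{\varepsilon,R}$ are bounded as mappings of $W_1^{\Omega,a}$ to $L_\infty$ uniformly with respect to $\varepsilon$ and $R$, $0<\varepsilon<R$, if and only if $B$ satisfies the weak cancellation condition $$\int_{S^{d-1}}B(\zeta)[v]\Big(\sum_{j=1}^d a_j\zeta_j^2\Big)\,d\sigma(\zeta)=0\qquad\text{for any } v\in V,\quad\text{where } V=\bigcap_{\zeta\in S^{d-1}}\Omega(\zeta).$$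
   Context: $S^{d-1}$ is the unit sphere in $\mathbb{R}^d$ and $\sigma$ is the Lebesgue (surface) measure on it. $G(\ell,k)$ is the complex Grassmannian of all $k$-dimensional linear subspaces of $\mathbb{C}^\ell$, with the metric $\mathrm{dist}(L_1,L_2)=\|\pi_{L_1}-\pi_{L_2}\|_{\mathrm{HS}}$, where $\pi_L$ is the orthogonal projection of $\mathbb{C}^\ell$ onto $L$ and $\|\cdot\|_{\mathrm{HS}}$ is the Hilbert--Schmidt norm on $\ell\times\ell$ complex matrices. A map $F\colon M\to N$ between metric spaces is called Hölder continuous if there are $\alpha>0$ and $C$ such that $\mathrm{dist}_N(F(x),F(y))\le C\,\mathrm{dist}_M(x,y)^\alpha$ for all $x,y\in M$ with $\mathrm{dist}_M(x,y)\le 1$. The family $B$ is regarded as a function $(\zeta,v)\mapsto B(\zeta)[v]$ on $\omega=\{(\zeta,v)\mid \zeta\in S^{d-1},\ v\in\Omega(\zeta)\}\subset S^{d-1}\times\mathbb{C}^\ell$, linear in $v$; ''Hölder continuous'' means that the restriction of this function to $\{(\zeta,v)\in\omega\mid |v|\le1\}$ is Hölder continuous (equivalently, the linear functional $B(\zeta)\circ\pi_{\Omega(\zeta)}$ on $\mathbb{C}^\ell$ depends on $\zeta$ in a Hölder continuous way). The vector $a$ is called a pattern of homogeneity. The $a$-dilations are $\mathrm{Dil}_t(\xi)=(t^{-a_1}\xi_1,\dots,t^{-a_d}\xi_d)$, $t>0$. For $\xi\in\mathbb{R}^d\setminus\{0\}$, $\eta(\xi)>0$ is the unique number defined by $\sum_{j=1}^d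 \xi_j^2\,\eta(\xi)^{-2a_j}=1$, so that $\mathrm{Dil}_{\eta(\xi)}(\xi)\in S^{d-1}$. The space $W_1^{\Omega,a}$ is $$W_1^{\Omega,a}=\Big\{f\in L_1(\mathbb{R}^d,\mathbb{C}^\ell)\ \Big|\ \hat f(\xi)\in\Omega\big(\mathrm{Dil}_{\eta(\xi)}(\xi)\big)\ \text{ for all }\xi\in\mathbb{R}^d\setminus\{0\}\Big\},$$ with the norm inherited from $L_1(\mathbb{R}^d,\mathbb{C}^\ell)$. $\hat f$ and $\mathcal{F}^{-1}$ denote the Fourier transform (coordinatewise) and the inverse Fourier transform, with any fixed normalization; $\chi$ denotes an indicator function. *)

(* Defs.v *)
From HB Require Import structures.
From mathcomp Require Import all_boot all_order all_algebra.
From mathcomp Require Import all_classical all_reals all_analysis.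
From mathcomp Require Import measurable_realfun.
From mathcomp Require Import complex.

Set Implicit Arguments.
Unset Strict Implicit.
Unset Printing Implicit Defensive.

Import Order.TTheory GRing.Theory Num.Theory.
Import numFieldNormedType.Exports.

Local Open Scope classical_set_scope.
Local Open Scope ring_scope.
Local Open Scope complex_scope.

(* Points of R^d are d-tuples: they carry the product (= Borel) sigma-algebra
   of the library. *)
Section euclidean.
Context {R : realType} {d : nat}.
Implicit Types x y : d.-tuple R.

Definition edot x y : R := \sum_(i < d) tnth x i * tnth y i.
Definition enorm x : R := Num.sqrt (edot x x).
Definition euclid_dist x y : R :=
  Num.sqrt (\sum_(i < d) (tnth x i - tnth y i) ^+ 2).
Definition origin : d.-tuple R := [tuple 0 | _ < d].

Definition sphere : set (d.-tuple R) := [set x | enorm x = 1].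

End euclidean.

(* The d-dimensional Lebesgue measure, as an iterated product measure. *)
Section lebesgue.
Context {R : realType}.

Definition tcons n (p : R * n.-tuple R) : n.+1.-tuple R :=
  [tuple of p.1 :: p.2].

Fixpoint lebesgue_tuple (n : nat) : set (n.-tuple R) -> \bar R :=
  match n return set (n.-tuple R) -> \bar R with
  | 0 => \d_[tuple]
  | n.+1 =>
      pushforward (lebesgue_measure \x @lebesgue_tuple n)%E (@tcons n)
  end.

Lemma measurable_tcons n :
  measurable_fun [set: measurableTypeR R * n.-tuple R] (@tcons n).
Proof.
exact: (@measurable_cons _ _ _ R fst n snd (@measurable_fst _ _ _ _)
  (@measurable_snd _ _ _ _)).
Qed.

Definition tuncons n (t : n.+1.-tuple R) : measurableTypeR R * n.-tuple R :=
  (thead t, [tuple of behead t]).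

Lemma tconsK n : cancel (@tcons n) (@tuncons n).
Proof. by case=> x t; rewrite /tuncons theadE; congr pair; exact/val_inj. Qed.

Lemma tunconsK n : cancel (@tuncons n) (@tcons n).
Proof. by move=> t; rewrite [RHS]tuple_eta; exact/val_inj. Qed.

Lemma measurable_tuncons n : measurable_fun setT (@tuncons n).
Proof.
apply: measurable_fun_pair.
- exact: (@measurable_tnth _ R n.+1 ord0).
- exact: measurable_behead.
Qed.

Lemma lebesgue_tuple_structure n :
  {mu : {sigma_finite_measure set n.-tuple R -> \bar R} |
    mu = @lebesgue_tuple n :> (_ -> _)}.
Proof.
elim: n => [|n [mu muE]]; first by exists \d_[tuple].
pose l : {sigma_finite_measure set (measurableTypeR R) -> \bar R} :=
  lebesgue_measure.
pose m := [the {measure set _ -> \bar R} of (l \x mu)%E].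
pose p : {measure set n.+1.-tuple R -> \bar R} :=
  measure_function_pushforward__canonical__measure_function_Measure m
    (@measurable_tcons n).
have psf : sigma_finite setT p.
  have /sigma_finiteP[F [TF ndF Foo]] := sigma_finiteT l.
  have /sigma_finiteP[G [TG ndG Goo]] := sigma_finiteT mu.
  exists (fun k => @tuncons n @^-1` (F k `*` G k)).
    rewrite -preimage_bigcup -[LHS](preimage_setT (@tuncons n)); congr (_ @^-1` _).
    rewrite -setXTT TF TG predeqE => -[x y]; split.
      move=> [/= [i _ Fnx] [k _ Gky]]; exists (maxn i k) => //; split.
      - by move: x Fnx; exact/subsetPset/ndF/leq_maxl.
      - by move: y Gky; exact/subsetPset/ndG/leq_maxr.
    by move=> [i _ []/= ? ?]; split; exists i.
  move=> k; have [? ?] := Foo k; have [? ?] := Goo k; split.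
    rewrite -[X in measurable X]setTI; apply: measurable_tuncons => //.
    exact: measurableX.
  rewrite /p /= /pushforward -comp_preimage.
  rewrite (_ : _ \o _ = id) ?preimage_id; last by apply/funext; exact: tconsK.
  by rewrite /m /= product_measure1E// lte_mul_pinfty// ge0_fin_numE.
pose P := @Measure_isSigmaFinite.Build _ _ _ (p : set _ -> \bar R) psf.
pose q : {sigma_finite_measure set n.+1.-tuple R -> \bar R} :=
  HB.pack (p : set _ -> \bar R) (Measure.on p) P.
by exists q; rewrite /q /p /m /= -muE.
Qed.

Section instances.
Variable n : nat.
Local Notation leb := (@lebesgue_tuple n).

Let leb0 : leb set0 = 0%E.
Proof. by case: (lebesgue_tuple_structure n) => mu <-; exact: measure0. Qed.

Let leb_ge0 A : (0 <= leb A)%E.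
Proof. by case: (lebesgue_tuple_structure n) => mu <-. Qed.

Let leb_sigma_additive : semi_sigma_additive leb.
Proof.
by case: (lebesgue_tuple_structure n) => mu <-; exact: measure_semi_sigma_additive.
Qed.

HB.instance Definition _ :=
  isMeasure.Build _ _ _ leb leb0 leb_ge0 leb_sigma_additive.

Let leb_sigma_finite : sigma_finite setT leb.
Proof. by case: (lebesgue_tuple_structure n) => mu <-; exact: sigma_finiteT. Qed.

HB.instance Definition _ :=
  Measure_isSigmaFinite.Build _ _ _ leb leb_sigma_finite.

End instances.
End lebesgue.
Arguments lebesgue_tuple {R n}.

(* The surface measure on the unit sphere: sigma(A) is d times the volume of
   the cone {t z | 0 < t <= 1, z in A}. *)
Section surface_measure.
Context {R : realType} {d : nat}.
Implicit Types x : d.-tuple R.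

Definition punctured_ball : set (d.-tuple R) := [set x | 0 < enorm x <= 1].
Definition normalize x : d.-tuple R := [tuple tnth x i / enorm x | i < d].

Lemma measurable_enorm : measurable_fun setT (@enorm R d).
Proof.
rewrite (_ : @enorm R d = fun x => edot x x `^ 2^-1); last first.
  apply/funext => x; rewrite powR12_sqrt//.
  by apply: sumr_ge0 => i _; rewrite -expr2 sqr_ge0.
apply: (measurableT_comp (measurable_powR _)).
apply: measurable_sum => i; apply: measurable_funM; exact: measurable_tnth.
Qed.

Lemma measurable_punctured_ball : measurable punctured_ball.
Proof.
rewrite (_ : punctured_ball = @enorm R d @^-1` `]0, 1]).
  by rewrite -[X in measurable X]setTI; exact: measurable_enorm.
by apply/seteqP; split => x /=; rewrite in_itv.
Qed.

Lemma measurable_normalize : measurable_fun setT normalize.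
Proof.
apply/measurable_fun_tnthP => i.
rewrite (_ : _ \o _ = fun x => tnth x i * enorm x `^ (-1)); last first.
  by apply/funext => x /=; rewrite tnth_mktuple powR_inv1// sqrtr_ge0.
apply: measurable_funM; first exact: measurable_tnth.
exact: (measurableT_comp (measurable_powR _) measurable_enorm).
Qed.

Definition surface_measure : set (d.-tuple R) -> \bar R := fun A =>
  (d%:R%:E * lebesgue_tuple (normalize @^-1` A `&` punctured_ball))%E.

Let cone : {measure set d.-tuple R -> \bar R} :=
  measure_function_pushforward__canonical__measure_function_Measure
    (mrestr lebesgue_tuple measurable_punctured_ball) measurable_normalize.

Let surface_measureE : surface_measure = mscale d%:R%:nng cone.
Proof. by []. Qed.

Let surface0 : surface_measure set0 = 0%E.
Proof. by rewrite surface_measureE measure0. Qed.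

Let surface_ge0 A : (0 <= surface_measure A)%E.
Proof. by rewrite surface_measureE. Qed.

Let surface_sigma_additive : semi_sigma_additive surface_measure.
Proof. by rewrite surface_measureE; exact: measure_semi_sigma_additive. Qed.

HB.instance Definition _ := isMeasure.Build _ _ _ surface_measure
  surface0 surface_ge0 surface_sigma_additive.

End surface_measure.

Section complex_analysis.
Context {R : realType}.

(* Euclidean (Hilbert-Schmidt) norm of a complex matrix. *)
Definition hsnorm m n (A : 'M[R[i]]_(m, n)) : R :=
  Num.sqrt (\sum_i \sum_j Normc.normc (A i j) ^+ 2).

Definition cis (t : R) : R[i] := cos t +i* sin t.

Section integral.
Context {disp} {T : measurableType disp} (mu : {measure set T -> \bar R}).

Definition cintegrable (D : set T) (f : T -> R[i]) : Prop :=
  mu.-integrable D (fun x => (complex.Re (f x))%:E) /\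
  mu.-integrable D (fun x => (complex.Im (f x))%:E).

Definition cintegral (D : set T) (f : T -> R[i]) : R[i] :=
  (\int[mu]_(x in D) complex.Re (f x)) +i*
  (\int[mu]_(x in D) complex.Im (f x)).

End integral.

Definition integrable_rV d l (f : d.-tuple R -> 'rV[R[i]]_l) : Prop :=
  forall j, cintegrable lebesgue_tuple setT (fun x => f x 0 j).

Definition fourier d l (f : d.-tuple R -> 'rV[R[i]]_l)
    (xi : d.-tuple R) : 'rV[R[i]]_l :=
  \row_j cintegral lebesgue_tuple setT
    (fun x => f x 0 j * cis (- (2 * pi * edot x xi))).

Definition inv_fourier d (g : d.-tuple R -> R[i]) (x : d.-tuple R) : R[i] :=
  cintegral lebesgue_tuple setT (fun xi => g xi * cis (2 * pi * edot x xi)).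

End complex_analysis.

Definition hoelder_on {R : realType} {M N : Type} (A : set M)
    (distM : M -> M -> R) (distN : N -> N -> R) (F : M -> N) : Prop :=
  exists alpha C : R, 0 < alpha /\
    forall x y, A x -> A y -> distM x y <= 1 ->
      distN (F x) (F y) <= C * distM x y `^ alpha.

Section grassmannian.
Context {R : realType} {l k : nat}.

(* Subspaces of C^l are row spaces of l x l matrices; <<A>>%MS is the canonical
   matrix with the same row space as A, so that each k-dimensional subspace is
   represented by exactly one element of this type. *)
Record grassmannian := Grassmannian {
  gr_mx :> 'M[R[i]]_l ;
  gr_mxP : (<<gr_mx>>%MS == gr_mx) && (\rank gr_mx == k) }.

Definition gr_dist (L1 L2 : grassmannian) : R :=
  hsnorm (proj_ortho L1 - proj_ortho L2).

End grassmannian.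
Arguments grassmannian : clear implicits.

Section dilations.
Context {R : realType} {d : nat} (a : d.-tuple R).
Implicit Types xi : d.-tuple R.

Definition dil (t : R) xi : d.-tuple R :=
  [tuple t `^ (- tnth a j) * tnth xi j | j < d].

(* The defining equation has a unique positive solution when xi is not the
   origin and a is positive; at the origin there is none and the value is 0. *)
Definition eta xi : R :=
  xget 0 [set t | 0 < t /\
    \sum_(j < d) tnth xi j ^+ 2 * t `^ (- (2 * tnth a j)) = 1].

Definition eta_dir xi : d.-tuple R := dil (eta xi) xi.

End dilations.

(* Omega and B are total functions of which only the relevant part is used:
   Omega zeta for zeta in the sphere, and B zeta v for v in Omega zeta. *)
Section operators.
Context {R : realType} {d l k : nat}.
Variables (a : d.-tuple R) (Omega : d.-tuple R -> grassmannian R l k).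
Variable B : d.-tuple R -> 'rV[R[i]]_l -> R[i].

Definition W1 : set (d.-tuple R -> 'rV[R[i]]_l) :=
  [set f | integrable_rV f /\
    forall xi, xi != origin -> (fourier f xi <= Omega (eta_dir a xi))%MS].

Definition linear_family : Prop :=
  forall zeta, sphere zeta -> forall (c : R[i]) (u v : 'rV[R[i]]_l),
    (u <= Omega zeta)%MS -> (v <= Omega zeta)%MS ->
    B zeta (c *: u + v) = c * B zeta u + B zeta v.

Definition hoelder_family : Prop :=
  hoelder_on
    [set p : d.-tuple R * 'rV[R[i]]_l |
      [/\ sphere p.1, (p.2 <= Omega p.1)%MS & hsnorm p.2 <= 1]]
    (fun p q => Num.sqrt (euclid_dist p.1 q.1 ^+ 2 + hsnorm (p.2 - q.2) ^+ 2))
    (fun z w => Normc.normc (z - w))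
    (fun p => B p.1 p.2).

Definition Bop (eps r : R) (f : d.-tuple R -> 'rV[R[i]]_l) :
    d.-tuple R -> R[i] :=
  inv_fourier (fun xi =>
    if eps <= eta a xi <= r
    then (eta a xi ^- d)%:C * B (eta_dir a xi) (fourier f xi)
    else 0).

Definition uniformly_bounded : Prop :=
  exists C : R, forall eps r : R, 0 < eps -> eps < r ->
    forall f, W1 f ->
      ('N[lebesgue_tuple]_+oo[(fun x => (Normc.normc (Bop eps r f x))%:E)] <=
       C%:E * 'N[lebesgue_tuple]_1[(fun x => (hsnorm (f x))%:E)])%E.

Definition weak_cancellation : Prop :=
  forall v : 'rV[R[i]]_l,
    v \in \bigcap_(zeta in sphere) [set v | (v <= Omega zeta)%MS] ->
    cintegral surface_measure sphere
      (fun zeta => B zeta v * (\sum_(j < d) tnth a j * tnth zeta j ^+ 2)%:C) = 0.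

End operators.

(* Main.v *)
(* The symbol of the operator is homogeneous of degree -d for the dilations, and its mean over
   directions, taken in the unit ball along dilation orbits, is 1/d times the weighted surface
   integral of the statement.

   Sufficiency: the symbol can be changed off Omega so that weak cancellation becomes the
   vanishing of all its means. The truncated kernel is then a dyadic sum of dilates of the Fourier
   transform of one Hoelder continuous shell function of mean zero, plus two bounded edge terms;
   this transform is O(min(|y|, |y|^-gamma)), so the sum is bounded uniformly in eps and r, and
   the operator is convolution with it.

   Necessity: for v in V, test on v times the indicator function of the unit ball. When r is
   small the oscillation is negligible on that ball, and the operator yields the mean of B[v]
   times the integral of eta^-d over the annulus, which grows like log(r / eps). *)
From HB Require Import structures.
From mathcomp Require Import all_boot all_order all_algebra.
From mathcomp Require Import all_classical all_reals all_analysis.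
From mathcomp Require Import measurable_realfun ess_sup_inf.
From mathcomp Require Import complex spectral sesquilinear ring lra.
Require Import Defs.

Set Implicit Arguments.
Unset Strict Implicit.
Unset Printing Implicit Defensive.

Import Order.TTheory GRing.Theory Num.Theory.
Import numFieldNormedType.Exports.

Local Open Scope classical_set_scope.
Local Open Scope ring_scope.

(** * Lebesgue measure under affine maps *)

(** Weak cancellation speaks only about vectors of $V$, whereas a bounded kernel needs mean zero
    against every vector of $\mathbb{C}^\ell$. The gap can be closed because the averaged projection
    onto the orthogonal complements of the [Omega z] is positive semidefinite with null space
    exactly $V$: the symbol may be corrected in just those directions about which the hypothesis is
    silent. The symbol is merely Hoelder continuous, so integration by parts gives nothing. Decay of
    the shell transform comes from comparing the shell with its translate by half a period, and the
    sharp cuts at [eps] and [r], which spoil such a comparison, are traded for a piecewise linear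
    partition of scales. The trade is cheap, since $\eta^{-d}$ has the same integral over every
    dyadic annulus. Integrals over the sphere are replaced by integrals over the unit ball of
    functions composed with a projection to the sphere. The weight $\sum_j a_j\zeta_j^2$ then
    appears as the flux of the field $(a_j x_j)_j$ through the sphere, by comparing the divergence
    identity for this field with the one for the radial field. *)

Section affine_line.
Context {R : realType}.
Local Notation leb := (@lebesgue_measure R).

Definition affine1 (c b x : R) : R := c * x + b.

Lemma measurable_affine1 (c b : R) :
  measurable_fun setT (affine1 c b : measurableTypeR R -> measurableTypeR R).
Proof. by apply: measurable_funD => //; apply: measurable_funM. Qed.

(** By uniqueness of Lebesgue measure: [c] times its image under the affine map gives each interval
    []x, y]] the length [y - x]. *)
Lemma lebesgue_measure_affine1 (c b : R) (A : set (measurableTypeR R)) :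
  0 < c -> measurable A ->
  leb (affine1 c b @^-1` A) = (c^-1%:E * leb A)%E.
Proof.
move=> c0 mA.
have cge0 : 0 <= c by exact: ltW.
pose m : {measure set (measurableTypeR R) -> \bar R} :=
  mscale (NngNum cge0)
  (measure_function_pushforward__canonical__measure_function_Measure leb
    (measurable_affine1 c b)).
have H : leb A = m A.
  apply: lebesgue_measure_unique => // X /=[[x y]] _ <-.
  rewrite /m /mscale /= /pushforward.
  have -> : affine1 c b @^-1` [set` `]x, y]] = [set` `](x - b) / c, (y - b) / c]].
    apply/seteqP; split=> z /=; rewrite !in_itv/= /affine1 ltr_pdivrMr// ler_pdivlMr// [z * c]mulrC ltrBlDr lerBrDr//.
  rewrite !lebesgue_measure_itv/= !lte_fin ltr_pM2r ?invr_gt0// ltrD2r.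
  case: ifPn => _; last by rewrite mule0.
  rewrite -!EFinB -EFinM; congr EFin; field; exact: lt0r_neq0.
rewrite H /m /mscale /= /pushforward muleA -EFinM mulVf ?mul1e//.
exact: lt0r_neq0.
Qed.

End affine_line.

Lemma mule_scale2 (R : realType) (p u v : R) (x y : \bar R) :
  p * (u * v) = 1 -> (p%:E * ((u%:E * x) * (v%:E * y)) = x * y)%E.
Proof. by move=> E; rewrite muleACA -EFinM [LHS]muleA -EFinM E mul1e. Qed.

Section affine_tuple.
Context {R : realType}.

Definition affine d (c b : d.-tuple R) (x : d.-tuple R) : d.-tuple R :=
  [tuple tnth c i * tnth x i + tnth b i | i < d].

Lemma measurable_affine d (c b : d.-tuple R) : measurable_fun setT (affine c b).
Proof.
apply/measurable_fun_tnthP => i.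
rewrite (_ : _ \o _ = fun x => tnth c i * tnth x i + tnth b i); last first.
  by apply/funext => x /=; rewrite tnth_mktuple.
apply: measurable_funD => //; apply: measurable_funM => //; exact: measurable_tnth.
Qed.

(** Only positive diagonal maps occur later: dilations, translations and maps between cubes. The
    induction splits off the first coordinate, and uniqueness of the product measure reduces the
    claim to rectangles. *)
Lemma lebesgue_tuple_affine d (c b : d.-tuple R) (A : set (d.-tuple R)) :
  (forall i, 0 < tnth c i) -> measurable A ->
  lebesgue_tuple (affine c b @^-1` A)
  = ((\prod_(i < d) tnth c i)^-1%:E * lebesgue_tuple A)%E.
Proof.
elim: d => [|d IH] in c b A *.
  move=> _ mA; rewrite big_ord0 invr1 mul1e /=; congr (_ _).
  by apply/seteqP; split => x /=; rewrite (tuple0 (affine c b x)) (tuple0 x).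
move=> c0 mA; set p := (\prod_(i < _) _).
have p0 : 0 < p by apply: prodr_gt0.
have pge0 := ltW p0.
pose c' : d.-tuple R := [tuple of behead c].
pose b' : d.-tuple R := [tuple of behead b].
have tc i : tnth c' i = tnth c (lift ord0 i) by rewrite [in RHS](tuple_eta c) tnthS.
have tb i : tnth b' i = tnth b (lift ord0 i) by rewrite [in RHS](tuple_eta b) tnthS.
have pE : p = tnth c ord0 * \prod_(i < d) tnth c' i.
  by rewrite /p big_ord_recl; under [in RHS]eq_bigr do rewrite tc.
have c'0 i : 0 < tnth c' i by rewrite tc.
pose T (q : measurableTypeR R * d.-tuple R) : measurableTypeR R * d.-tuple R :=
  (affine1 (tnth c ord0) (tnth b ord0) q.1, affine c' b' q.2).
have mT : measurable_fun setT T.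
  apply: measurable_fun_pair.
    exact: (measurableT_comp (measurable_affine1 _ _) measurable_fst).
  exact: (measurableT_comp (measurable_affine _ _) measurable_snd).
have preT X : affine c b @^-1` X = @tuncons R d @^-1` (T @^-1` (@tcons R d @^-1` X)).
  apply/seteqP; suff E x : affine c b x = tcons (T (tuncons x)) by split=> x /=; rewrite E.
  apply: eq_from_tnth => i; rewrite tnth_mktuple.
  case: (unliftP ord0 i) => [j ->|->].
    by rewrite tnthS /= tnth_mktuple tc tb [in LHS](tuple_eta x) tnthS.
  by rewrite tnth0 /= /affine1.
have mX : measurable (@tcons R d @^-1` A).
  by rewrite -[X in measurable X]setTI; exact: measurable_tcons.
rewrite preT /= /pushforward -[X in (_ \x _)%E X]/((@tcons R d) @^-1` ((@tuncons R d) @^-1` _)).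
rewrite -comp_preimage (_ : _ \o _ = id) ?preimage_id; last by apply/funext; exact: tconsK.
pose m := mscale (NngNum pge0)
  (measure_function_pushforward__canonical__measure_function_Measure
   ((lebesgue_measure \x @lebesgue_tuple R d)%E : {measure set _ -> \bar R}) mT).
have H : (lebesgue_measure \x @lebesgue_tuple R d)%E (@tcons R d @^-1` A) = m (@tcons R d @^-1` A).
  apply: product_measure_unique => // X Y mX1 mY1.
  transitivity (p%:E * (lebesgue_measure \x @lebesgue_tuple R d)%E
    ((affine1 (tnth c ord0) (tnth b ord0) @^-1` X) `*` (affine c' b' @^-1` Y)))%E.
    by [].
  rewrite product_measure1E//; last 2 first.
    by rewrite -[X in measurable X]setTI; exact: measurable_affine1.
    by rewrite -[X in measurable X]setTI; exact: measurable_affine.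
  transitivity (p%:E * (((tnth c ord0)^-1%:E * lebesgue_measure X) *
     ((\prod_(i < d) tnth c' i)^-1%:E * lebesgue_tuple Y)))%E.
    congr (_ * (_ * _))%E; last exact: IH.
    exact: lebesgue_measure_affine1.
  apply: mule_scale2; rewrite -invfM -pE mulfV ?gt_eqF//.
by rewrite H /m /mscale /= muleA -EFinM mulVf ?mul1e// gt_eqF.
Qed.

End affine_tuple.

Section affine_integral.
Context {R : realType} {d : nat}.
Local Notation leb := (@lebesgue_tuple R d).
Variables c b : d.-tuple R.
Hypothesis c0 : forall i, 0 < tnth c i.
Let J := (\prod_(i < d) tnth c i).
Let J0 : 0 < J. Proof. exact: prodr_gt0. Qed.
Let Jge0 : 0 <= J^-1. Proof. by rewrite invr_ge0 ltW. Qed.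

Local Notation push := (measure_function_pushforward__canonical__measure_function_Measure
    leb (measurable_affine c b)).

Lemma ge0_integral_affine (f : d.-tuple R -> \bar R) :
  measurable_fun setT f -> (forall x, 0 <= f x)%E ->
  (\int[leb]_x f (affine c b x) = J^-1%:E * \int[leb]_x f x)%E.
Proof.
move=> mf f0.
rewrite -[LHS](@ge0_integral_pushforward _ _ _ _ _ _ (measurable_affine c b) leb setT f)//.
transitivity (\int[mscale (NngNum Jge0) leb]_x f x)%E; last by rewrite ge0_integral_mscale.
apply: (@eq_measure_integral _ _ _ setT (mscale (NngNum Jge0) leb) push f) => A mA _.
exact: lebesgue_tuple_affine.
Qed.

Lemma Rintegral_affine (f : d.-tuple R -> R) :
  leb.-integrable setT (EFin \o f) ->
  \int[leb]_x f (affine c b x) = J^-1 * \int[leb]_x f x.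
Proof.
move=> If; have mf := measurable_int _ If.
have Ip := integrable_funepos measurableT If; have In := integrable_funeneg measurableT If.
rewrite /Rintegral [in LHS]integralE [in RHS]integralE.
transitivity (fine (J^-1%:E * (\int[leb]_x (EFin \o f)^\+ x) - J^-1%:E * (\int[leb]_x (EFin \o f)^\- x))%E).
  congr (fine (_ - _)%E).
    etransitivity; last exact: (ge0_integral_affine (measurable_funepos mf) (funepos_ge0 _)).
    by apply: eq_integral => x _; rewrite !funeposE.
  etransitivity; last exact: (ge0_integral_affine (measurable_funeneg mf) (funeneg_ge0 _)).
  by apply: eq_integral => x _; rewrite !funenegE.
have pf := integrable_fin_num measurableT Ip.
have nf := integrable_fin_num measurableT In.
rewrite -muleBr//; last exact: fin_num_adde_defr.
by rewrite fineM// fin_numB; apply/andP.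
Qed.

End affine_integral.

(** * Volumes of cubes and balls *)

Section boxes.
Context {R : realType}.

(** Cubes bound balls from outside, which gives finite volume, and fit into balls, which gives
    positive integrals. *)
Lemma lebesgue_tuple_unit_cube d :
  @lebesgue_tuple R d [set x | forall i, 0 < tnth x i <= 1] = 1%E.
Proof.
elim: d => [|d IH].
  by rewrite /= diracE mem_set// => -[].
rewrite /= /pushforward.
rewrite (_ : _ @^-1` _ = `]0%R, 1%R] `*` [set x : d.-tuple R| forall i, 0 < tnth x i <= 1]); last first.
  apply/seteqP; split => -[x y] /=.
    move=> H; split=> [|i]; first by rewrite in_itv/=; have := H ord0; rewrite tnth0.
    by have := H (lift ord0 i); rewrite tnthS.
  move=> [+ H] i; rewrite in_itv/= => h.
  by case: (unliftP ord0 i) => [j ->|->]; [rewrite tnthS|rewrite tnth0].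
rewrite product_measure1E//.
  rewrite [X in (_ * X)%E]IH mule1.
  by rewrite [LHS]lebesgue_measure_itv/= lte_fin ltr01 oppr0 adde0.
rewrite (_ : [set x | _] = \bigcap_(i in @setT 'I_d) ((fun x : d.-tuple R => tnth x i) @^-1` `]0, 1])).
  apply: fin_bigcap_measurable => // i _.
  by rewrite -[X in measurable X]setTI; exact: measurable_tnth.
apply/seteqP; split=> x /= H i; first by move=> _; rewrite /= in_itv/=.
by have := H i I; rewrite /= in_itv/=.
Qed.

Lemma measurable_box d (b c : d.-tuple R) :
  measurable [set x : d.-tuple R | forall i, tnth b i < tnth x i <= tnth c i].
Proof.
rewrite (_ : [set x | _] = \bigcap_(i in @setT 'I_d) ((fun x : d.-tuple R => tnth x i) @^-1` `]tnth b i, tnth c i])).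
  apply: fin_bigcap_measurable => // i _.
  by rewrite -[X in measurable X]setTI; exact: measurable_tnth.
apply/seteqP; split=> x /= H i; first by move=> _; rewrite /= in_itv/=.
by have := H i I; rewrite /= in_itv/=.
Qed.

Lemma lebesgue_tuple_cube d (b : d.-tuple R) (r : R) : 0 < r ->
  lebesgue_tuple [set x : d.-tuple R | forall i, tnth b i < tnth x i <= tnth b i + r]
  = (r ^+ d)%:E.
Proof.
move=> r0; pose A := [set x : d.-tuple R | forall i, tnth b i < tnth x i <= tnth b i + r].
have mA : measurable A.
  have := measurable_box b [tuple tnth b i + r | i < d].
  by rewrite (_ : [set x | _] = A)//; apply/seteqP; split=> x /= H i; have := H i; rewrite tnth_mktuple.
have := lebesgue_tuple_unit_cube d.
rewrite (_ : [set x : d.-tuple R | forall i, 0 < tnth x i <= 1] = affine [tuple r | _ < d] b @^-1` A); last first.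
  have E x i : (tnth b i < tnth (affine [tuple r | _ < d] b x) i <= tnth b i + r) = (0 < tnth x i <= 1).
    by rewrite !tnth_mktuple ltrDr pmulr_rgt0// [tnth b i + r]addrC lerD2r ger_pMr.
  by apply/seteqP; split=> x /= H i; have := H i; rewrite E.
rewrite lebesgue_tuple_affine//; last by move=> i; rewrite tnth_mktuple.
under eq_bigr do rewrite tnth_mktuple.
rewrite big_const_ord iter_mulr_1 => E.
rewrite -[LHS]mul1e -(@mulfV _ (r ^+ d)) ?expf_neq0 ?gt_eqF// EFinM -muleA.
by rewrite E mule1.
Qed.

Lemma enorm_coord d (x : d.-tuple R) i : `|tnth x i| <= enorm x.
Proof.
rewrite /enorm -sqrtr_sqr; apply: ler_wsqrtr; rewrite /edot (bigD1 i)//= expr2 lerDl.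
by apply: sumr_ge0 => j _; rewrite -expr2 sqr_ge0.
Qed.

Lemma measurable_ball_enorm d (rho : R) : measurable [set x : d.-tuple R | enorm x <= rho].
Proof.
rewrite (_ : [set x | _] = @enorm R d @^-1` `]-oo, rho]).
  by rewrite -[X in measurable X]setTI; exact: measurable_enorm.
by apply/seteqP; split=> x /=; rewrite in_itv.
Qed.

Lemma lebesgue_tuple_ball_fin d (rho : R) :
  (@lebesgue_tuple R d [set x : d.-tuple R | (enorm x <= rho)%R] < +oo)%E.
Proof.
(* The extra [1] keeps the side positive whatever the sign of [rho] and makes the lower inequality
   of the half-open cube strict. *)
pose r := `|rho| + 1.
have r0 : 0 < r by rewrite ltr_wpDl.
pose b : d.-tuple R := [tuple - r | _ < d].
pose A := [set x : d.-tuple R | forall i, tnth b i < tnth x i <= tnth b i + (r + r)].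
apply: (@le_lt_trans _ _ (lebesgue_tuple A)).
  apply: le_measure; rewrite ?inE; first exact: measurable_ball_enorm.
    have := measurable_box b [tuple tnth b i + (r + r) | i < d].
    rewrite (_ : [set x | _] = A)//.
    by apply/seteqP; split=> x /= H i; have := H i; rewrite !tnth_mktuple.
  move=> x /= xr i; rewrite !tnth_mktuple addrA addNr add0r.
  have : `|tnth x i| < r.
    apply: (le_lt_trans (enorm_coord x i)); apply: (le_lt_trans xr).
    by rewrite /r ltr_pwDr// ler_norm.
  by rewrite ltr_norml => /andP[-> /ltW ->].
by rewrite lebesgue_tuple_cube ?ltry// addr_gt0.
Qed.

End boxes.

(** * Euclidean norm and inner product *)

Section euclidean_geometry.
Context {R : realType} {d : nat}.
Implicit Types x y z : d.-tuple R.

Definition tsub x y : d.-tuple R := [tuple tnth x i - tnth y i | i < d].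

Lemma edot_ge0 x : 0 <= edot x x.
Proof. by apply: sumr_ge0 => i _; rewrite -expr2 sqr_ge0. Qed.

Lemma enorm_ge0 x : 0 <= enorm x. Proof. exact: sqrtr_ge0. Qed.

Lemma sqr_enorm x : enorm x ^+ 2 = edot x x.
Proof. by rewrite sqr_sqrtr// edot_ge0. Qed.

Lemma enormE x : enorm x = Num.sqrt (\sum_(i < d) tnth x i ^+ 2).
Proof. by rewrite /enorm /edot; congr Num.sqrt; apply: eq_bigr => i _; rewrite expr2. Qed.

Lemma euclid_distE x y : euclid_dist x y = enorm (tsub x y).
Proof.
by rewrite /euclid_dist enormE; congr Num.sqrt; apply: eq_bigr => i _; rewrite tnth_mktuple.
Qed.

Lemma euclid_dist_ge0 x y : 0 <= euclid_dist x y. Proof. exact: sqrtr_ge0. Qed.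

Lemma euclid_distC x y : euclid_dist x y = euclid_dist y x.
Proof.
by rewrite /euclid_dist; congr Num.sqrt; apply: eq_bigr => i _; rewrite -sqrrN opprB.
Qed.

Lemma enorm_eq0 x : (enorm x == 0) = (x == origin).
Proof.
apply/idP/eqP => [/eqP x0|->].
  apply: eq_from_tnth => i; rewrite tnth_mktuple; apply/eqP.
  by rewrite -normr_eq0 eq_le normr_ge0 andbT -x0 enorm_coord.
by rewrite enormE big1 ?sqrtr0// => i _; rewrite tnth_mktuple expr0n.
Qed.

Lemma edot0l x y : enorm x = 0 -> edot x y = 0.
Proof.
move=> /eqP; rewrite enorm_eq0 => /eqP ->.
by rewrite /edot big1// => i _; rewrite tnth_mktuple mul0r.
Qed.

Lemma edotC x y : edot x y = edot y x.
Proof. by apply: eq_bigr => i _; rewrite mulrC. Qed.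

(** Cauchy-Schwarz, obtained by summing $\frac{XY}{2}(x_i/X-y_i/Y)^2\ge0$ with [X], [Y] the two
    norms. *)
Lemma edot_le x y : edot x y <= enorm x * enorm y.
Proof.
have [x0|x0] := eqVneq (enorm x) 0; first by rewrite edot0l// x0 mul0r.
have [y0|y0] := eqVneq (enorm y) 0; first by rewrite edotC edot0l// y0 mulr0.
set X := enorm x in x0 *; set Y := enorm y in y0 *.
have Xp : 0 < X by rewrite lt0r x0 enorm_ge0.
have Yp : 0 < Y by rewrite lt0r y0 enorm_ge0.
apply: (@le_trans _ _ (\sum_(i < d) (X * Y / 2) * (X ^- 2 * (tnth x i * tnth x i) + Y ^- 2 * (tnth y i * tnth y i)))).
  apply: ler_sum => i _; set a := tnth x i; set b := tnth y i.
  rewrite -subr_ge0 (_ : _ - _ = X * Y / 2 * (a / X - b / Y) ^+ 2).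
    by rewrite mulr_ge0 ?sqr_ge0// divr_ge0// mulr_ge0// ltW.
  by field; apply/andP.
rewrite -mulr_sumr big_split/= -!mulr_sumr -!/(edot _ _) -!sqr_enorm -/X -/Y.
by rewrite !mulVf ?expf_neq0// -mulrA mulVf// mulr1.
Qed.

Lemma enormZ (c : R) x : enorm [tuple c * tnth x i | i < d] = `|c| * enorm x.
Proof.
rewrite -[`|c|]sqrtr_sqr !enormE -sqrtrM ?sqr_ge0//; congr Num.sqrt.
by rewrite mulr_sumr; apply: eq_bigr => i _; rewrite tnth_mktuple exprMn.
Qed.

Lemma edot_norm_le x y : `|edot x y| <= enorm x * enorm y.
Proof.
rewrite ler_norml edot_le andbT lerNl.
have := edot_le [tuple (-1) * tnth x i | i < d] y.
rewrite enormZ normrN1 mul1r; apply: le_trans.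
rewrite /edot -sumrN; apply: ler_sum => i _.
by rewrite tnth_mktuple mulN1r mulNr.
Qed.

Lemma enorm_le_sub x y : enorm x <= enorm y + enorm (tsub x y).
Proof.
rewrite -ler_sqr ?nnegrE ?addr_ge0 ?enorm_ge0//.
rewrite sqrrD !sqr_enorm.
have -> : edot x x = edot y y + edot y (tsub x y) *+ 2 + edot (tsub x y) (tsub x y).
  rewrite /edot mulr2n -!big_split/=; apply: eq_bigr => i _.
  rewrite !tnth_mktuple; ring.
by rewrite lerD2r lerD2l lerMn2r edot_le orbT.
Qed.

Lemma enorm_le_norm x y : (forall i, `|tnth x i| <= `|tnth y i|) -> enorm x <= enorm y.
Proof.
move=> h; rewrite !enormE; apply: ler_wsqrtr; apply: ler_sum => i _.
by rewrite -real_normK ?num_real// -[leRHS]real_normK ?num_real// lerXn2r ?nnegrE.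
Qed.

(** The factor [d] in place of its square root is crude, but constants never matter below;
    [d <= d ^ 2] holds for every natural number. *)
Lemma enorm_le_coord x (c : R) : 0 <= c -> (forall i, `|tnth x i| <= c) -> enorm x <= d%:R * c.
Proof.
move=> c0 h; rewrite -ler_sqr ?nnegrE ?enorm_ge0 ?mulr_ge0//.
rewrite sqr_enorm (@le_trans _ _ (\sum_(i < d) c ^+ 2))//.
  apply: ler_sum => i _; rewrite -expr2 -real_normK ?num_real//.
  by rewrite lerXn2r ?nnegrE.
rewrite sumr_const card_ord exprMn -[leLHS]mulr_natl; apply: ler_wpM2r; first exact: sqr_ge0.
rewrite -natrX ler_nat; case: (d) => // n; by rewrite expnS expn1 leq_pmull.
Qed.

Lemma enorm0 : enorm (origin : d.-tuple R) = 0.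
Proof. by apply/eqP; rewrite enorm_eq0. Qed.

End euclidean_geometry.

(** * Integrals of bounded functions with bounded support *)

Section bounded_support.
Context {R : realType} {d : nat}.
Local Notation leb := (@lebesgue_tuple R d).
Implicit Types f g : d.-tuple R -> R.

Definition lint f : R := \int[leb]_x f x.

Definition ballI (rho : R) : d.-tuple R -> R := fun x => ((enorm x <= rho)%R)%:R.

(** A subclass of the integrable functions, stable under sums, bounded measurable factors and affine
    changes of variable, so that membership settles all integrability conditions. A multiple of a
    ball indicator encodes boundedness and bounded support at once. *)
Definition bsupp f : Prop := measurable_fun setT f /\
  exists M rho : R, forall x, `|f x| <= M * ballI rho x.

Lemma measurable_ballI rho : measurable_fun setT (ballI rho).
Proof.
rewrite (_ : ballI rho = \1_[set x : d.-tuple R | (enorm x <= rho)%R]).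
  exact: measurable_indic (measurable_ball_enorm _).
by apply/funext => x; rewrite indicE mem_setE.
Qed.

Lemma ballI_ge0 rho x : 0 <= ballI rho x. Proof. exact: ler0n. Qed.

Lemma ballI_le rho rho' x : rho <= rho' -> ballI rho x <= ballI rho' x.
Proof. by move=> h; rewrite /ballI ler_nat; case: leP => // /le_trans /(_ h) ->. Qed.

Lemma bsupp_ball rho : bsupp (ballI rho).
Proof.
split; first exact: measurable_ballI.
by exists 1, rho => x; rewrite mul1r ger0_norm// ballI_ge0.
Qed.

Lemma bsuppP f : bsupp f -> exists M rho : R, 0 <= M /\ forall x, `|f x| <= M * ballI rho x.
Proof.
move=> [_ [M [rho H]]]; exists `|M|, rho; split=> // x.
by apply: (le_trans (H x)); rewrite ler_wpM2r ?ballI_ge0 ?ler_norm.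
Qed.

Lemma bsupp_integrable f : bsupp f -> leb.-integrable setT (EFin \o f).
Proof.
move=> bf; have [M [rho [M0 H]]] := bsuppP bf; case: bf => mf _.
apply: (@le_integrable _ _ _ _ _ measurableT _ (fun x => (M * ballI rho x)%:E)).
- exact/measurable_EFinP.
- by move=> x _ /=; rewrite lee_fin [leRHS]ger0_norm ?mulr_ge0 ?ballI_ge0.
- apply: (@integrableZl _ _ _ leb setT measurableT M (fun x => (ballI rho x)%:E)); apply/integrableP; split.
    by apply/measurable_EFinP; exact: measurable_ballI.
  rewrite (_ : (fun x => _) = fun x => (\1_[set x : d.-tuple R | (enorm x <= rho)%R] x)%:E).
    rewrite integral_indic//; last exact: measurable_ball_enorm.
    by rewrite setIT lebesgue_tuple_ball_fin.
  by apply/funext => x; rewrite /= indicE mem_setE ger0_norm// ballI_ge0.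
Qed.

Lemma bsupp_le f g : measurable_fun setT f -> bsupp g -> (forall x, `|f x| <= `|g x|) -> bsupp f.
Proof.
move=> mf [_ [M [rho H]]] fg; split => //; exists M, rho => x.
exact: le_trans (fg x) (H x).
Qed.

Lemma bsuppZ (k : R) f : bsupp f -> bsupp (fun x => k * f x).
Proof.
move=> [mf [M [rho H]]]; split; first exact: measurable_funM.
exists (`|k| * M), rho => x; by rewrite normrM -mulrA ler_wpM2l.
Qed.

Lemma bsuppN f : bsupp f -> bsupp (fun x => - f x).
Proof.
move=> /(bsuppZ (-1)) h; rewrite (_ : (fun x => _) = fun x => -1 * f x)//.
by apply/funext => x; rewrite mulN1r.
Qed.

Lemma bsuppD f g : bsupp f -> bsupp g -> bsupp (fun x => f x + g x).
Proof.
move=> bf bg; have [M [rho [M0 H]]] := bsuppP bf; have [M' [rho' [M'0 H']]] := bsuppP bg.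
split; first by apply: measurable_funD; [exact: bf.1|exact: bg.1].
exists (M + M'), (Num.max rho rho') => x; apply: (le_trans (ler_normD _ _)).
rewrite mulrDl; apply: lerD.
  by apply: (le_trans (H x)); rewrite ler_wpM2l// ballI_le// le_max lexx.
by apply: (le_trans (H' x)); rewrite ler_wpM2l// ballI_le// le_max lexx orbT.
Qed.

Lemma bsuppB f g : bsupp f -> bsupp g -> bsupp (fun x => f x - g x).
Proof. by move=> bf /bsuppN; exact: bsuppD. Qed.

Lemma bsupp0 : bsupp (fun=> 0).
Proof. by split => //; exists 0, 0 => x; rewrite normr0 mul0r. Qed.

Lemma bsupp_sum I (s : seq I) (F : I -> d.-tuple R -> R) :
  (forall i, bsupp (F i)) -> bsupp (fun x => \sum_(i <- s) F i x).
Proof.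
move=> h; elim: s => [|i s IH].
  by under [X in bsupp X]funext do rewrite big_nil; exact: bsupp0.
by under [X in bsupp X]funext do rewrite big_cons; exact: bsuppD.
Qed.

Lemma bsuppM (C : R) (k f : d.-tuple R -> R) : bsupp f -> measurable_fun setT k -> (forall x, `|k x| <= C) ->
  bsupp (fun x => f x * k x).
Proof.
move=> [mf [M [rho H]]] mk kC; split; first exact: measurable_funM.
exists (M * C), rho => x; rewrite normrM mulrAC.
by apply: ler_pM.
Qed.

Lemma lintD f g : bsupp f -> bsupp g -> lint (fun x => f x + g x) = lint f + lint g.
Proof. by move=> bf bg; rewrite /lint RintegralD//; exact: bsupp_integrable. Qed.

Lemma lintB f g : bsupp f -> bsupp g -> lint (fun x => f x - g x) = lint f - lint g.
Proof. by move=> bf bg; rewrite /lint RintegralB//; exact: bsupp_integrable. Qed.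

Lemma lintZ (k : R) f : bsupp f -> lint (fun x => k * f x) = k * lint f.
Proof. by move=> bf; rewrite /lint RintegralZl//; exact: bsupp_integrable. Qed.

Lemma lint0 : lint (fun=> 0) = 0.
Proof. by rewrite /lint /Rintegral integral0. Qed.

Lemma lint_sum I (s : seq I) (F : I -> d.-tuple R -> R) :
  (forall i, bsupp (F i)) -> lint (fun x => \sum_(i <- s) F i x) = \sum_(i <- s) lint (F i).
Proof.
move=> h; elim: s => [|i s IH].
  rewrite big_nil -[RHS]lint0; congr lint; apply/funext => x; by rewrite big_nil.
rewrite big_cons -IH -lintD//; last exact: bsupp_sum.
by congr lint; apply/funext => x; rewrite big_cons.
Qed.

Lemma lint_le f g : bsupp f -> bsupp g -> (forall x, f x <= g x) -> lint f <= lint g.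
Proof. by move=> bf bg fg; rewrite /lint le_Rintegral//; exact: bsupp_integrable. Qed.

Lemma lint_ge0 f : (forall x, 0 <= f x) -> 0 <= lint f.
Proof. by move=> f0; exact: Rintegral_ge0. Qed.

Lemma lint_bound f g : bsupp f -> bsupp g -> (forall x, `|f x| <= g x) -> `|lint f| <= lint g.
Proof.
move=> bf bg fg; apply: (@le_trans _ _ (lint (fun x => `|f x|))).
  by apply: le_normr_Rintegral => //; exact: bsupp_integrable.
apply: lint_le => //.
apply: (bsupp_le _ bf) => [|x]; last by rewrite normr_id.
by apply: measurableT_comp bf.1.
Qed.

Lemma bsupp_affine (c b : d.-tuple R) f : (forall i, 0 < tnth c i) ->
  bsupp f -> bsupp (f \o affine c b).
Proof.
move=> c0 bf; have [M [rho [M0 H]]] := bsuppP bf; case: bf => mf _.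
split; first exact: (measurableT_comp mf (measurable_affine c b)).
(* Each summand bounds one coordinate of a point whose image lies in the ball of radius [rho]; the
   sum bounds them all. *)
pose C := \sum_(i < d) ((tnth c i)^-1 * (`|rho| + `|tnth b i|)).
have sge0 i : 0 <= ((tnth c i)^-1 * (`|rho| + `|tnth b i|)).
  by rewrite mulr_ge0 ?invr_ge0 ?addr_ge0// ltW.
exists M, (d%:R * C) => x; apply: (le_trans (H _)); rewrite ler_wpM2l//.
rewrite /ballI; case: (leP (enorm (affine c b x)) rho) => [h|_]; last exact: (ler0n R _).
rewrite (_ : enorm x <= _)//; apply: enorm_le_coord; first exact: sumr_ge0.
move=> i; apply: (@le_trans _ _ ((tnth c i)^-1 * (`|rho| + `|tnth b i|))); last first.
  by rewrite /C (bigD1 i)//= lerDl; exact: sumr_ge0.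
rewrite ler_pdivlMl// -[X in X * _]gtr0_norm// -normrM.
rewrite (_ : tnth c i * tnth x i = tnth (affine c b x) i - tnth b i); last first.
  by rewrite tnth_mktuple addrK.
apply: (le_trans (ler_normB _ _)); rewrite lerD2r.
by apply: (le_trans (enorm_coord _ _)); apply: (le_trans h); exact: ler_norm.
Qed.

Lemma lint_affine (c b : d.-tuple R) f : (forall i, 0 < tnth c i) -> bsupp f ->
  lint (f \o affine c b) = (\prod_(i < d) tnth c i)^-1 * lint f.
Proof. by move=> c0 bf; apply: Rintegral_affine => //; exact: bsupp_integrable. Qed.

(** A cube with corner [z] fits into the ball of radius [r] and contributes at least [c] times its
    volume. *)
Lemma lint_gt0 f z (c r : R) : bsupp f -> (forall x, 0 <= f x) -> 0 < c -> 0 < r ->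
  (forall x, euclid_dist x z <= r -> c <= f x) -> 0 < lint f.
Proof.
move=> bf f0 c0 r0 H.
(* By [enorm_le_coord] a cube of this side stays within distance [r] of its corner; [d.+1] also
   covers [d = 0]. *)
pose q := r / d.+1%:R.
have q0 : 0 < q by rewrite divr_gt0.
pose A := [set x : d.-tuple R | forall i, tnth z i < tnth x i <= tnth z i + q].
have mA : measurable A.
  have := measurable_box z [tuple tnth z i + q | i < d].
  by rewrite (_ : [set x | _] = A)//; apply/seteqP; split=> x /= K i; have := K i; rewrite tnth_mktuple.
have AE : lebesgue_tuple A = (q ^+ d)%:E by exact: lebesgue_tuple_cube.
have : ((c * q ^+ d)%:E <= \int[leb]_x (f x)%:E)%E.
  rewrite EFinM -AE -[X in (_ * lebesgue_tuple X)%E]setIT -integral_indic// -ge0_integralZl_EFin//; last 2 first.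
    exact/measurable_EFinP/measurable_indic.
    exact: ltW.
  apply: ge0_le_integral => //.
  - by move=> x _; rewrite -EFinM lee_fin mulr_ge0 ?indicE ?ler0n// ltW.
  - by apply: measurable_funeM; apply/measurable_EFinP; exact: measurable_indic.
  - by apply/measurable_EFinP; exact: bf.1.
  - move=> x _; rewrite -EFinM lee_fin indicE; case: (boolP (x \in A)) => xA; last by rewrite mulr0.
    rewrite mulr1; apply: H; rewrite euclid_distE.
    apply: (@le_trans _ _ (d%:R * q)).
      apply: enorm_le_coord; first exact: ltW.
      move=> i; rewrite tnth_mktuple; move: xA; rewrite inE => /(_ i) /andP[xz xq].
      by rewrite ger0_norm ?subr_ge0 ?(ltW xz)// lerBlDl.
    by rewrite /q mulrCA ger_pMr// ler_pdivrMr// mul1r ler_nat.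
rewrite /lint /Rintegral; have := integrable_fin_num measurableT (bsupp_integrable bf).
move=> fin h; rewrite -lte_fin fineK//; apply: lt_le_trans h.
by rewrite lte_fin mulr_gt0// exprn_gt0.
Qed.

End bounded_support.

(** * Anisotropic dilations *)

Section min_exponent.
Context {R : realType} {d : nat} (a : d.-tuple R).

(** The starting value [1] is the average of the exponents, so for [d > 0] the result is their true
    minimum, and [amin <= 1] holds by construction. *)
Definition amin : R := \big[Num.min/1]_(j < d) tnth a j.

Lemma amin_le j : amin <= tnth a j.
Proof. by rewrite /amin; apply: bigmin_le_cond. Qed.

Lemma amin_le1 : amin <= 1.
Proof. by rewrite /amin; apply: bigmin_le_id. Qed.

Lemma amin_gt0 : (forall j, 0 < tnth a j) -> 0 < amin.
Proof. by move=> a0; rewrite /amin; elim/big_ind: _ => // x y x0 y0; rewrite lt_min x0. Qed.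
End min_exponent.

Section dilations.
Context {R : realType} {d : nat} (a : d.-tuple R).
Hypothesis a0 : forall j, 0 < tnth a j.
Implicit Types (x y : d.-tuple R) (s t : R).

Lemma tnth_dil t x j : tnth (dil a t x) j = t `^ (- tnth a j) * tnth x j.
Proof. by rewrite tnth_mktuple. Qed.

Lemma dil1 x : dil a 1 x = x.
Proof. by apply: eq_from_tnth => j; rewrite tnth_dil powR1 mul1r. Qed.

Lemma dilM s t x : 0 <= s -> 0 <= t -> dil a s (dil a t x) = dil a (s * t) x.
Proof. by move=> s0 t0; apply: eq_from_tnth => j; rewrite !tnth_dil powRM// mulrA. Qed.

Lemma dilK t x : 0 < t -> dil a t^-1 (dil a t x) = x.
Proof. by move=> t0; rewrite dilM ?invr_ge0 ?ltW// mulVf ?gt_eqF// dil1. Qed.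

Lemma dil0 t : dil a t origin = origin.
Proof. by apply: eq_from_tnth => j; rewrite tnth_dil !tnth_mktuple mulr0. Qed.

Lemma dil_eq0 t x : 0 < t -> (dil a t x == origin) = (x == origin).
Proof.
move=> t0; apply/eqP/eqP => [E|->]; last exact: dil0.
by rewrite -(dilK x t0) E dil0.
Qed.

Lemma dil_affine t : dil a t = affine [tuple t `^ (- tnth a j) | j < d] [tuple 0 | _ < d].
Proof.
by apply/funext => x; apply: eq_from_tnth => j; rewrite tnth_dil !tnth_mktuple addr0.
Qed.

Lemma dil_tsub t x y : dil a t (tsub x y) = tsub (dil a t x) (dil a t y).
Proof. by apply: eq_from_tnth => j; rewrite !tnth_mktuple mulrBr. Qed.

(** For [s >= 1] each coordinate shrinks at least at the rate of the smallest exponent. Existence,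
    uniqueness and monotonicity of [eta] all rest on this contraction. *)
Lemma enorm_dil_le s x : 1 <= s -> enorm (dil a s x) <= s `^ (- amin a) * enorm x.
Proof.
move=> s1; have s0 : 0 < s by exact: lt_le_trans s1.
rewrite -[X in X * _]ger0_norm ?powR_ge0// -enormZ.
apply: enorm_le_norm => i; rewrite tnth_dil tnth_mktuple !normrM ler_wpM2r//.
by rewrite !ger0_norm ?powR_ge0// ler_powR// lerN2 amin_le.
Qed.

Lemma enorm_dil_le1 s x : 1 <= s -> enorm (dil a s x) <= enorm x.
Proof.
move=> s1; apply: (le_trans (enorm_dil_le x s1)).
rewrite ler_piMl ?enorm_ge0// -(powRr0 s) ler_powR// oppr_le0 ltW// amin_gt0//.
Qed.

Lemma enorm_dil_ge s x : 0 < s -> s <= 1 -> s `^ (- amin a) * enorm x <= enorm (dil a s x).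
Proof.
move=> s0 s1; have h : 1 <= s^-1 by rewrite invf_ge1.
have := enorm_dil_le (dil a s x) h; rewrite dilK//.
have -> : s^-1 `^ (- amin a) = s `^ amin a.
  by rewrite -powR_inv1 ?(ltW s0)// -powRrM mulN1r opprK.
by move=> H; rewrite powRN ler_pdivrMl ?powR_gt0.
Qed.

Lemma sqr_enorm_dil x t : 0 <= t ->
  \sum_(j < d) tnth x j ^+ 2 * t `^ (- (2 * tnth a j)) = enorm (dil a t x) ^+ 2.
Proof.
move=> t0; rewrite sqr_enorm; apply: eq_bigr => j _.
by rewrite tnth_dil -mulrN mulrC mulrC [2 * _]mulrC powRrM powR_mulrn ?powR_ge0// -expr2 exprMn mulrC.
Qed.

(** Intermediate value theorem in the logarithm of the dilation parameter, where the squared norm is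
    a sum of exponentials. *)
Lemma eta_exists x : x != origin -> exists t, 0 < t /\ enorm (dil a t x) = 1.
Proof.
move=> x0; have X0 : 0 < enorm x by rewrite lt0r enorm_eq0 x0 enorm_ge0.
pose F (s : R) := \sum_(j < d) tnth x j ^+ 2 * expR (s * (- (2 * tnth a j))).
have FE s : F s = enorm (dil a (expR s) x) ^+ 2.
  by rewrite -sqr_enorm_dil ?expR_ge0//; apply: eq_bigr => j _; rewrite expRM.
have cF : continuous F.
  apply: continuous_big => [|j _]; first exact: add_continuous.
  move=> s; apply: cvgM; first exact: cvg_cst.
  apply: (continuous_comp (f := fun s => s * (- (2 * tnth a j)))); last exact: continuous_expR.
  apply: continuousM; [exact: cvg_id|exact: cst_continuous].
(* With this [L] the guaranteed factors $e^{\pm L\,\mathrm{amin}}$ outweigh the norm of [x], so that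
   the values at [- L] and [L] lie on either side of [1]. *)
pose L := `|ln (enorm x)| / amin a.
have L0 : 0 <= L by rewrite divr_ge0// ltW// amin_gt0.
have LE : L * amin a = `|ln (enorm x)| by rewrite /L divfK// gt_eqF// amin_gt0.
have F1 : 1 <= F (- L).
  rewrite FE -[leLHS](expr1n _ 2) ler_sqr ?nnegrE ?enorm_ge0//.
  apply: le_trans (enorm_dil_ge x (expR_gt0 _) _); last first.
    by rewrite -expR0 ler_expR oppr_le0.
  rewrite -expRM mulrNN LE -[X in _ <= _ * X](lnK X0) -expRD -[leLHS]expR0 ler_expR.
  by rewrite -lerBlDr sub0r ler_normr lexx orbT.
have F2 : F L <= 1.
  rewrite FE -[leRHS](expr1n _ 2) ler_sqr ?nnegrE ?enorm_ge0//.
  apply: (le_trans (enorm_dil_le x _)); first by rewrite -expR0 ler_expR.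
  rewrite -expRM mulrN LE -[X in _ * X <= _](lnK X0) -expRD -[leRHS]expR0 ler_expR.
  by rewrite addrC subr_le0 ler_norm.
have LL : - L <= L by rewrite (@le_trans _ _ 0)// oppr_le0.
have : Num.min (F (- L)) (F L) <= 1 <= Num.max (F (- L)) (F L).
  by rewrite ge_min F2 orbT le_max F1.
move=> /(IVT LL (continuous_subspaceT cF))[s _ Fs].
exists (expR s); split; first exact: expR_gt0.
apply/eqP; rewrite -(@eqrXn2 _ 2) ?enorm_ge0// expr1n -Fs FE//.
Qed.

Lemma dil_norm1_unique x s t : 0 < s -> 0 < t ->
  enorm (dil a s x) = 1 -> enorm (dil a t x) = 1 -> s = t.
Proof.
suff H u v : 0 < u -> 0 < v -> enorm (dil a u x) = 1 -> enorm (dil a v x) = 1 -> v <= u.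
  by move=> s0 t0 Es Et; apply/eqP; rewrite eq_le !H.
move=> u0 v0 Eu Ev; rewrite leNgt; apply/negP => uv.
have h : 1 < v / u by rewrite ltr_pdivlMr// mul1r.
have := enorm_dil_le (dil a u x) (ltW h).
rewrite dilM ?divr_ge0 ?(ltW u0) ?(ltW v0)// divfK ?gt_eqF// Eu Ev mulr1.
rewrite leNgt => /negP; apply; rewrite powRN invf_lt1 ?powR_gt0 ?(lt_trans ltr01)//.
rewrite -(powRr0 (v / u)) /powR (gt_eqF (lt_trans ltr01 h)) ltr_expR mul0r mulr_gt0 ?amin_gt0//.
exact: ln_gt0.
Qed.

Lemma etaP x : x != origin -> 0 < eta a x /\ enorm (dil a (eta a x) x) = 1.
Proof.
move=> /eta_exists[t [t0 Et]]; rewrite /eta; set P := [set t | _].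
have Pt : P t by split=> //; rewrite sqr_enorm_dil ?Et ?expr1n// ltW.
have [s0] := xgetI 0 Pt; rewrite sqr_enorm_dil ?(ltW s0)// => Es; split => //.
by apply/eqP; rewrite -(@eqrXn2 _ 2) ?enorm_ge0// expr1n Es.
Qed.

Lemma eta_gt0 x : x != origin -> 0 < eta a x. Proof. by move=> /etaP[]. Qed.

Lemma sphere_eta_dir x : x != origin -> sphere (eta_dir a x).
Proof. by move=> /etaP[]. Qed.

Lemma eta_origin : eta a origin = 0.
Proof.
rewrite /eta xgetPN// => t [t0]; rewrite big1 => [/eqP|j _].
  by rewrite eq_sym oner_eq0.
by rewrite tnth_mktuple expr0n mul0r.
Qed.

Lemma eta_ge0 x : 0 <= eta a x.
Proof. by have [->|/eta_gt0/ltW//] := eqVneq x origin; rewrite eta_origin. Qed.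

Lemma eta_uniq x t : 0 < t -> enorm (dil a t x) = 1 -> eta a x = t.
Proof.
move=> t0 Et; have x0 : x != origin.
  apply/eqP => xE; move: Et; rewrite xE dil0 enorm0 => /eqP.
  by rewrite eq_sym oner_eq0.
have [e0 Ee] := etaP x0; exact: dil_norm1_unique Ee Et.
Qed.

Lemma eta_sphere x : sphere x -> eta a x = 1.
Proof. by move=> xS; apply: eta_uniq => //; rewrite dil1. Qed.

Lemma eta_dir_sphere x : sphere x -> eta_dir a x = x.
Proof. by move=> xS; rewrite /eta_dir eta_sphere// dil1. Qed.

Lemma eta_dil s x : 0 < s -> eta a (dil a s x) = eta a x / s.
Proof.
move=> s0; have [->|x0] := eqVneq x origin; first by rewrite dil0 eta_origin mul0r.
have [e0 Ee] := etaP x0; apply: eta_uniq; first by rewrite divr_gt0.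
by rewrite dilM ?divr_ge0 ?ltW// divfK ?gt_eqF.
Qed.

Lemma eta_dir_dil s x : 0 < s -> eta_dir a (dil a s x) = eta_dir a x.
Proof.
move=> s0; rewrite /eta_dir eta_dil// dilM ?divr_ge0 ?eta_ge0 ?ltW//.
by rewrite divfK// gt_eqF.
Qed.

(** The norm decreases along a dilation orbit, so sublevel sets of [eta] are dilated unit balls.
    Measurability of [eta] follows without any continuity argument. *)
Lemma eta_le x t : 0 < t -> (eta a x <= t) = (enorm (dil a t x) <= 1).
Proof.
move=> t0; have [->|x0] := eqVneq x origin.
  by rewrite eta_origin dil0 enorm0 ler01 ltW.
have [e0 Ee] := etaP x0.
apply/idP/idP => [h|].
  have -> : t = t / eta a x * eta a x by rewrite divfK// gt_eqF.
  rewrite -dilM ?divr_ge0 ?(ltW t0) ?(ltW e0)//.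
  by rewrite -Ee; apply: enorm_dil_le1; rewrite ler_pdivlMr// mul1r.
apply: contraTT; rewrite -!ltNge => h.
rewrite -Ee.
have h1 : 1 < eta a x / t by rewrite ltr_pdivlMr// mul1r.
have -> : eta a x = eta a x / t * t by rewrite divfK// gt_eqF.
rewrite -dilM ?divr_ge0 ?(ltW t0) ?(ltW e0)//.
have y0 : 0 < enorm (dil a t x) by rewrite lt0r enorm_ge0 enorm_eq0 dil_eq0 ?x0.
apply: (le_lt_trans (enorm_dil_le _ (ltW h1))).
rewrite -[ltRHS]mul1r ltr_pM2r// powRN invf_lt1 ?powR_gt0 ?(lt_trans ltr01)//.
rewrite -(powRr0 (eta a x / t)) /powR (gt_eqF (lt_trans ltr01 h1)) ltr_expR mul0r mulr_gt0 ?amin_gt0//.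
exact: ln_gt0.
Qed.

Lemma eta_le1 x : (eta a x <= 1) = (enorm x <= 1).
Proof. by rewrite eta_le// dil1. Qed.

Lemma measurable_dil_fun (f : d.-tuple R -> R) : measurable_fun setT f ->
  measurable_fun setT (fun x => dil a (f x) x).
Proof.
move=> mf; apply/measurable_fun_tnthP => j.
rewrite (_ : _ \o _ = fun x => f x `^ (- tnth a j) * tnth x j); last first.
  by apply/funext => x /=; rewrite tnth_mktuple.
apply: measurable_funM; last exact: measurable_tnth.
exact: (measurableT_comp (measurable_powR _) mf).
Qed.

Lemma measurable_eta : measurable_fun setT (eta a).
Proof.
suff mle t : measurable [set x | eta a x <= t].
  apply: (measurability _ (RGenOInfty.measurableE R)) => _ [_ [t ->] <-]; rewrite setTI.
  rewrite (_ : _ @^-1` _ = ~` [set x | eta a x <= t]); first exact: measurableC.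
  by apply/seteqP; split=> x /=; rewrite in_itv/= andbT ltNge => /negP.
have [t0|t0] := ltP 0 t.
  rewrite (_ : [set x | _] = (dil a t) @^-1` [set x | enorm x <= 1]).
    rewrite -[X in measurable X]setTI.
    by apply: (measurable_dil_fun (f := cst t)) => //; exact: measurable_ball_enorm.
  by apply/seteqP; split=> x /=; rewrite eta_le.
(* The default value [0] of [eta] is taken at the origin only. *)
have [->|t0'] := eqVneq t 0.
  rewrite (_ : [set x | _] = [set x | enorm x <= 0]); first exact: measurable_ball_enorm.
  apply/seteqP; split=> x /=; last first.
    move=> h; have /eqP : enorm x = 0 by apply/eqP; rewrite eq_le h enorm_ge0.
    by rewrite enorm_eq0 => /eqP ->; rewrite eta_origin.
  have [->|/eta_gt0] := eqVneq x origin; first by rewrite enorm0.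
  by rewrite ltNge => /negbTE ->.
rewrite (_ : [set x | _] = set0); first exact: measurable0.
apply/seteqP; split=> x //= h.
have := le_trans (eta_ge0 x) h.
by move=> t0''; move: t0'; rewrite eq_le t0 t0''.
Qed.

Lemma measurable_eta_dir : measurable_fun setT (eta_dir a).
Proof. exact: (measurable_dil_fun measurable_eta). Qed.

Hypothesis asum : \sum_(j < d) tnth a j = d%:R.

(** Here the normalization of the exponents enters: the Jacobian of a dilation depends on their sum
    alone. *)
Lemma prod_dil t : 0 < t -> (\prod_(j < d) t `^ (- tnth a j))^-1 = t ^+ d.
Proof.
move=> t0.
have -> : \prod_(j < d) t `^ (- tnth a j) = expR (\sum_(j < d) (- tnth a j * ln t)).
  by rewrite expR_sum; apply: eq_bigr => j _; rewrite /powR gt_eqF.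
rewrite -mulr_suml sumrN asum -expRN mulNr opprK mulrC.
by rewrite expRM lnK// powR_mulrn// ltW.
Qed.

Lemma bsupp_dil t (f : d.-tuple R -> R) : 0 < t -> bsupp f -> bsupp (f \o dil a t).
Proof.
move=> t0 bf; rewrite dil_affine; apply: bsupp_affine => // i.
by rewrite tnth_mktuple powR_gt0.
Qed.

Lemma lint_dil t (f : d.-tuple R -> R) : 0 < t -> bsupp f ->
  lint (f \o dil a t) = t ^+ d * lint f.
Proof.
move=> t0 bf; rewrite dil_affine lint_affine//; last first.
  by move=> i; rewrite tnth_mktuple powR_gt0.
by under eq_bigr do rewrite tnth_mktuple; rewrite prod_dil.
Qed.

End dilations.

(** * Open sets and measurability of Hoelder functions on the sphere *)

Section open_sets.
Context {R : realType} {d : nat}.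
Implicit Types (x y : d.-tuple R).

(** The product sigma-algebra knows coordinates only, so an open set is written as the countable
    union of the boxes inside it that have rational centre and half-side $1/(n+1)$. *)
Lemma measurable_open_tuple (U : set (d.-tuple R)) :
  (forall x, U x -> exists2 r : R, 0 < r & forall y, euclid_dist y x < r -> U y) ->
  measurable U.
Proof.
move=> oU.
pose box (p : d.-tuple rat * nat) := [set x : d.-tuple R | forall i, `|tnth x i - ratr (tnth p.1 i)| < p.2.+1%:R^-1].
pose F p := [set x : d.-tuple R | box p x /\ box p `<=` U].
have mbox p : measurable (box p).
  rewrite (_ : box p = \bigcap_(i in @setT 'I_d)
     ((fun x : d.-tuple R => `|tnth x i - ratr (tnth p.1 i)|) @^-1` `]-oo, p.2.+1%:R^-1[)).
    apply: fin_bigcap_measurable => // i _.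
    rewrite -[X in measurable X]setTI.
    have : measurable_fun setT (fun x : d.-tuple R => `|tnth x i - ratr (tnth p.1 i)|).
      apply: measurableT_comp => //.
      by apply: measurable_funB => //; exact: measurable_tnth.
    by apply.
  apply/seteqP; split=> x /= H i; first by move=> _; rewrite /= in_itv/=.
  by have := H i I; rewrite /= in_itv/=.
have -> : U = \bigcup_p F p.
  apply/seteqP; split=> [x Ux|x [p _ [pb pU]]]; last exact: pU.
  have [r r0 rU] := oU _ Ux.
  (* This makes any two points of one box closer than [r]. *)
  pose n := Num.truncn (d.+1%:R * 2 / r).
  have nr : d.+1%:R * (2 * n.+1%:R^-1) < r.
    by rewrite mulrA ltr_pdivrMr// -ltr_pdivrMl// mulrC; exact: truncnS_gt.
  have qE (i : 'I_d) : exists q : rat, `|tnth x i - ratr q| < n.+1%:R^-1.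
    have [|q] := @rat_in_itvoo R (tnth x i - n.+1%:R^-1) (tnth x i + n.+1%:R^-1).
      by rewrite ltrD2l (lt_trans (y := 0))// ?oppr_lt0 invr_gt0.
    rewrite in_itv/= => /andP[q1 q2]; exists q.
    by rewrite distrC ltr_distl q1.
  have [q qP] := choice qE.
  exists ([tuple q i | i < d], n) => //; split=> [i/=|y yb]; first by rewrite tnth_mktuple.
  apply: rU; apply: le_lt_trans nr.
  rewrite euclid_distE; apply: (@le_trans _ _ (d%:R * (2 * n.+1%:R^-1))); last first.
    by rewrite ler_wpM2r ?mulr_ge0 ?invr_ge0// ler_nat.
  apply: enorm_le_coord; first by rewrite mulr_ge0 ?invr_ge0.
  move=> i; rewrite tnth_mktuple; have := yb i; rewrite /= tnth_mktuple => yi.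
  have -> : tnth y i - tnth x i = (tnth y i - ratr (q i)) - (tnth x i - ratr (q i)) by ring.
  apply: (le_trans (ler_normB _ _)); rewrite mulrDl mul1r.
  by apply: lerD; exact: ltW.
apply: countable_bigcupT_measurable => [|p]; first exact: countableP.
have [pU|pU] := pselect (box p `<=` U).
  rewrite (_ : F p = box p)//; by apply/seteqP; split=> [x []|x].
rewrite (_ : F p = set0)//; by apply/seteqP; split=> [x []|x].
Qed.

Lemma measurable_sphere : measurable (@sphere R d).
Proof.
rewrite (_ : sphere = @enorm R d @^-1` [set 1]).
  rewrite -[X in measurable X]setTI; exact: measurable_enorm.
by apply/seteqP; split.
Qed.

Lemma measurable_origin : measurable [set (origin : d.-tuple R)].
Proof.
rewrite (_ : [set origin] = [set x : d.-tuple R | enorm x <= 0]).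
  exact: measurable_ball_enorm.
apply/seteqP; split=> x /=; first by move=> ->; rewrite enorm0.
by move=> h; apply/eqP; rewrite -enorm_eq0 eq_le h enorm_ge0.
Qed.

(* On the sphere every Hoelder function is bounded by a multiple of 1, and the exponent can
   be lowered; both are folded into the definition. *)
Record holder_sphere (g : d.-tuple R -> R) (C gamma : R) : Prop := HolderSphere {
  holder_C : 0 <= C;
  holder_exp : 0 < gamma <= 1;
  holder_bound : forall z, sphere z -> `|g z| <= C;
  holder_diff : forall z z', sphere z -> sphere z' ->
    `|g z - g z'| <= C * euclid_dist z z' `^ gamma }.

(** [g] is arbitrary off the sphere, so its superlevel set is only relatively open. The union of
    ambient balls whose trace on the sphere stays in the superlevel set is open with the same
    trace. *)
Lemma holder_level (g : d.-tuple R -> R) C gamma (t : R) : holder_sphere g C gamma ->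
  exists2 U, measurable U & sphere `&` [set z | t < g z] = sphere `&` U.
Proof.
move=> [C0 /andP[ga0 ga1] _ gH].
exists [set y | exists x, exists r, [/\ sphere x, 0 < r, euclid_dist y x < r &
    forall z, sphere z -> euclid_dist z x < r -> t < g z]].
  apply: measurable_open_tuple => y [x [r [xS r0 yx H]]].
  exists (r - euclid_dist y x); first by rewrite subr_gt0.
  move=> z zy; exists x, r; split => //.
  move: zy; rewrite ltrBrDr; apply: le_lt_trans.
  rewrite !euclid_distE; have -> : tsub z y = tsub (tsub z x) (tsub y x).
    by apply: eq_from_tnth => i; rewrite !tnth_mktuple; ring.
  by rewrite addrC enorm_le_sub.
apply/seteqP; split=> [x [xS /= tx]|y [yS [x [r [_ _ yx H]]]]]; split => //; last exact: H.
(* Solves $(C+1)\,r^\gamma = g(x)-t$; the [+ 1] covers [C = 0]. *)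
pose r := ((g x - t) / (C + 1)) `^ gamma^-1.
have q0 : 0 < (g x - t) / (C + 1) by rewrite divr_gt0 ?subr_gt0 ?ltr_wpDl.
have r0 : 0 < r by rewrite powR_gt0.
exists x, r; split => //.
  by rewrite euclid_distE (_ : tsub x x = origin) ?enorm0//; apply: eq_from_tnth => i;
     rewrite !tnth_mktuple subrr.
move=> z zS zx.
have : `|g z - g x| < g x - t.
  apply: (le_lt_trans (gH _ _ zS xS)).
  have h : euclid_dist z x `^ gamma < (g x - t) / (C + 1).
    have := @gt0_ltr_powR R gamma ga0 (euclid_dist z x) r.
    rewrite !nnegrE euclid_dist_ge0 (ltW r0) => /(_ isT isT zx); rewrite /r -powRrM mulVf ?gt_eqF// powRr1// ltW//.
  move: h; rewrite ltr_pdivlMr; last by rewrite ltr_wpDl.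
  apply: le_lt_trans; rewrite mulrC ler_wpM2l ?powR_ge0// lerDl//.
by rewrite ltr_norml => /andP[+ _]; rewrite opprB ltrD2r.
Qed.

Lemma measurable_holder (g : d.-tuple R -> R) C gamma : holder_sphere g C gamma ->
  measurable_fun sphere g.
Proof.
move=> hg; apply: (measurability _ (RGenOInfty.measurableE R)) => _ [_ [t ->] <-].
have [U mU E] := holder_level t hg.
rewrite (_ : _ `&` _ = sphere `&` U); first by apply: measurableI => //; exact: measurable_sphere.
by rewrite -E; apply/seteqP; split=> x [? /=]; rewrite in_itv/= andbT.
Qed.

(** The projections to the sphere fail only at the origin, which is split off as a measurable
    point. *)
Lemma measurable_holder_comp (g : d.-tuple R -> R) C gamma (p : d.-tuple R -> d.-tuple R) :
  holder_sphere g C gamma -> measurable_fun setT p -> (forall x, x != origin -> sphere (p x)) ->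
  measurable_fun setT (g \o p).
Proof.
move=> hg mp pS.
have -> : setT = ~` [set origin] `|` [set (origin : d.-tuple R)].
  by rewrite setUC setUCr.
have mC : measurable (~` [set (origin : d.-tuple R)]).
  by apply: measurableC; exact: measurable_origin.
apply/measurable_funU => //; first exact: measurable_origin.
split; last exact: measurable_fun_set1.
apply: (@measurable_comp _ _ _ _ _ _ sphere) => //.
- exact: measurable_sphere.
- by move=> _ [x /eqP x0 <-]; exact: pS.
- exact: measurable_holder hg.
- exact: measurable_funS mp.
Qed.

End open_sets.

(** * Mean-zero symbols multiplied by radial factors *)

Section mean_zero_shells.
Context {R : realType} {d : nat} (a : d.-tuple R).
Hypotheses (a0 : forall j, 0 < tnth a j) (asum : \sum_(j < d) tnth a j = d%:R).
Implicit Types (G : d.-tuple R -> R).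

Definition dil_invariant G := forall s x, 0 < s -> G (dil a s x) = G x.

Definition etaI (t : R) : d.-tuple R -> R := fun x => ((eta a x <= t)%R)%:R.

Lemma etaI_ge0 t x : 0 <= etaI t x. Proof. exact: ler0n. Qed.

Lemma etaI_le1 t x : etaI t x <= 1. Proof. by rewrite /etaI lern1 leq_b1. Qed.

Lemma etaI1 x : etaI 1 x = ballI 1 x. Proof. by rewrite /etaI /ballI eta_le1. Qed.

Lemma etaI_dil t : 0 < t -> etaI t = etaI 1 \o dil a t.
Proof.
move=> t0; apply/funext => x; rewrite /etaI /= eta_dil//.
by rewrite ler_pdivrMr// mul1r.
Qed.

Lemma bsupp_etaI t : 0 < t -> bsupp (etaI t).
Proof.
move=> t0; rewrite etaI_dil//; apply: bsupp_dil => //.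
rewrite (_ : etaI 1 = ballI 1); first exact: bsupp_ball.
by apply/funext => x; exact: etaI1.
Qed.

Definition vol : R := lint (@ballI R d 1).

Lemma lint_etaI t : 0 < t -> lint (etaI t) = t ^+ d * vol.
Proof.
move=> t0; rewrite etaI_dil// lint_dil//.
  by congr (_ * lint _); apply/funext => x; exact: etaI1.
exact: bsupp_etaI.
Qed.

Lemma vol_gt0 : 0 < vol.
Proof.
apply: (@lint_gt0 _ _ _ origin 1 1 (bsupp_ball 1)) => //.
move=> x; rewrite euclid_distE (_ : tsub x origin = x); first by rewrite /ballI => ->.
by apply: eq_from_tnth => i; rewrite !tnth_mktuple subr0.
Qed.

Lemma bsupp_etaIM t G (M : R) : 0 < t -> measurable_fun setT G -> (forall x, `|G x| <= M) ->
  bsupp (fun x => etaI t x * G x).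
Proof. by move=> t0 mG GM; apply: (bsuppM (C := M)) => //; exact: bsupp_etaI. Qed.

Lemma lint_etaIM t G (M : R) : 0 < t -> measurable_fun setT G -> (forall x, `|G x| <= M) ->
  dil_invariant G -> lint (fun x => etaI t x * G x) = t ^+ d * lint (fun x => ballI 1 x * G x).
Proof.
move=> t0 mG GM Ginv.
rewrite (_ : (fun x => etaI t x * G x) = (fun x => etaI 1 x * G x) \o dil a t); last first.
  by apply/funext => x; rewrite etaI_dil//= Ginv.
rewrite lint_dil//; last exact: bsupp_etaIM GM.
by congr (_ * lint _); apply/funext => x; rewrite etaI1.
Qed.

Definition shellI (s t : R) : d.-tuple R -> R := fun x => etaI t x - etaI s x.

Lemma shellIE s t x : s <= t -> shellI s t x = ((s < eta a x <= t)%R)%:R.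
Proof.
move=> st; rewrite /shellI /etaI; case: (leP (eta a x) s) => /= h.
  by rewrite (le_trans h st) subrr.
by rewrite subr0.
Qed.

Lemma bsupp_shellI s t : 0 < s -> 0 < t -> bsupp (shellI s t).
Proof. by move=> s0 t0; apply: bsuppB; exact: bsupp_etaI. Qed.

Lemma lint_shellI s t : 0 < s -> 0 < t -> lint (shellI s t) = (t ^+ d - s ^+ d) * vol.
Proof. by move=> s0 t0; rewrite lintB ?lint_etaI ?mulrBl//; exact: bsupp_etaI. Qed.

Section mean_zero.
Variables (G : d.-tuple R -> R) (M : R) (p : R -> R) (C : R).
Hypotheses (mG : measurable_fun setT G) (GM : forall x, `|G x| <= M) (Ginv : dil_invariant G).
Hypothesis G0 : lint (fun x => ballI 1 x * G x) = 0.
Hypotheses (mp : measurable_fun setT p) (pC : forall t, `|p t| <= C).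

Let L s t := lint (fun x => shellI s t x * (p (eta a x) * G x)).

Let mpG : measurable_fun setT (fun x => p (eta a x) * G x).
Proof.
by apply: measurable_funM => //; apply: measurableT_comp => //; exact: measurable_eta.
Qed.

Let pGM x : `|p (eta a x) * G x| <= C * M.
Proof. by rewrite normrM ler_pM. Qed.

Let bL s t : 0 < s -> 0 < t -> bsupp (fun x => shellI s t x * (p (eta a x) * G x)).
Proof. by move=> s0 t0; apply: (bsuppM (C := C * M)) => //; exact: bsupp_shellI. Qed.

(** For constant [p] the integral vanishes by scaling, and freezing [p] at the outer radius costs at
    most its oscillation. Bisecting the shell halves the oscillation while the volumes add up,
    whence the factor [2 ^- n]. *)
Lemma lint_shell_halving (K : R) (n : nat) (s t : R) : 0 < s -> s <= t ->
  (forall x y, s < x <= t -> s < y <= t -> `|p x - p y| <= K * `|x - y|) -> 0 <= K ->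
  `|L s t| <= 2 ^- n * (K * (t - s) * M * ((t ^+ d - s ^+ d) * vol)).
Proof.
elim: n s t => [|n IH] s t s0 st Lip K0; have t0 := lt_le_trans s0 st.
  have E : L s t = lint (fun x => shellI s t x * ((p (eta a x) - p t) * G x)).
    pose A x := shellI s t x * ((p (eta a x) - p t) * G x).
    (* The part with [p] frozen at [t]: its integral is a difference of two scaled means of [G],
       hence zero. *)
    pose Bf x := p t * (etaI t x * G x - etaI s x * G x).
    have bB : bsupp Bf by apply/bsuppZ/bsuppB; exact: bsupp_etaIM GM.
    have bA : bsupp A.
      apply: (bsuppM (C := (C + C) * M)); first exact: bsupp_shellI.
        apply: measurable_funM => //; apply: measurable_funB => //.
        by apply: measurableT_comp => //; exact: measurable_eta.
      move=> x; rewrite normrM ler_pM//; apply: (le_trans (ler_normB _ _)).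
      exact: lerD.
    rewrite -[RHS]addr0; transitivity (lint A + lint Bf); last first.
      congr (_ + _); rewrite lintZ; last by apply: bsuppB; exact: bsupp_etaIM GM.
      rewrite lintB; [|exact: bsupp_etaIM GM|exact: bsupp_etaIM GM].
      by rewrite !(lint_etaIM _ mG GM Ginv)// G0 !mulr0 subrr mulr0.
    rewrite -lintD//; congr lint; apply/funext => x; rewrite /A /Bf /shellI; ring.
  rewrite expr0 invr1 mul1r E -lint_shellI// -lintZ; last exact: bsupp_shellI.
  apply: lint_bound; last first.
  - move=> x; rewrite shellIE//; case: (boolP (s < eta a x <= t)) => [h|_]; last first.
      by rewrite mul0r mulr0 normr0.
    rewrite mul1r mulr1 normrM ler_pM//.
    have tt : s < t <= t by rewrite lexx andbT; case/andP: h => /lt_le_trans h1 /h1.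
    apply: (le_trans (Lip _ _ h tt)); rewrite ler_wpM2l//.
    case/andP: h => h1 h2; rewrite distrC ger0_norm ?subr_ge0// lerD2l lerN2 ltW//.
  - by apply: bsuppZ; exact: bsupp_shellI.
  - apply: (bsuppM (C := (C + C) * M)); first exact: bsupp_shellI.
      apply: measurable_funM => //; apply: measurable_funB => //.
      by apply: measurableT_comp => //; exact: measurable_eta.
    move=> x; rewrite normrM ler_pM//; apply: (le_trans (ler_normB _ _)).
    exact: lerD.
pose m := (s + t) / 2.
have [sm mt] : s <= m /\ m <= t by rewrite /m; split; lra.
have m0 : 0 < m by exact: lt_le_trans sm.
have -> : L s t = L s m + L m t.
  rewrite /L -lintD; [|exact: bL|exact: bL].
  congr lint; apply/funext => x; rewrite /shellI; ring.
apply: (le_trans (ler_normD _ _)).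
apply: (le_trans (lerD (IH s m s0 sm _ K0) (IH m t m0 mt _ K0))).
- move=> x y /andP[x1 x2] /andP[y1 y2]; apply: Lip; apply/andP; split=> //.
    exact: le_trans mt.
  exact: le_trans mt.
- move=> x y /andP[x1 x2] /andP[y1 y2]; apply: Lip; apply/andP; split=> //.
    exact: le_lt_trans x1.
  exact: le_lt_trans y1.
rewrite le_eqVlt; apply/orP; left; apply/eqP.
have -> : m - s = (t - s) / 2 by rewrite /m; field.
have -> : t - m = (t - s) / 2 by rewrite /m; field.
rewrite exprS invfM; field.
by rewrite expf_neq0.
Qed.

(** Plays the role of integration in polar coordinates for a Lipschitz radial factor; it is the
    limit of the bisection. *)
Lemma lint_mean_zero (K s t : R) : 0 < s -> s <= t ->
  (forall x y, s < x <= t -> s < y <= t -> `|p x - p y| <= K * `|x - y|) -> 0 <= K ->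
  lint (fun x => shellI s t x * (p (eta a x) * G x)) = 0.
Proof.
move=> s0 st Lip K0; apply/eqP; rewrite -normr_le0; apply/ler_addgt0Pr => e e0; rewrite add0r.
set W := K * (t - s) * M * ((t ^+ d - s ^+ d) * vol).
have H n := lint_shell_halving n s0 st Lip K0.
pose n := Num.truncn (`|W| / e).
apply: (le_trans (H n)); rewrite -/W.
rewrite ler_pdivrMl ?exprn_gt0//; apply: (le_trans (ler_norm W)).
rewrite -ler_pdivrMr//; apply: le_trans (ltW (truncnS_gt _)) _.
rewrite -/n -natrX ler_nat; exact: ltn_expl.
Qed.

End mean_zero.

End mean_zero_shells.

(** * Polar coordinates for anisotropic dilations *)

Section expR_slope.
Context {R : realType}.

Lemma cvg_expR_at0 (y : R) : expR (y * t) @[t --> 0^'+] --> (1 : R).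
Proof.
have : expR (y * t) @[t --> (0 : R)] --> expR (y * 0).
  apply: (@continuous_comp R R R (fun t => y * t) expR 0); last exact: continuous_expR.
  exact: mulrl_continuous.
by rewrite mulr0 expR0; exact: cvg_at_right_filter.
Qed.

(** Squeezed between $y$ and $y e^{yt}$, both bounds coming from $e^u\ge 1+u$. *)
Lemma cvg_expR_slope (y : R) : (expR (y * t) - 1) / t @[t --> 0^'+] --> y.
Proof.
apply: (@squeeze_cvgr _ _ _ _ (fun=> y) (fun t => y * expR (y * t))).
- near=> t; have t0 : 0 < t by near: t; exact: nbhs_right_gt.
  rewrite ler_pdivlMr// ler_pdivrMr//; apply/andP; split.
    by rewrite lerBrDl expR_ge1Dx.
  have := expR_ge1Dx (- (y * t)); rewrite expRN => H.
  have : (1 + - (y * t)) * expR (y * t) <= 1 by rewrite -ler_pdivlMr ?expR_gt0// div1r.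
  rewrite mulrDl mul1r mulNr; lra.
- exact: cvg_cst.
- rewrite -[X in _ --> X]mulr1.
  by apply: cvgM; [exact: cvg_cst|exact: cvg_expR_at0].
Unshelve. all: by end_near. Qed.

Lemma cvg_sum_seq (T : Type) (F : set_system T) (I : Type) (s : seq I)
    (f : I -> T -> R) (l : I -> R) : Filter F ->
  (forall i, f i x @[x --> F] --> l i) ->
  \sum_(i <- s) f i x @[x --> F] --> \sum_(i <- s) l i.
Proof.
move=> FF H; elim: s => [|i s IH].
  by under eq_fun do rewrite big_nil; rewrite big_nil; exact: cvg_cst.
by under eq_fun do rewrite big_cons; rewrite big_cons; apply: cvgD.
Qed.

(** The right-hand side of the hypothesis is a product of two quantities of order [t]. After
    division by [t] it disappears in the limit, and the derivatives at [0] have to match. *)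
Lemma slope_limit (n : nat) (F K dd : R) (b M : 'I_n -> R) :
  (forall t, 0 < t ->
    `|(1 - expR (- dd * t)) * F - \sum_(j < n) (expR (b j * t) - 1) * M j| <=
     K * (\sum_(j < n) (expR (b j * t) - 1)) * (1 - expR (- dd * t))) ->
  dd * F = \sum_(j < n) b j * M j.
Proof.
move=> H; apply/eqP; rewrite -subr_eq0 -normr_le0.
have c1 : (1 - expR (- dd * t)) / t @[t --> 0^'+] --> dd.
  rewrite -[X in _ --> X]opprK; under eq_fun do rewrite -opprB mulNr.
  apply: cvgN; exact: cvg_expR_slope.
have c2 : (\sum_(j < n) (expR (b j * t) - 1)) @[t --> 0^'+] --> (0 : R).
  rewrite [X in _ --> X](_ : _ = \sum_(j < n) (0 : R)); last by rewrite big1.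
  apply: cvg_sum_seq => j; rewrite -[X in _ --> X](subrr 1).
  by apply: cvgB; [exact: cvg_expR_at0|exact: cvg_cst].
have c3 : `|(1 - expR (- dd * t)) / t * F - \sum_(j < n) (expR (b j * t) - 1) / t * M j|
   @[t --> 0^'+] --> `|dd * F - \sum_(j < n) b j * M j|.
  apply: cvg_norm; apply: cvgB; first by apply: cvgM => //; exact: cvg_cst.
  apply: cvg_sum_seq => j; apply: cvgM; last exact: cvg_cst.
  exact: cvg_expR_slope.
have c4 : K * (\sum_(j < n) (expR (b j * t) - 1)) * ((1 - expR (- dd * t)) / t)
   @[t --> 0^'+] --> K * 0 * dd.
  by apply: cvgM => //; apply: cvgM => //; exact: cvg_cst.
rewrite mulr0 mul0r in c4.
apply: ler_cvg_to c3 c4 _.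
near=> t; have t0 : 0 < t by near: t; exact: nbhs_right_gt.
rewrite mulrA ler_pdivlMr// -[X in _ * X <= _](gtr0_norm t0) -normrM mulrBl mulr_suml.
rewrite mulrAC divfK ?gt_eqF//.
under eq_bigr => j _ do rewrite mulrAC divfK ?gt_eqF//.
exact: H.
Unshelve. all: by end_near. Qed.

End expR_slope.

(** * The divergence identity along dilations *)

Section paraboloid.
Context {R : realType} {d : nat}.

(** It vanishes on the sphere of radius [s], so moving the ball slightly creates no boundary term of
    first order; its gradient inside the ball is $-2x$, the source of the weight. *)
Definition paraboloid (s : R) (x : d.-tuple R) : R := ballI s x * (s ^+ 2 - edot x x).

Lemma bsupp_paraboloid s : 0 < s -> bsupp (paraboloid s).
Proof.
move=> s0; split.
  apply: measurable_funM; first exact: measurable_ballI.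
  apply: measurable_funB => //.
  by apply: measurable_sum => i; apply: measurable_funM; exact: measurable_tnth.
exists (s ^+ 2), s => x; rewrite normrM mulrC [`|ballI s x|]ger0_norm ?ballI_ge0//.
rewrite /ballI; case: (leP (enorm x) s) => [h|_]; last by rewrite !mulr0.
rewrite ler_wpM2r// ger0_norm; first by rewrite gerBl edot_ge0.
by rewrite subr_ge0 -sqr_enorm ler_sqr ?nnegrE ?enorm_ge0// ltW.
Qed.

End paraboloid.

Section divergence.
Context {R : realType} {d : nat} (b : d.-tuple R).
Hypotheses (b0 : forall j, 0 < tnth b j) (bsum : \sum_(j < d) tnth b j = d%:R).
Variables (G : d.-tuple R -> R) (M : R).
Hypotheses (mG : measurable_fun setT G) (GM : forall x, `|G x| <= M).
Hypothesis Ginv : dil_invariant b G.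
Variable s : R.
Hypothesis s0 : 0 < s.

Let M0 : 0 <= M. Proof. exact: le_trans (normr_ge0 _) (GM origin). Qed.

Local Notation K := (@paraboloid R d s).
Let bK : bsupp K. Proof. exact: bsupp_paraboloid. Qed.

Let bGK : bsupp (fun x => K x * G x).
Proof. exact: (bsuppM bK mG GM). Qed.

Let sq j (x : d.-tuple R) := ballI s x * (tnth x j ^+ 2 * G x).

Let bsq j : bsupp (sq j).
Proof.
split.
  apply: measurable_funM; first exact: measurable_ballI.
  apply: measurable_funM => //; apply: measurable_funX; exact: measurable_tnth.
exists (s ^+ 2 * M), s => x; rewrite normrM mulrC [`|ballI s x|]ger0_norm ?ballI_ge0//.
rewrite /ballI; case: (leP (enorm x) s) => [h|_]; last by rewrite !mulr0.
rewrite ler_wpM2r// normrM ler_pM// normrX.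
by apply: lerXn2r; rewrite ?nnegrE ?(ltW s0)// (le_trans (enorm_coord x j)).
Qed.

(** Dilations carry negative exponents, so for [t > 0] this map expands: coordinate [j] is
    multiplied by $e^{b_j t}$. *)
Let T t := dil b (expR (- t)).
Let bb t j : R := expR (2 * tnth b j * t) - 1.

Let Tsq t x : edot (T t x) (T t x) = \sum_(j < d) expR (2 * tnth b j * t) * tnth x j ^+ 2.
Proof.
apply: eq_bigr => j _; rewrite tnth_dil -expRM mulrNN.
rewrite mulrACA -expRD -expr2; congr (expR _ * _); ring.
Qed.

Let Tsqx t x : edot (T t x) (T t x) - edot x x = \sum_(j < d) bb t j * tnth x j ^+ 2.
Proof.
by rewrite Tsq /edot -sumrB; apply: eq_bigr => j _; rewrite /bb mulrBl mul1r expr2.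
Qed.

Let bb_ge0 t j : 0 < t -> 0 <= bb t j.
Proof.
move=> t0; rewrite subr_ge0 -(@expR0 R) ler_expR !mulr_ge0//; exact: ltW.
Qed.

Let Tx t x : 0 < t -> enorm x <= enorm (T t x).
Proof.
move=> t0; rewrite -ler_sqr ?nnegrE ?enorm_ge0// !sqr_enorm -subr_ge0 Tsqx.
by apply: sumr_ge0 => j _; rewrite mulr_ge0 ?bb_ge0 ?sqr_ge0.
Qed.

(** Lives on the points that [T t] pushes out of the ball. There $|T_t x|^2-s^2$ is of order [t],
    and so is the volume of that set, so the integral is of second order. *)
Let E t x := (ballI s x - ballI s (T t x)) * (edot (T t x) (T t x) - s ^+ 2).

Let KE t x : 0 < t -> K x - K (T t x) = \sum_(j < d) bb t j * (ballI s x * tnth x j ^+ 2) - E t x.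
Proof.
move=> t0; have h := Tx x t0.
have -> : \sum_(j < d) bb t j * (ballI s x * tnth x j ^+ 2) = ballI s x * (edot (T t x) (T t x) - edot x x).
  by rewrite Tsqx mulr_sumr; apply: eq_bigr => j _; rewrite mulrCA.
rewrite /paraboloid /E /ballI; case: (leP (enorm (T t x)) s) => h1.
  by rewrite (le_trans h h1) /=; ring.
by case: (leP (enorm x) s) => h2 /=; ring.
Qed.

Let bE t : bsupp (E t).
Proof.
have bi : bsupp (ballI s \o T t) by apply: bsupp_dil; [exact: expR_gt0|exact: bsupp_ball].
have bKT : bsupp (K \o T t) by apply: bsupp_dil; [exact: expR_gt0|exact: bK].
have -> : E t = fun x => (fun x => ballI s x * (edot (T t x) (T t x) - s ^+ 2)) x + (K \o T t) x.
  by apply/funext => x; rewrite /E /paraboloid /=; ring.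
apply: bsuppD => //.
have -> : (fun x => ballI s x * (edot (T t x) (T t x) - s ^+ 2)) =
  fun x => \sum_(j < d) expR (2 * tnth b j * t) * (ballI s x * tnth x j ^+ 2) - s ^+ 2 * ballI s x.
  apply/funext => x; rewrite Tsq mulrBr mulr_sumr [s ^+ 2 * _]mulrC; congr (_ - _).
  by apply: eq_bigr => j _; rewrite mulrCA.
apply: bsuppB; last by apply: bsuppZ; exact: bsupp_ball.
apply: bsupp_sum => j; apply: bsuppZ.
split.
  by apply: measurable_funM; [exact: measurable_ballI|apply: measurable_funX; exact: measurable_tnth].
exists (s ^+ 2), s => x; rewrite normrM mulrC [`|ballI s x|]ger0_norm ?ballI_ge0//.
rewrite /ballI; case: (leP (enorm x) s) => [h|_]; last by rewrite !mulr0.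
rewrite ler_wpM2r// normrX.
by apply: lerXn2r; rewrite ?nnegrE ?(ltW s0)// (le_trans (enorm_coord x j)).
Qed.

Let E_le t x : 0 < t -> `|E t x| <= (\sum_(j < d) bb t j) * s ^+ 2 * (ballI s x - ballI s (T t x)).
Proof.
move=> t0; have h := Tx x t0; rewrite /E /ballI.
case: (leP (enorm (T t x)) s) => h1.
  by rewrite (le_trans h h1) /= subrr mul0r normr0 mulr0.
case: (leP (enorm x) s) => h2 /=; last by rewrite subrr mul0r normr0 mulr0.
rewrite subr0 mul1r mulr1 ger0_norm; last first.
  by rewrite subr_ge0 -sqr_enorm ler_sqr ?nnegrE ?enorm_ge0// ltW.
have xx : edot x x <= s ^+ 2.
  by rewrite -sqr_enorm ler_sqr ?nnegrE ?enorm_ge0// ltW.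
apply: (@le_trans _ _ (edot (T t x) (T t x) - edot x x)); first by rewrite lerD2l lerN2.
rewrite Tsqx mulr_suml; apply: ler_sum => j _; rewrite ler_wpM2l ?bb_ge0//.
rewrite -real_normK ?num_real//.
by apply: lerXn2r; rewrite ?nnegrE ?(ltW s0)// (le_trans (enorm_coord x j)).
Qed.

(* This is the divergence theorem for [paraboloid] times the field [(b_j x_j)_j], in weak form:
   differentiate [lint (paraboloid * G)] along the dilations, under which [G] is invariant and
   Lebesgue measure scales by the trace [d] of [b]. *)
Lemma divergence_ball :
  d%:R * lint (fun x => K x * G x) =
  2 * lint (fun x => ballI s x * (G x * \sum_(j < d) tnth b j * tnth x j ^+ 2)).
Proof.
have -> : 2 * lint (fun x => ballI s x * (G x * \sum_(j < d) tnth b j * tnth x j ^+ 2))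
   = \sum_(j < d) 2 * tnth b j * lint (sq j).
  transitivity (\sum_(j < d) lint (fun x => 2 * tnth b j * sq j x)); last first.
    by apply: eq_bigr => j _; rewrite lintZ.
  rewrite -lint_sum; last by move=> j; exact: bsuppZ.
  rewrite -lintZ; last first.
    rewrite (_ : (fun x => _) = fun x => \sum_(j < d) tnth b j * sq j x).
      by apply: bsupp_sum => j; exact: bsuppZ.
    apply/funext => x; rewrite mulrA mulr_sumr; apply: eq_bigr => j _; rewrite /sq; ring.
  congr lint; apply/funext => x; rewrite mulrA mulr_sumr mulr_sumr.
  apply: eq_bigr => j _; rewrite /sq; ring.
(* In the constant, [M] bounds [G] and [s ^+ 2] the squared coordinates, while [T t] pushes out the
   fraction $1-e^{-dt}$ of the volume of the ball. *)
apply: (slope_limit (K := M * s ^+ 2 * lint (@ballI R d s))) => t t0.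
pose y := expR (- t).
have y0 : 0 < y by exact: expR_gt0.
have yd : expR (- d%:R * t) = y ^+ d by rewrite mulNr -mulrN expRM_natl.
have E1 : (1 - expR (- d%:R * t)) * lint (fun x => K x * G x)
  = lint (fun x => (K x - K (T t x)) * G x).
  rewrite yd mulrBl mul1r -(lint_dil bsum y0 bGK) -lintB//; last exact: bsupp_dil.
  by congr lint; apply/funext => x; rewrite /= Ginv// mulrBl.
have E2 : lint (fun x => (K x - K (T t x)) * G x)
   = \sum_(j < d) bb t j * lint (sq j) - lint (fun x => E t x * G x).
  transitivity (\sum_(j < d) lint (fun x => bb t j * sq j x) - lint (fun x => E t x * G x)); last first.
    by congr (_ - _); apply: eq_bigr => j _; rewrite lintZ.
  rewrite -lint_sum; last by move=> j; exact: bsuppZ.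
  rewrite -lintB; last 2 first.
    by apply: bsupp_sum => j; exact: bsuppZ.
    exact: (bsuppM (bE t) mG GM).
  congr lint; apply/funext => x; rewrite KE// mulrBl mulr_suml; congr (_ - _).
  by apply: eq_bigr => j _; rewrite /sq; ring.
rewrite E1 E2 addrAC subrr add0r normrN.
pose A (x : d.-tuple R) := ballI s x - ballI s (T t x).
have bA : bsupp A.
  apply: bsuppB; first exact: bsupp_ball.
  by apply: (@bsupp_dil R d b y (ballI s)) => //; exact: bsupp_ball.
have -> : M * s ^+ 2 * lint (@ballI R d s) * (\sum_(j < d) (expR (2 * tnth b j * t) - 1))
    * (1 - expR (- d%:R * t)) = lint (fun x => M * s ^+ 2 * (\sum_(j < d) bb t j) * A x).
  rewrite lintZ// lintB; [|exact: bsupp_ball|by apply: (@bsupp_dil R d b y (ballI s)) => //; exact: bsupp_ball].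
  rewrite (_ : lint (fun x => ballI s (T t x)) = y ^+ d * lint (@ballI R d s)); last first.
    by rewrite -(lint_dil bsum y0)//; exact: bsupp_ball.
  by rewrite yd /bb; ring.
apply: lint_bound.
- exact: (bsuppM (bE t) mG GM).
- exact: bsuppZ.
- move=> x; rewrite normrM mulrC.
  have -> : M * s ^+ 2 * (\sum_(j < d) bb t j) * A x = M * ((\sum_(j < d) bb t j) * s ^+ 2 * A x) by ring.
  by apply: ler_pM => //; exact: E_le.
Qed.

End divergence.

(** * Comparison of anisotropic and radial projection *)

Section polar.
Context {R : realType} {d : nat} (a : d.-tuple R).
Hypotheses (d0 : (0 < d)%N) (a0 : forall j, 0 < tnth a j)
  (asum : \sum_(j < d) tnth a j = d%:R).

(** With all exponents equal to [1], [eta] is the norm and [eta_dir] the radial projection, so each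
    fact about dilations also serves the isotropic side. *)
Let ones : d.-tuple R := [tuple 1 | _ < d].

Lemma ones_gt0 j : 0 < tnth ones j. Proof. by rewrite tnth_mktuple. Qed.

Lemma ones_sum : \sum_(j < d) tnth ones j = d%:R.
Proof. by under eq_bigr do rewrite tnth_mktuple; rewrite sumr_const card_ord. Qed.

Lemma eta_ones (x : d.-tuple R) : eta ones x = enorm x.
Proof.
have [->|x0] := eqVneq x origin; first by rewrite eta_origin enorm0.
have n0 : 0 < enorm x by rewrite lt0r enorm_eq0 x0 enorm_ge0.
apply: (eta_uniq ones_gt0) => //.
rewrite (_ : dil _ _ _ = [tuple (enorm x)^-1 * tnth x i | i < d]).
  by rewrite enormZ gtr0_norm ?invr_gt0// mulVf// gt_eqF.
by apply: eq_from_tnth => j; rewrite !tnth_mktuple powR_inv1// ltW.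
Qed.

Lemma eta_dir_ones (x : d.-tuple R) : eta_dir ones x = normalize x.
Proof.
by apply: eq_from_tnth => j; rewrite !tnth_mktuple eta_ones powR_inv1 ?enorm_ge0// mulrC.
Qed.

Lemma normalize_sphere (x : d.-tuple R) : x != origin -> sphere (normalize x).
Proof. by move=> x0; rewrite -eta_dir_ones; apply: (sphere_eta_dir ones_gt0). Qed.

(** The inner product of the field $(a_j z_j)_j$, which generates the dilations, with the outer
    normal [z] of the sphere. *)
Definition weight (z : d.-tuple R) := \sum_(j < d) tnth a j * tnth z j ^+ 2.

Lemma measurable_weight : measurable_fun setT weight.
Proof.
apply: measurable_sum => j; apply: measurable_funM => //; apply: measurable_funX.
exact: measurable_tnth.
Qed.

Lemma weight_ge0 z : 0 <= weight z.
Proof. by apply: sumr_ge0 => j _; rewrite mulr_ge0 ?sqr_ge0// ltW. Qed.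

Lemma weight_le z : enorm z <= 1 -> weight z <= d%:R.
Proof.
move=> z1; rewrite -asum; apply: ler_sum => j _; rewrite ler_piMr ?(ltW (a0 j))//.
rewrite -real_normK ?num_real// expr_le1//.
exact: le_trans (enorm_coord _ _) z1.
Qed.

Lemma enorm_normalize (x : d.-tuple R) : enorm (normalize x) <= 1.
Proof.
have [->|x0] := eqVneq x origin; last by rewrite (normalize_sphere x0).
rewrite (_ : normalize _ = origin) ?enorm0//.
by apply: eq_from_tnth => j; rewrite !tnth_mktuple mul0r.
Qed.

Lemma weight_normalize x : weight (normalize x) * edot x x = weight x.
Proof.
have [->|x0] := eqVneq x origin.
  rewrite -sqr_enorm enorm0 expr0n mulr0 /weight big1// => j _.
  by rewrite tnth_mktuple expr0n mulr0.
rewrite /weight mulr_suml; apply: eq_bigr => j _; rewrite tnth_mktuple -sqr_enorm; field.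
by rewrite enorm_eq0.
Qed.

Variables (g : d.-tuple R -> R) (C gamma : R).
Hypothesis hg : holder_sphere g C gamma.

Lemma measurable_holder_dir : measurable_fun setT (g \o eta_dir a).
Proof.
apply: (measurable_holder_comp hg); first exact: measurable_eta_dir.
exact: sphere_eta_dir.
Qed.

Lemma measurable_holder_normalize : measurable_fun setT (g \o normalize).
Proof.
apply: (measurable_holder_comp hg); first exact: measurable_normalize.
exact: normalize_sphere.
Qed.

Let C0 : 0 <= C. Proof. by case: hg. Qed.

Lemma holder_dir_bound x : `|g (eta_dir a x)| <= C + `|g origin|.
Proof.
have [->|x0] := eqVneq x origin; first by rewrite /eta_dir dil0 lerDr.
by rewrite ler_wpDr//; apply: (holder_bound hg); exact: sphere_eta_dir.
Qed.

Lemma holder_normalize_bound x : `|g (normalize x)| <= C + `|g origin|.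
Proof.
have [->|x0] := eqVneq x origin; last first.
  by rewrite ler_wpDr//; apply: (holder_bound hg); exact: normalize_sphere.
rewrite (_ : normalize _ = origin) ?lerDr//.
by apply: eq_from_tnth => j; rewrite !tnth_mktuple mul0r.
Qed.

Lemma holder_dir_invariant : dil_invariant a (g \o eta_dir a).
Proof. by move=> s x s0; rewrite /= eta_dir_dil. Qed.

(* Near the sphere the two projections [eta_dir a x] and [normalize x] almost agree. *)
Lemma holder_projections : exists2 c : R, 0 <= c & forall t x, 0 < t -> t <= 1 ->
  1 < enorm x -> enorm x <= expR t ->
  `|g (eta_dir a x) - g (normalize x)| <= c * t `^ gamma.
Proof.
have ga0 := amin_gt0 a0.
(* Each $a_j$ is at most the sum [d], so [A] bounds every ratio $a_j/\mathrm{amin}$; [A >= 1] takes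
   care of the radial projection. *)
pose A := d%:R / amin a.
have A1 : 1 <= A by rewrite ler_pdivlMr// mul1r (le_trans (amin_le1 a))// ler1n.
have A0 : 0 <= A by exact: le_trans A1.
have Aj j : tnth a j / amin a <= A.
  rewrite ler_wpM2r ?invr_ge0 ?(ltW ga0)// -asum (bigD1 j)//= lerDl.
  by apply: sumr_ge0 => i _; exact: ltW.
clearbody A.
pose c1 := d%:R * (expR 1 * A).
have c10 : 0 <= c1 by apply: mulr_ge0 => //; apply: mulr_ge0 => //; exact: expR_ge0.
exists (C * c1 `^ gamma) => [|t x t0 t1 x1 xt]; first by rewrite mulr_ge0// powR_ge0.
have x0 : x != origin by rewrite -enorm_eq0 gt_eqF// (lt_trans ltr01).
have /andP[gm0 gm1] := holder_exp hg.
apply: (le_trans (holder_diff hg (sphere_eta_dir a0 x0) (normalize_sphere x0))).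
rewrite -mulrA ler_wpM2l// -powRM// ?(ltW t0)//.
apply: ge0_ler_powR; rewrite ?nnegrE ?euclid_dist_ge0 ?(ltW gm0)//; first by rewrite mulr_ge0// ltW.
rewrite euclid_distE /c1 -!mulrA; apply: enorm_le_coord.
  by apply: mulr_ge0; [exact: expR_ge0|apply: mulr_ge0 => //; exact: ltW].
move=> j; rewrite tnth_mktuple tnth_dil tnth_mktuple.
have e1 : 1 <= eta a x by rewrite leNgt; apply/negP => /ltW; rewrite eta_le1// leNgt x1.
have e0 : 0 < eta a x by exact: lt_le_trans e1.
have et : eta a x <= expR (t / amin a).
  rewrite eta_le ?expR_gt0//.
  apply: (le_trans (enorm_dil_le _ _ _)).
    by rewrite -expR0 ler_expR divr_ge0// ltW.
  rewrite -expRM mulrN divfK ?gt_eqF// expRN ler_pdivrMl ?expR_gt0// mulr1//.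
(* Both scaling factors, $\eta^{-a_j}$ and $1/|x|$, lie between $e^{-At}$ and [1], so they differ by
   at most [A * t]. *)
have lo : expR (- (A * t)) <= eta a x `^ (- tnth a j).
  rewrite /powR gt_eqF// ler_expR mulNr lerN2.
  have : ln (eta a x) <= t / amin a.
    by rewrite -[leRHS]expRK ler_ln ?posrE ?expR_gt0.
  move=> /(ler_wpM2l (ltW (a0 j))) => h; apply: (le_trans h).
  by rewrite mulrA mulrAC ler_wpM2r// ltW.
have hi : eta a x `^ (- tnth a j) <= 1.
  by rewrite -(powRr0 (eta a x)) ler_powR// oppr_le0 ltW.
have lo2 : expR (- (A * t)) <= (enorm x)^-1.
  rewrite expRN lef_pV2 ?posrE ?expR_gt0 ?(lt_trans ltr01)//.
  by apply: (le_trans xt); rewrite ler_expR ler_peMl// ltW.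
have hi2 : (enorm x)^-1 <= 1 by rewrite invf_le1 ?(lt_trans ltr01)// ltW.
rewrite [_ * tnth x j]mulrC -mulrBr normrM.
have H1 : `|tnth x j| <= expR 1.
  apply: (le_trans (enorm_coord _ _)); apply: (le_trans xt); by rewrite ler_expR.
have H2 : `|eta a x `^ (- tnth a j) - (enorm x)^-1| <= A * t.
  have := expR_ge1Dx (- (A * t)) => h3.
  rewrite ler_norml; apply/andP; split; lra.
by apply: ler_pM.
Qed.

Let G := g \o eta_dir a.
Let H := g \o normalize.
Let w := weight \o @normalize R d.
Let D (x : d.-tuple R) := G x - H x * w x.
Let N : R := C + `|g origin|.
Local Notation K := (@paraboloid R d).

Let N0 : 0 <= N. Proof. by rewrite addr_ge0. Qed.

Let mw : measurable_fun setT w.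
Proof. exact: (measurableT_comp measurable_weight measurable_normalize). Qed.

Let wd x : `|w x| <= d%:R.
Proof. by rewrite ger0_norm ?weight_ge0// weight_le// enorm_normalize. Qed.

Let mHw : measurable_fun setT (fun x => H x * w x).
Proof. by apply: measurable_funM => //; exact: measurable_holder_normalize. Qed.

Let Hwd x : `|H x * w x| <= N * d%:R.
Proof. by rewrite normrM ler_pM// holder_normalize_bound. Qed.

Let mD : measurable_fun setT D.
Proof. by apply: measurable_funB => //; exact: measurable_holder_dir. Qed.

Let Dd x : `|D x| <= N + N * d%:R.
Proof. by apply: (le_trans (ler_normB _ _)); rewrite lerD// holder_dir_bound. Qed.

Let weight_le2 s x : enorm x <= s -> weight x <= d%:R * s ^+ 2.
Proof.
move=> xs; rewrite -weight_normalize ler_pM ?weight_ge0 ?edot_ge0//.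
  by rewrite weight_le// enorm_normalize.
rewrite -sqr_enorm; apply: lerXn2r => //; rewrite nnegrE ?enorm_ge0//.
exact: le_trans (enorm_ge0 _) xs.
Qed.

Let bweight (s L : R) (k : d.-tuple R -> R) : measurable_fun setT k -> (forall x, `|k x| <= L) ->
  bsupp (fun x => ballI s x * (k x * weight x)).
Proof.
move=> mk kL; split.
  apply: measurable_funM; first exact: measurable_ballI.
  by apply: measurable_funM => //; exact: measurable_weight.
exists (L * (d%:R * s ^+ 2)), s => x.
rewrite normrM mulrC [`|ballI s x|]ger0_norm ?ballI_ge0//.
rewrite /ballI; case: (leP (enorm x) s) => [h|_]; last by rewrite !mulr0.
rewrite ler_wpM2r// normrM ler_pM// ger0_norm ?weight_ge0//.
exact: weight_le2.
Qed.

Let mGH : measurable_fun setT (fun x => G x - H x).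
Proof.
by apply: measurable_funB; [exact: measurable_holder_dir|exact: measurable_holder_normalize].
Qed.

Let GHb x : `|G x - H x| <= N + N.
Proof.
apply: (le_trans (ler_normB _ _)).
by apply: lerD; [exact: holder_dir_bound|exact: holder_normalize_bound].
Qed.

(** The identity with exponents [1], applied to [H * w], carries the factor $|x|^2$, and [w] times
    $|x|^2$ is [weight x]. Hence both identities end with the same weight and can be subtracted. *)
Let JD (s : R) : 0 < s ->
  d%:R * lint (fun x => K s x * D x) = 2 * lint (fun x => ballI s x * ((G x - H x) * weight x)).
Proof.
move=> s0; have bK := @bsupp_paraboloid R d s s0.
have J1 := divergence_ball a0 asum measurable_holder_dir holder_dir_bound holder_dir_invariant s0.
have inv2 : dil_invariant ones (fun x => H x * w x).
  by move=> t x t0; rewrite /H /w /= -!eta_dir_ones eta_dir_dil//; exact: ones_gt0.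
have J2 := divergence_ball ones_gt0 ones_sum mHw Hwd inv2 s0.
have -> : (fun x => K s x * D x) = fun x => K s x * G x - K s x * (H x * w x).
  by apply/funext => x; rewrite mulrBr.
rewrite lintB; last 2 first.
- exact: (bsuppM bK measurable_holder_dir holder_dir_bound).
- exact: (bsuppM bK mHw Hwd).
rewrite mulrBr J1 J2 -mulrBr; congr (2 * _).
rewrite -lintB; last 2 first.
- exact: (@bweight s N G measurable_holder_dir holder_dir_bound).
- have := bweight s measurable_holder_normalize holder_normalize_bound.
  congr bsupp; apply/funext => x; rewrite -[in LHS]weight_normalize /edot /=.
  congr (_ * _); rewrite -mulrA; congr (_ * _); congr (_ * _).
  by apply: eq_bigr => j _; rewrite tnth_mktuple mul1r expr2.
congr lint; apply/funext => x; rewrite -mulrBr; congr (_ * _).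
rewrite mulrBl; congr (_ - _); rewrite -weight_normalize -mulrA; congr (_ * (_ * _)).
by apply: eq_bigr => j _; rewrite tnth_mktuple mul1r expr2.
Qed.

Let mcst1 : measurable_fun setT (fun _ : d.-tuple R => (1 : R)).
Proof. exact: measurable_cst. Qed.

(** The case of the constant symbol converts a shell integral of [weight] back into one of the
    paraboloid, whose size is known. *)
Let J1 (s : R) : 0 < s ->
  d%:R * lint (@paraboloid R d s) = 2 * lint (fun x => ballI s x * weight x).
Proof.
move=> s0.
have n1 (x : d.-tuple R) : `|1 : R| <= 1 by rewrite normr1.
have J := divergence_ball a0 asum (G := fun=> 1) mcst1 n1 (fun _ _ _ => erefl) s0.
transitivity (d%:R * lint (fun x => K s x * 1)).
  by congr (_ * lint _); apply/funext => x; rewrite mulr1.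
by rewrite J; congr (_ * lint _); apply/funext => x; rewrite mul1r.
Qed.

(* Apply [divergence_ball] with the exponents [a] and with all exponents equal to 1 on the balls
   of radius [1] and [expR t]; the discrepancy lives on a thin shell, where
   [holder_projections] makes it [o(t)]. *)
Theorem polar_ball : lint (fun x => ballI 1 x * g (eta_dir a x)) =
  lint (fun x => ballI 1 x * (g (normalize x) * weight (normalize x))).
Proof.
have b1 : @bsupp R d (ballI 1) by exact: bsupp_ball.
suff : lint (fun x => ballI 1 x * D x) = 0.
  rewrite (_ : (fun x => _) = fun x => ballI 1 x * G x - ballI 1 x * (H x * w x)); last first.
    by apply/funext => x; rewrite mulrBr.
  rewrite lintB; last 2 first.
  - exact: (bsuppM b1 measurable_holder_dir holder_dir_bound).
  - exact: (bsuppM b1 mHw Hwd).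
  by move=> /subr0_eq.
set X := lint _.
have [c c0 cP] := holder_projections.
pose V := vol (R := R) (d := d).
have V0 : 0 < V by exact: vol_gt0.
pose M' := N + N * d%:R.
have M'0 : 0 <= M' by rewrite addr_ge0 ?mulr_ge0.
have key (t : R) : 0 < t -> t <= 1 ->
    `|X| <= c * t `^ gamma * expR (d%:R * t) * V + M' * (expR (d%:R * t) - 1) * V.
  move=> t0 t1; pose s := expR t.
  have s0 : 0 < s by exact: expR_gt0.
  have s1 : 1 < s by rewrite -(@expR0 R) ltr_expR.
  have sd : expR (d%:R * t) = s ^+ d by rewrite expRM_natl.
  have bs : @bsupp R d (ballI s) by exact: bsupp_ball.
  have Vs : lint (@ballI R d s) = s ^+ d * V.
    rewrite -(lint_etaI ones_gt0 ones_sum s0); congr lint; apply/funext => x.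
    by rewrite /etaI eta_ones.
  (* On the unit ball [q] is the constant [s ^+ 2 - 1], and it falls to [0] across the thin shell.
     Thus [X] is recovered from the integral of [q * D] up to the contribution of the shell. *)
  pose q (x : d.-tuple R) := K s x - K 1 x.
  have bq : bsupp q by apply: bsuppB; exact: bsupp_paraboloid.
  have h0 : 0 < s ^+ 2 - 1 by rewrite subr_gt0 exprn_egt1.
  pose A (x : d.-tuple R) := ballI s x - ballI 1 x.
  have bA : bsupp A by exact: bsuppB.
  have A0 x : 0 <= A x by rewrite subr_ge0 ballI_le// ltW.
  have qE x : q x = (s ^+ 2 - 1) * ballI 1 x + A x * (s ^+ 2 - edot x x).
    by rewrite /q /paraboloid /A expr1n; ring.
  have Aq x : 0 <= A x * (s ^+ 2 - edot x x) <= (s ^+ 2 - 1) * A x.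
    rewrite /A /ballI; case: (leP (enorm x) 1) => h1.
      by rewrite (le_trans h1 (ltW s1)) /= subrr mul0r mulr0 lexx.
    case: (leP (enorm x) s) => h2; last by rewrite subrr mul0r mulr0 lexx.
    rewrite subr0 mul1r mulr1 subr_ge0 -sqr_enorm lerD2l lerN2 exprn_ege1 ?(ltW h1)// andbT.
    by apply: lerXn2r; rewrite ?nnegrE ?enorm_ge0// ltW.
  have Jq : d%:R * lint (fun x => q x * D x) = 2 * lint (fun x => A x * ((G x - H x) * weight x)).
    have -> : (fun x => q x * D x) = fun x => K s x * D x - K 1 x * D x.
      by apply/funext => x; rewrite mulrBl.
    rewrite lintB; last 2 first.
    - by apply: (bsuppM _ mD Dd); exact: bsupp_paraboloid.
    - by apply: (bsuppM _ mD Dd); exact: bsupp_paraboloid.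
    rewrite mulrBr !JD// -mulrBr -lintB; last 2 first.
    - exact: (bweight _ mGH GHb).
    - exact: (bweight _ mGH GHb).
    by congr (_ * lint _); apply/funext => x; rewrite /A [RHS]mulrBl.
  have b1w u : bsupp (fun x => ballI u x * weight x).
    have n1 (x : d.-tuple R) : `|1 : R| <= 1 by rewrite normr1.
    have := @bweight u 1 (fun=> 1) mcst1 n1.
    by congr bsupp; apply/funext => x; rewrite mul1r.
  have Jq1 : d%:R * lint q = 2 * lint (fun x => A x * weight x).
    rewrite lintB; [|exact: bsupp_paraboloid|exact: bsupp_paraboloid].
    rewrite mulrBr !J1// -mulrBr -lintB//.
    by congr (_ * lint _); apply/funext => x; rewrite /A mulrBl.
  have bAw : bsupp (fun x => A x * weight x).
    have -> : (fun x => A x * weight x) = fun x => ballI s x * weight x - ballI 1 x * weight x.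
      by apply/funext => x; rewrite /A mulrBl.
    exact: bsuppB.
  have bAGH : bsupp (fun x => A x * ((G x - H x) * weight x)).
    have -> : (fun x => A x * ((G x - H x) * weight x)) =
        fun x => (A x * weight x) * (G x - H x).
      by apply/funext => x; ring.
    exact: (bsuppM bAw mGH GHb).
  have S1 : `|lint (fun x => A x * ((G x - H x) * weight x))| <=
      c * t `^ gamma * lint (fun x => A x * weight x).
    rewrite -lintZ//; apply: lint_bound => //; first exact: bsuppZ.
    move=> x; rewrite /A /ballI; case: (leP (enorm x) 1) => h1.
      by rewrite (le_trans h1 (ltW s1)) /= subrr !mul0r mulr0 normr0.
    case: (leP (enorm x) s) => h2; last by rewrite subrr !mul0r mulr0 normr0.
    rewrite subr0 !mul1r normrM [`|weight x|]ger0_norm ?weight_ge0//.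
    by rewrite ler_wpM2r ?weight_ge0//; exact: cP.
  (* Replacing the integral of [weight] by that of [q] brings out a factor [s ^+ 2 - 1], which
     cancels at the end and leaves the small factor $t^\gamma$. *)
  have S2 : `|lint (fun x => q x * D x)| <= c * t `^ gamma * lint q.
    have dd : 0 < (d%:R : R) by rewrite ltr0n.
    rewrite -(ler_pM2l dd) -[X in X * `|_|](gtr0_norm dd) -normrM Jq normrM.
    rewrite (gtr0_norm (ltr0Sn _ _)) mulrCA Jq1 mulrCA.
    by rewrite ler_pM2l.
  have S3 : lint q <= (s ^+ 2 - 1) * (s ^+ d * V).
    rewrite -Vs -lintZ//; apply: lint_le => //; first exact: bsuppZ.
    move=> x; rewrite qE; have /andP[_ h] := Aq x.
    apply: (le_trans (lerD (lexx _) h)).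
    by rewrite -mulrDr /A [ballI 1 x + _]addrC subrK.
  (* The part of [q] outside the unit ball: at most [s ^+ 2 - 1], on a shell whose volume tends to
     [0] with [t]. *)
  pose r (x : d.-tuple R) := A x * (s ^+ 2 - edot x x).
  have br : bsupp r.
    have -> : r = fun x => q x - (s ^+ 2 - 1) * ballI 1 x.
      by apply/funext => x; rewrite qE addrAC subrr add0r.
    by apply: bsuppB => //; exact: bsuppZ.
  have S4 : lint (fun x => q x * D x) = (s ^+ 2 - 1) * X + lint (fun x => r x * D x).
    rewrite -lintZ; last exact: (bsuppM b1 mD Dd).
    rewrite -lintD; last 2 first.
    - by apply: bsuppZ; exact: (bsuppM b1 mD Dd).
    - exact: (bsuppM br mD Dd).
    by congr lint; apply/funext => x; rewrite qE mulrDl mulrA.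
  have S5 : `|lint (fun x => r x * D x)| <= (s ^+ 2 - 1) * (M' * (s ^+ d - 1) * V).
    have -> : (s ^+ 2 - 1) * (M' * (s ^+ d - 1) * V) = lint (fun x => M' * (s ^+ 2 - 1) * A x).
      rewrite lintZ// lintB// Vs -/(vol) -/V; ring.
    apply: lint_bound; [exact: (bsuppM br mD Dd)|exact: bsuppZ|].
    move=> x; have /andP[r0 rA] := Aq x.
    rewrite normrM (ger0_norm r0) mulrC -mulrA.
    by apply: ler_pM => //; exact: Dd.
  rewrite sd -(ler_pM2l h0).
  rewrite -{1}(gtr0_norm h0) -normrM.
  have -> : (s ^+ 2 - 1) * X = lint (fun x => q x * D x) - lint (fun x => r x * D x).
    by rewrite S4 addrK.
  apply: (le_trans (ler_normB _ _)); rewrite mulrDr; apply: lerD => //.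
  apply: (le_trans S2).
  have -> : (s ^+ 2 - 1) * (c * t `^ gamma * s ^+ d * V) = c * t `^ gamma * ((s ^+ 2 - 1) * (s ^+ d * V)) by ring.
  by rewrite ler_wpM2l// mulr_ge0 ?powR_ge0.
have lim : c * t `^ gamma * expR (d%:R * t) * V + M' * (expR (d%:R * t) - 1) * V
    @[t --> 0^'+] --> c * 0 * 1 * V + M' * (1 - 1) * V.
  have ce := cvg_expR_at0 (d%:R : R).
  apply: cvgD; apply: cvgM; try exact: cvg_cst.
    apply: cvgM => //; apply: cvgM; first exact: cvg_cst.
    apply: powR_cvg0; by case/andP: (holder_exp hg).
  apply: cvgM; first exact: cvg_cst.
  by apply: cvgB => //; exact: cvg_cst.
rewrite subrr !mulr0 !mul0r addr0 in lim.
apply/eqP; rewrite -normr_le0.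
apply: ler_cvg_to (cvg_cst _) lim _.
near=> t; apply: key; first by near: t; exact: nbhs_right_gt.
near: t; exact: nbhs_right_le.
Unshelve. all: by end_near. Qed.

End polar.

(** * Integration against the surface measure *)

Section mrestr_integral.
Context {disp} {T : measurableType disp} {R : realType} (mu : {measure set T -> \bar R}).
Variables (D : set T) (mD : measurable D).

Lemma ge0_integral_mrestr (f : T -> \bar R) : measurable_fun setT f ->
  (forall x, 0 <= f x)%E -> (\int[mrestr mu mD]_x f x = \int[mu]_(x in D) f x)%E.
Proof.
move=> mf f0.
have mC : measurable (~` D) by exact: measurableC.
rewrite [LHS](ge0_negligible_integral mC)//; last by rewrite -[RHS](measure0 mu); congr (mu _); exact: setICl.
rewrite setTD setCK; apply: (@eq_measure_integral _ _ _ _ mu (mrestr mu mD) f) => A mA AD.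
by rewrite /= /mrestr (setIidl AD).
Qed.
End mrestr_integral.

Section surface_integral.
Context {R : realType} {d : nat}.
Local Notation leb := (@lebesgue_tuple R d).
Local Notation sigma := (@surface_measure R d).
Local Notation n := (@normalize R d).

Local Notation rleb := (mrestr leb (@measurable_punctured_ball R d)).
Local Notation push := (measure_function_pushforward__canonical__measure_function_Measure
    rleb (@measurable_normalize R d)).

(** The surface measure is by construction [d] times the image under [normalize] of Lebesgue measure
    on the punctured ball. *)
Lemma ge0_integral_surface (f : d.-tuple R -> \bar R) : measurable_fun setT f ->
  (forall x, 0 <= f x)%E ->
  (\int[sigma]_x f x = d%:R%:E * \int[leb]_(x in punctured_ball) f (n x))%E.
Proof.
move=> mf f0.
pose k : {nonneg R} := NngNum (ler0n R d).
transitivity (\int[mscale k push]_x f x)%E.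
  exact: (@eq_measure_integral _ _ _ _ (mscale k push) sigma f).
rewrite ge0_integral_mscale//; congr (_ * _)%E.
have := @ge0_integral_pushforward _ _ _ _ _ _ (@measurable_normalize R d) rleb setT f
   measurableT mf (fun y _ => f0 y).
rewrite preimage_setT => E; transitivity (\int[rleb]_x f (n x))%E; first exact: E.
apply: (@ge0_integral_mrestr _ _ _ leb _ (@measurable_punctured_ball R d) (f \o n)) => //.
exact: (measurableT_comp mf (@measurable_normalize R d)).
by move=> x; exact: f0.
Qed.

Lemma bsupp_normalize (f : d.-tuple R -> R) (M : R) : measurable_fun setT f ->
  (forall x, `|f x| <= M) -> bsupp (fun x => ballI 1 x * f (n x)).
Proof.
move=> mf fM; apply: (bsuppM (C := M)) => //; first exact: bsupp_ball.
exact: (measurableT_comp mf (@measurable_normalize R d)).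
Qed.

(** [ballI 1] contains the origin and the punctured ball does not. As [normalize] fixes the origin,
    the condition [f origin = 0] makes the two integrands agree pointwise. *)
Lemma ge0_integral_surface_lint (f : d.-tuple R -> R) (M : R) : measurable_fun setT f ->
  (forall x, 0 <= f x <= M) -> f origin = 0 ->
  (\int[sigma]_x (f x)%:E = (d%:R * lint (fun x => ballI 1 x * f (n x)))%:E)%E.
Proof.
move=> mf f0M forig; have f0 x : 0 <= f x by case/andP: (f0M x).
rewrite (ge0_integral_surface (f := EFin \o f)); last 2 first.
- exact/measurable_EFinP.
- by move=> x /=; rewrite lee_fin.
rewrite EFinM; congr (_ * _)%E.
have bf : bsupp (fun x => ballI 1 x * f (n x)).
  by apply: (bsupp_normalize (M := M)) => // x; have /andP[? ?] := f0M x; rewrite ger0_norm.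
rewrite /lint /Rintegral fineK; last by apply: integrable_fin_num => //; exact: bsupp_integrable.
rewrite [LHS]integral_mkcond; apply: eq_integral => x _; rewrite patchE.
case: ifPn => /= [|xb].
  by rewrite inE /= => /andP[_ x1]; rewrite /ballI x1 mul1r.
rewrite /ballI; case: (leP (enorm x) 1) => x1; last by rewrite mul0r.
have x0 : x = origin.
  apply/eqP; rewrite -enorm_eq0; apply: contraNT xb => x0; rewrite inE /punctured_ball /= x1 andbT.
  by rewrite lt0r x0 enorm_ge0.
rewrite x0 (_ : n origin = origin) ?forig ?mulr0//.
by apply: eq_from_tnth => j; rewrite !tnth_mktuple mul0r.
Qed.

Lemma Rintegral_sphere (h : d.-tuple R -> R) (M : R) :
  measurable_fun sphere h -> (forall x, sphere x -> `|h x| <= M) -> h origin = 0 ->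
  \int[sigma]_(x in sphere) h x = d%:R * lint (fun x => ballI 1 x * h (n x)).
Proof.
move=> mh hM horig; rewrite Rintegral_mkcond.
pose k := h \_ sphere.
have k0 x : ~ sphere x -> k x = 0 by move=> xS; rewrite /k patchE memNset.
have kS x : sphere x -> k x = h x by move=> xS; rewrite /k patchE mem_set.
have ko : k origin = 0 by apply: k0; rewrite /sphere /= enorm0 => /esym/eqP; rewrite oner_eq0.
have mk : measurable_fun setT k by apply/(measurable_restrictT _ (@measurable_sphere R d)).
have kM x : `|k x| <= `|M|.
  have [xS|xS] := pselect (sphere x); last by rewrite k0// normr0.
  by rewrite kS//; apply: (le_trans (hM _ xS)); exact: ler_norm.
have -> : lint (fun x => ballI 1 x * h (n x)) = lint (fun x => ballI 1 x * k (n x)).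
  congr lint; apply/funext => x; congr (_ * _).
  have [->|x0] := eqVneq x origin.
    rewrite (_ : n origin = origin) ?horig ?ko//.
    by apply: eq_from_tnth => j; rewrite !tnth_mktuple mul0r.
  by rewrite kS//; exact: normalize_sphere.
pose p x := Num.max (k x) 0; pose q x := Num.max (- k x) 0.
have kE x : k x = p x - q x.
  rewrite /p /q; have [h1|h1] := leP 0 (k x).
    by rewrite ?(max_l h1) max_r ?oppr_le0// subr0.
  by rewrite ?(max_r (ltW h1)) max_l ?oppr_ge0 ?(ltW h1)// sub0r opprK.
have mp : measurable_fun setT p by apply: measurable_maxr.
have mq : measurable_fun setT q by apply: measurable_maxr => //; exact: measurableT_comp.
have pM x : 0 <= p x <= `|M|.
  rewrite /p le_max lexx orbT/= ge_max normr_ge0 andbT.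
  exact: le_trans (ler_norm _) (kM x).
have qM x : 0 <= q x <= `|M|.
  rewrite /q le_max lexx orbT/= ge_max normr_ge0 andbT.
  by apply: le_trans (ler_norm _) _; rewrite normrN.
have po : p origin = 0 by rewrite /p ko maxxx.
have qo : q origin = 0 by rewrite /q ko oppr0 maxxx.
have Ip := ge0_integral_surface_lint mp pM po.
have Iq := ge0_integral_surface_lint mq qM qo.
have integ (f : d.-tuple R -> R) : measurable_fun setT f -> (forall x, 0 <= f x <= `|M|) -> f origin = 0 ->
    sigma.-integrable setT (EFin \o f).
  move=> mf fM fo; apply/integrableP; split; first exact/measurable_EFinP.
  under eq_integral => x _ do rewrite /= ger0_norm ?(andP (fM x)).1//.
  by rewrite (ge0_integral_surface_lint mf fM fo) ltry.
have bs (f : d.-tuple R -> R) : measurable_fun setT f -> (forall x, 0 <= f x <= `|M|) -> 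
    bsupp (fun x => ballI 1 x * f (n x)).
  move=> mf fM; apply: (bsupp_normalize (M := `|M|)) => // x.
  by have /andP[? ?] := fM x; rewrite ger0_norm.
transitivity (\int[sigma]_x (p x - q x)).
  by apply: eq_Rintegral => x _; rewrite -/k kE.
rewrite RintegralB//; [|exact: integ|exact: integ].
rewrite /Rintegral Ip Iq /= -mulrBr -lintB; [|exact: bs|exact: bs].
by congr (_ * lint _); apply/funext => x; rewrite kE mulrBr.
Qed.

End surface_integral.

(** * Uniform bound for the truncated kernel *)

Section cutoff.
Context {R : realType}.
Implicit Types t u : R.

Lemma bernoulli_le u n : 0 <= u <= 1 -> 1 - u ^+ n <= n%:R * (1 - u).
Proof.
move=> /andP[u0 u1]; elim: n => [|n IH]; first by rewrite expr0 subrr mul0r.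
rewrite exprS.
have : 0 <= u ^+ n <= 1 by rewrite exprn_ge0// exprn_ile1.
move=> /andP[v0 v1]; rewrite -natr1 mulrDl mul1r.
have : 0 <= (1 - u ^+ n) * (1 - u) by rewrite mulr_ge0 ?subr_ge0.
nra.
Qed.

(** Lipschitz regularity of the cutoff is enough, because the symbol it multiplies is only Hoelder
    continuous. *)
Definition theta t := Num.max 0 (Num.min 1 (2 - t)).

Lemma theta_ge0 t : 0 <= theta t. Proof. by rewrite /theta le_max lexx. Qed.

Lemma theta_le1 t : theta t <= 1.
Proof. by rewrite /theta ge_max ler01 ge_min lexx. Qed.

Lemma theta1 t : t <= 1 -> theta t = 1.
Proof.
move=> t1; rewrite /theta; have -> : Num.min 1 (2 - t) = 1 by apply/min_idPl; lra.
by apply/max_idPr.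
Qed.

Lemma theta0 t : 2 <= t -> theta t = 0.
Proof.
move=> t2; rewrite /theta; apply/max_idPl; rewrite ge_min; apply/orP; right; lra.
Qed.

(** A Lipschitz bound in terms of ratios, the form in which values of [eta] at two points will be
    compared. The constant [2] is the largest argument at which [theta] still varies. *)
Lemma theta_lip t u : 0 <= t -> 0 <= u <= 1 -> `|theta t - theta (u * t)| <= 2 * (1 - u).
Proof.
move=> t0 /andP[u0 u1].
have [t2|t2] := leP t 2; last first.
  rewrite (theta0 (ltW t2)) sub0r normrN ger0_norm ?theta_ge0//.
  rewrite /theta ge_max; apply/andP; split; first by rewrite mulr_ge0// subr_ge0.
  by rewrite ge_min; apply/orP; right; nra.
have ut : u * t <= t by rewrite ler_piMl.
have d2 : t - u * t <= 2 * (1 - u) by nra.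
apply: le_trans d2; rewrite /theta.
have lip1 (x y : R) : y <= x -> `|Num.max 0 (Num.min 1 (2 - x)) - Num.max 0 (Num.min 1 (2 - y))| <= x - y.
  move=> yx.
  have [hx|hx] := leP 1 (2 - x); have [hy|hy] := leP 1 (2 - y).
  - by rewrite subrr normr0 subr_ge0.
  - by have [?|?] := leP 0 (2 - y); have [?|?] := leP 0 (1 : R); rewrite ler_norml; apply/andP; split; lra.
  - by have [?|?] := leP 0 (2 - x); have [?|?] := leP 0 (1 : R); rewrite ler_norml; apply/andP; split; lra.
  - by have [?|?] := leP 0 (2 - x); have [?|?] := leP 0 (2 - y); rewrite ler_norml; apply/andP; split; lra.
exact: lip1.
Qed.

Lemma measurable_theta : measurable_fun setT theta.
Proof.
apply: measurable_maxr; first exact: measurable_cst.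
by apply: measurable_minr => //; apply: measurable_funB.
Qed.

(** A difference of cutoffs at consecutive dyadic scales, so that sums over scales telescope. *)
Definition psi t := theta (t / 2) - theta t.

Lemma psi_le1 t : `|psi t| <= 1.
Proof.
have := theta_ge0 t; have := theta_le1 t; have := theta_ge0 (t / 2); have := theta_le1 (t / 2).
by move=> *; rewrite /psi ler_norml; apply/andP; split; lra.
Qed.

Lemma psi0l t : t <= 1 -> psi t = 0.
Proof. by move=> t1; rewrite /psi !theta1 ?subrr//; lra. Qed.

Lemma psi0r t : 4 <= t -> psi t = 0.
Proof. by move=> t1; rewrite /psi !theta0 ?subrr//; lra. Qed.

Lemma psi_lip t u : 0 <= t -> 0 <= u <= 1 -> `|psi t - psi (u * t)| <= 4 * (1 - u).
Proof.
move=> t0 hu; have h1 := theta_lip t0 hu.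
have h2 : `|theta (t / 2) - theta (u * (t / 2))| <= 2 * (1 - u) by apply: theta_lip => //; rewrite divr_ge0.
rewrite mulrA in h2; rewrite /psi.
have -> : theta (t / 2) - theta t - (theta (u * t / 2) - theta (u * t)) =
  (theta (t / 2) - theta (u * t / 2)) - (theta t - theta (u * t)) by ring.
apply: (le_trans (ler_normB _ _)); lra.
Qed.

Variable d : nat.

(** The homogeneity of the symbol is built into the bump, so that dilates of one function produce
    all scales. *)
Definition shell_cut t := psi t * t `^ (- d%:R).

Lemma shell_cut0l t : t <= 1 -> shell_cut t = 0. Proof. by move=> h; rewrite /shell_cut psi0l// mul0r. Qed.
Lemma shell_cut0r t : 4 <= t -> shell_cut t = 0. Proof. by move=> h; rewrite /shell_cut psi0r// mul0r. Qed.

Lemma powRn_le1 t : 1 <= t -> t `^ (- d%:R) <= 1.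
Proof. by move=> t1; rewrite -[leRHS](powRr0 t) ler_powR// oppr_le0. Qed.

Lemma shell_cut_le1 t : `|shell_cut t| <= 1.
Proof.
have [t1|t1] := leP t 1; first by rewrite shell_cut0l// normr0.
rewrite /shell_cut normrM mulr_ile1// ?psi_le1// ger0_norm ?powR_ge0//.
by rewrite powRn_le1// ltW.
Qed.

Lemma measurable_shell_cut : measurable_fun setT shell_cut.
Proof.
apply: measurable_funM; last exact: measurable_powR.
apply: measurable_funB; last exact: measurable_theta.
by apply: (measurableT_comp measurable_theta); apply: measurable_funM.
Qed.

(** The power $t^{-d}$ is singular at [0], but [psi] vanishes up to [1]. If [u * t <= 1], the bound
    for [psi] suffices; otherwise the powers differ by at most $1-u^d\le d(1-u)$. *)
Lemma shell_cut_lip t u : 0 <= t -> 0 <= u <= 1 -> `|shell_cut t - shell_cut (u * t)| <= (4 + d%:R) * (1 - u).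
Proof.
move=> t0 hu; have /andP[u0 u1] := hu; have P := psi_lip t0 hu.
have ut : u * t <= t by rewrite ler_piMl.
have u1' : 0 <= 1 - u by rewrite subr_ge0.
have [t1|t1] := leP t 1.
  rewrite !shell_cut0l//; last exact: le_trans t1.
  by rewrite subrr normr0 mulr_ge0// addr_ge0.
have [ut1|ut1] := leP (u * t) 1.
  rewrite (shell_cut0l ut1) subr0; rewrite (psi0l ut1) subr0 in P.
  rewrite /shell_cut normrM; apply: (@le_trans _ _ `|psi t|).
    by rewrite ler_piMr// ger0_norm ?powR_ge0// powRn_le1// ltW.
  by apply: (le_trans P); rewrite ler_wpM2r// lerDl.
have u0' : 0 < u.
  by rewrite lt0r u0 andbT; apply/eqP => uE; move: ut1; rewrite uE mul0r ltr10.
have -> : shell_cut t - shell_cut (u * t) = (psi t - psi (u * t)) * t `^ (- d%:R)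
   - psi (u * t) * ((u * t) `^ (- d%:R) - t `^ (- d%:R)) by rewrite /shell_cut; ring.
apply: (le_trans (ler_normB _ _)); rewrite [leRHS]mulrDl; apply: lerD.
  apply: le_trans P; rewrite normrM ler_piMr// ger0_norm ?powR_ge0// powRn_le1// ltW//.
rewrite normrM -[leRHS]mul1r ler_pM ?psi_le1//.
have -> : (u * t) `^ (- d%:R) - t `^ (- d%:R) = (u * t) `^ (- d%:R) * (1 - u ^+ d).
  rewrite !powR_invn ?mulr_ge0// mulrBr mulr1; congr (_ - _).
  rewrite exprMn invfM mulrAC mulVf ?mul1r// expf_neq0// gt_eqF//.
have h1 : 0 <= 1 - u ^+ d by rewrite subr_ge0 exprn_ile1.
rewrite ger0_norm ?mulr_ge0 ?powR_ge0//.
apply: (@le_trans _ _ (1 - u ^+ d)); last exact: bernoulli_le.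
by rewrite ler_piMl// powRn_le1// ltW.
Qed.

End cutoff.

(** * A potential for sums over dyadic scales *)

Section lyapunov.
Context {R : realType}.
Variables (q gamma : R).
Hypotheses (q1 : 1 < q) (ga0 : 0 < gamma) (ga1 : gamma <= 1).

(* A bounded increasing potential: along a geometric progression [r_k] its increments dominate
   [min(r_k, r_k^-gamma)], so sums of such terms telescope. *)
Definition lyap (r : R) : R := r `^ gamma / (1 + r `^ gamma).

Let den (r : R) : 0 < 1 + r `^ gamma. Proof. by rewrite ltr_wpDr ?powR_ge0. Qed.

Lemma lyap_ge0 r : 0 <= lyap r.
Proof. by rewrite divr_ge0 ?powR_ge0// ltW. Qed.

Lemma lyap_le1 r : lyap r <= 1.
Proof. by rewrite ler_pdivrMr// mul1r lerDr. Qed.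

Lemma lyap_homo r s : 0 <= r -> r <= s -> lyap r <= lyap s.
Proof.
move=> r0 rs; have : r `^ gamma <= s `^ gamma.
  by apply: ge0_ler_powR; rewrite ?nnegrE ?(ltW ga0)// (le_trans r0).
rewrite /lyap => h; rewrite ler_pdivrMr// mulrAC ler_pdivlMr//; lra.
Qed.

Let Q := q `^ gamma.

Let Q1 : 1 < Q.
Proof.
rewrite /Q /powR gt_eqF ?(lt_trans ltr01)// -expR0 ltr_expR mulr_gt0// ln_gt0//.
Qed.

(** With $\rho=r^\gamma$ the increment is $(Q-1)\rho/((1+Q\rho)(1+\rho))$. Here $1+Q\rho\le
    Q(1+\rho)$ accounts for [Q], and $y(1+\rho)^2\le4\rho$, a consequence of the two bounds on [y],
    for the [4]. *)
Lemma lyap_step r (y : R) : 0 < r -> y <= r -> y <= r `^ (- gamma) ->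
  y <= 4 * Q / (Q - 1) * (lyap (q * r) - lyap r).
Proof.
move=> r0 y1 y2.
have q0 : 0 <= q by rewrite ltW// (lt_trans ltr01).
rewrite /lyap powRM ?(ltW r0)// -/Q.
set rho := r `^ gamma.
have rho0 : 0 < rho by exact: powR_gt0.
have yr : y <= rho \/ 1 <= rho.
  have [r1|r1] := leP r 1.
    left; apply: (le_trans y1); apply: ger1_powR => //; by rewrite r0.
  right; rewrite -(powRr0 r) ler_powR// ltW//.
have yr2 : y * rho <= 1.
  by rewrite -ler_pdivlMr// div1r -powRN.
have Q0 : 0 < Q by exact: lt_trans Q1.
have Qm : 0 < Q - 1 by rewrite subr_gt0.
have D1 : 0 < 1 + rho by rewrite ltr_wpDl.
have D2 : 0 < 1 + Q * rho by rewrite ltr_pwDl// ltW// mulr_gt0.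
have -> : 4 * Q / (Q - 1) * (Q * rho / (1 + Q * rho) - rho / (1 + rho))
   = 4 * Q * rho / ((1 + Q * rho) * (1 + rho)).
  by field; rewrite !gt_eqF.
rewrite ler_pdivlMr ?mulr_gt0//.
have [y0|y0] := leP y 0.
  apply: (@le_trans _ _ 0); first by rewrite mulr_le0_ge0// mulr_ge0// ltW.
  by rewrite !mulr_ge0// ltW.
have H1 : (1 + Q * rho) <= Q * (1 + rho) by rewrite mulrDr mulr1 lerD2r ltW.
apply: (@le_trans _ _ (y * (Q * (1 + rho) * (1 + rho)))).
  by rewrite ler_pM2l// ler_pM2r.
rewrite -!mulrA mulrCA [4 * _]mulrCA ler_pM2l//.
case: yr => h.
  nra.
nra.
Qed.

End lyapunov.

Section powR_nat.
Context {R : realType}.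

(** Distances will control only $1-u^{\mathrm{amin}}$. An integer multiple of [amin] exceeding [1]
    and all exponents lets the Bernoulli inequality pass to the other powers of [u]. *)
Lemma exists_nat_multiple d (a : d.-tuple R) : (forall j, 0 < tnth a j) ->
  exists n : nat, [/\ 1 <= n%:R * amin a & forall j, tnth a j <= n%:R * amin a].
Proof.
move=> a0; have al := amin_gt0 a0.
pose S := 1 + \sum_(j < d) tnth a j.
exists (Num.truncn (S / amin a)).+1.
have h : S <= (Num.truncn (S / amin a)).+1%:R * amin a.
  by rewrite -ler_pdivrMr// ltW// truncnS_gt.
have s0 : 0 <= \sum_(j < d) tnth a j by apply: sumr_ge0 => j _; exact: ltW.
split; first by apply: le_trans h; rewrite lerDl.
move=> j; apply: le_trans h; rewrite ler_wpDl// (bigD1 j)//= lerDl.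
by apply: sumr_ge0 => i _; exact: ltW.
Qed.

Lemma sub1_powR_le (u al b : R) (n : nat) : 0 < u -> u <= 1 -> 0 < al -> b <= n%:R * al ->
  1 - u `^ b <= n%:R * (1 - u `^ al).
Proof.
move=> u0 u1 al0 bn.
have h : (u `^ al) ^+ n <= u `^ b.
  by rewrite -powR_mulrn ?powR_ge0// -powRrM mulrC; apply: ger_powR; rewrite ?u0.
apply: (@le_trans _ _ (1 - (u `^ al) ^+ n)); first by rewrite lerD2l lerN2.
apply: bernoulli_le; rewrite powR_ge0/= -[leRHS](powRr0 u).
by apply: ger_powR; rewrite ?u0// ltW.
Qed.
End powR_nat.

(** * Hoelder continuity of the shell function *)

Section smooth_shell.
Context {R : realType} {d : nat} (a : d.-tuple R).
Hypothesis (a0 : forall j, 0 < tnth a j).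
Variables (g : d.-tuple R -> R) (C gamma : R).
Hypothesis hg : holder_sphere g C gamma.

Definition shell_fun (x : d.-tuple R) : R := shell_cut d (eta a x) * g (eta_dir a x).

Let C0 : 0 <= C. Proof. by case: hg. Qed.

Lemma shell_fun_small x : eta a x <= 1 -> shell_fun x = 0.
Proof. by move=> h; rewrite /shell_fun shell_cut0l// mul0r. Qed.

Lemma shell_fun_bound x : `|shell_fun x| <= C * etaI a 4 x.
Proof.
rewrite /etaI; case: (leP (eta a x) 4) => h4; last first.
  by rewrite /shell_fun shell_cut0r ?(ltW h4)// mul0r normr0 mulr0.
have [h1|h1] := leP (eta a x) 1; first by rewrite shell_fun_small// normr0 mulr_ge0.
have x0 : x != origin.
  by apply/eqP => xE; move: h1; rewrite xE eta_origin ltr10.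
rewrite /= mulr1 normrM -[leRHS]mul1r ler_pM ?shell_cut_le1//.
by apply: (holder_bound hg); exact: sphere_eta_dir.
Qed.

Lemma bsupp_shell_fun : bsupp shell_fun.
Proof.
split.
  apply: measurable_funM; last exact: measurable_holder_dir hg.
  by apply: (measurableT_comp (measurable_shell_cut d)); exact: measurable_eta.
have b4 : bsupp (etaI a 4) by apply: bsupp_etaI.
have [M [rho [M0 H]]] := bsuppP b4.
exists (C * M), rho => x; apply: (le_trans (shell_fun_bound x)).
rewrite -mulrA ler_wpM2l//; apply: le_trans (H x); exact: ler_norm.
Qed.

(** Dilate by [eta a x], so that [x] lands on the sphere. As [eta a x >= 1] this shrinks the
    distance, while [y] gets norm at most the stated power; the triangle inequality concludes. *)
Lemma eta_ratio x y : x != origin -> y != origin -> 1 <= eta a x -> eta a y <= eta a x ->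
  1 - (eta a y / eta a x) `^ amin a <= euclid_dist x y.
Proof.
move=> x0 y0 ex1 eyx.
have [ex Ex] := etaP a0 x0; have [ey Ey] := etaP a0 y0.
have := enorm_le_sub (dil a (eta a x) x) (dil a (eta a x) y).
rewrite Ex -dil_tsub => h.
have h1 : enorm (dil a (eta a x) (tsub x y)) <= euclid_dist x y.
  by rewrite euclid_distE; exact: enorm_dil_le1.
have h2 : enorm (dil a (eta a x) y) <= (eta a y / eta a x) `^ amin a.
  have -> : eta a x = eta a x / eta a y * eta a y by rewrite divfK// gt_eqF.
  rewrite -dilM ?divr_ge0 ?(ltW ex) ?(ltW ey)// divfK ?gt_eqF//.
  apply: (le_trans (enorm_dil_le a _ _)); first by rewrite ler_pdivlMr// mul1r.
  rewrite Ey mulr1 -invf_div -[(_ / _)^-1]powR_inv1; last by rewrite divr_ge0 ?(ltW ex) ?(ltW ey).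
  by rewrite -powRrM mulN1r opprK.
by lra.
Qed.

(** Where [eta <= 1] the function vanishes, so the larger [eta] may be taken above [1], where
    dilations contract. The ratio [u] of the two values of [eta] then controls the change of the
    cutoff and the displacement of the direction alike. *)
Lemma shell_fun_holder_le : exists2 c : R, 0 <= c & forall x y, eta a y <= eta a x ->
  `|shell_fun x - shell_fun y| <= c * euclid_dist x y `^ gamma.
Proof.
have [n [n1 na]] := exists_nat_multiple a0.
have al := amin_gt0 a0.
have /andP[gm0 gm1] := holder_exp hg.
have n10 : (0 : R) <= 1 + n%:R by rewrite addr_ge0.
have n11 : (1 : R) <= (1 + n%:R) `^ gamma.
  by rewrite -[leLHS](powRr0 (1 + n%:R : R)) ler_powR ?(ltW gm0)// lerDl.
exists (C * (5 + d%:R) * (1 + n%:R) `^ gamma) => [|x y yx].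
  by rewrite !mulr_ge0 ?addr_ge0 ?powR_ge0.
set D := euclid_dist x y.
have D0 : 0 <= D by exact: euclid_dist_ge0.
have [x1|x1] := leP (eta a x) 1.
  rewrite !shell_fun_small ?(le_trans yx)// subrr normr0.
  by rewrite !mulr_ge0 ?addr_ge0 ?powR_ge0.
have x0 : x != origin by apply/eqP => xE; move: x1; rewrite xE eta_origin ltr10.
have xS := sphere_eta_dir a0 x0.
(* The origin has no direction, but a point with [eta > 1] is at distance at least [1] from it, so
   the bound on the function suffices. *)
have [yE|y0] := eqVneq y origin.
  rewrite yE (shell_fun_small (x := origin)) ?eta_origin// subr0.
  have D1 : 1 <= D.
    rewrite /D yE euclid_distE (_ : tsub x origin = x); last first.
      by apply: eq_from_tnth => i; rewrite !tnth_mktuple subr0.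
    by rewrite leNgt; apply/negP => /ltW; rewrite -(eta_le1 a0) leNgt x1.
  have Dg : 1 <= D `^ gamma by rewrite -[leLHS](powRr0 D) ler_powR ?(ltW gm0).
  apply: (@le_trans _ _ C).
    apply: (le_trans (shell_fun_bound x)).
    by rewrite ler_piMr// etaI_le1.
  rewrite -mulrA -mulrA ler_peMr//.
  have h5 : (1 : R) <= 5 + d%:R by rewrite -[leLHS]addr0 lerD// ler1n.
  apply: (le_trans h5); rewrite ler_peMr ?addr_ge0//.
  by rewrite -[leLHS]mulr1 ler_pM.
have yS := sphere_eta_dir a0 y0.
have [ex Ex] := etaP a0 x0; have [ey Ey] := etaP a0 y0.
pose u := eta a y / eta a x.
have u0 : 0 < u by rewrite divr_gt0.
have u1 : u <= 1 by rewrite ler_pdivrMr// mul1r.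
have uy : eta a y = u * eta a x by rewrite /u divfK// gt_eqF.
have ur : 1 - u `^ amin a <= D by apply: eta_ratio => //; exact: ltW.
have ub b : b <= n%:R * amin a -> 1 - u `^ b <= n%:R * D.
  move=> bn; apply: (le_trans (sub1_powR_le u0 u1 al bn)).
  by rewrite ler_wpM2l.
have u1D : 1 - u <= n%:R * D by rewrite -{1}[u](powRr1 (ltW u0)); exact: ub.
have dD : euclid_dist (eta_dir a x) (eta_dir a y) <= (1 + n%:R) * D.
  rewrite euclid_distE.
  (* [y] dilated by the parameter of [x]: it differs from the direction of [x] by a contracted copy
     of [tsub x y], and from the direction of [y] by the factors $u^{a_i}$. *)
  pose z := dil a (eta a x) y.
  have -> : tsub (eta_dir a x) (eta_dir a y) =
      tsub (dil a (eta a x) (tsub x y)) (tsub (eta_dir a y) z).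
    by apply: eq_from_tnth => i; rewrite !tnth_mktuple; ring.
  apply: (le_trans (enorm_le_sub _ (dil a (eta a x) (tsub x y)))).
  rewrite mulrDl mul1r; apply: lerD.
    by rewrite /D euclid_distE; apply: (enorm_dil_le1 a0); exact: ltW.
  pose z' : d.-tuple R := [tuple (n%:R * D) * tnth (eta_dir a y) i | i < d].
  apply: (@le_trans _ _ (enorm z')); last first.
    by rewrite enormZ yS mulr1 ger0_norm// mulr_ge0.
  apply: enorm_le_norm => i.
  have zE : tnth z i = u `^ (tnth a i) * tnth (eta_dir a y) i.
    rewrite /z tnth_dil tnth_dil mulrA; congr (_ * _).
    rewrite uy powRM ?(ltW u0) ?(ltW ex)// mulrA -powRD ?subrr ?powRr0 ?mul1r//.
    by apply/implyP => _; rewrite gt_eqF.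
  have tsubE (v w : d.-tuple R) : tnth (tsub v w) i = tnth v i - tnth w i by rewrite tnth_mktuple.
  rewrite [tnth z' i]tnth_mktuple 3!tsubE zE addrAC subrr add0r normrN.
  rewrite -{1}[tnth (eta_dir a y) i]mul1r -mulrBl !normrM ler_wpM2r//.
  have ui : u `^ tnth a i <= 1.
    by rewrite -[leRHS](powRr0 u); apply: ger_powR; rewrite ?u0// ltW.
  by rewrite !ger0_norm ?subr_ge0 ?mulr_ge0//; exact: ub.
rewrite /shell_fun.
have -> : shell_cut d (eta a x) * g (eta_dir a x) - shell_cut d (eta a y) * g (eta_dir a y) =
   (shell_cut d (eta a x) - shell_cut d (eta a y)) * g (eta_dir a x) +
   shell_cut d (eta a y) * (g (eta_dir a x) - g (eta_dir a y)) by ring.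
apply: (le_trans (ler_normD _ _)).
have P1 : `|shell_cut d (eta a x) - shell_cut d (eta a y)| <= (4 + d%:R) * ((1 + n%:R) * D) `^ gamma.
  rewrite uy; apply: (le_trans (shell_cut_lip d (ltW ex) _)); first by rewrite (ltW u0).
  rewrite ler_wpM2l ?addr_ge0//.
  have w1 : 1 - u <= (1 + n%:R) * D by rewrite mulrDl mul1r ler_wpDl.
  have w0 : 0 <= 1 - u by rewrite subr_ge0.
  apply: (@le_trans _ _ ((1 - u) `^ gamma)).
    have [->|w] := eqVneq (1 - u) 0; first exact: powR_ge0.
    by apply: ger1_powR => //; rewrite lt0r w w0/= lerBlDr lerDl ltW.
  by apply: ge0_ler_powR; rewrite ?nnegrE ?(ltW gm0) ?mulr_ge0.
have P2 : `|g (eta_dir a x) - g (eta_dir a y)| <= C * ((1 + n%:R) * D) `^ gamma.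
  apply: (le_trans (holder_diff hg xS yS)); rewrite ler_wpM2l//.
  by apply: ge0_ler_powR; rewrite ?nnegrE ?(ltW gm0) ?mulr_ge0 ?euclid_dist_ge0.
have -> : C * (5 + d%:R) * (1 + n%:R) `^ gamma * D `^ gamma =
   (4 + d%:R) * ((1 + n%:R) * D) `^ gamma * C + 1 * (C * ((1 + n%:R) * D) `^ gamma).
  by rewrite powRM//; ring.
apply: lerD; rewrite normrM; apply: ler_pM => //; last exact: shell_cut_le1.
exact: (holder_bound hg).
Qed.

Lemma shell_fun_holder : exists2 c : R, 0 <= c & forall x y,
  `|shell_fun x - shell_fun y| <= c * euclid_dist x y `^ gamma.
Proof.
have [c c0 H] := shell_fun_holder_le; exists c => // x y.
have [h|h] := leP (eta a y) (eta a x); first exact: H.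
by rewrite distrC euclid_distC; apply: H; exact: ltW.
Qed.

End smooth_shell.

(** * Decay of the transform of the shell function *)

Section shell_transform.
Context {R : realType} {d : nat} (a : d.-tuple R).
Hypotheses (d0 : (0 < d)%N) (a0 : forall j, 0 < tnth a j)
  (asum : \sum_(j < d) tnth a j = d%:R).
Variables (g : d.-tuple R -> R) (C gamma : R).
Hypothesis hg : holder_sphere g C gamma.
Hypothesis g0 : lint (fun x => ballI 1 x * g (eta_dir a x)) = 0.

(* [tau] stands for the cosine or the sine. *)
Variable tau : R -> R.
Hypotheses (mtau : measurable_fun setT tau) (tau_le1 : forall t, `|tau t| <= 1)
  (tau_lip : forall s t, `|tau s - tau t| <= `|s - t|)
  (tau_pi : forall t, tau (t + pi) = - tau t).

Let C0 : 0 <= C. Proof. by case: hg. Qed.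

Definition wave (y : d.-tuple R) (x : d.-tuple R) : R := tau (2 * pi * edot y x).

Lemma measurable_wave y : measurable_fun setT (wave y).
Proof.
apply: (measurableT_comp mtau); apply: measurable_funM => //.
by apply: measurable_sum => i; apply: measurable_funM => //; exact: measurable_tnth.
Qed.

Lemma wave_le1 y x : `|wave y x| <= 1. Proof. exact: tau_le1. Qed.

Local Notation h := (shell_fun a g).

Let bh : bsupp h. Proof. exact: bsupp_shell_fun hg. Qed.

Definition shell_hat (y : d.-tuple R) : R := lint (fun x => h x * wave y x).

Let bhw y : bsupp (fun x => h x * wave y x).
Proof. exact: (bsuppM bh (measurable_wave y) (wave_le1 y)). Qed.

(** [shell_cut] is Lipschitz above [1] and supported in [[1, 4]], so [lint_mean_zero] applies on
    that shell. *)
Lemma lint_shell_fun0 : lint h = 0.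
Proof.
have K0 : (0 : R) <= 4 + d%:R by rewrite addr_ge0.
have := @lint_mean_zero _ _ a a0 asum (g \o eta_dir a) _ (shell_cut d) 1
  (measurable_holder_dir a0 hg) (holder_dir_bound a0 hg) (holder_dir_invariant a0 g) g0
  (measurable_shell_cut d) (shell_cut_le1 d) (4 + d%:R) 1 4 ltr01 _ _ K0.
move=> H; rewrite -[RHS]H; last 2 first.
- by rewrite ler1n.
- suff W (x y : R) : 1 < x <= 4 -> y <= x -> 1 < y -> `|shell_cut d x - shell_cut d y| <= (4 + d%:R) * `|x - y|.
    move=> x y hx hy; have [yx|xy] := leP y x; first by apply: W => //; case/andP: hy.
    by rewrite distrC [`|x - y|]distrC; apply: W; [|exact: ltW|case/andP: hx].
  move=> /andP[x1 x4] yx y1; have x0 : 0 < x by exact: lt_trans x1.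
  have -> : y = (y / x) * x by rewrite divfK// gt_eqF.
  apply: (le_trans (shell_cut_lip d (ltW x0) _)).
    by rewrite divr_ge0 ?(ltW x0) ?ler_pdivrMr ?mul1r// ltW// (lt_trans ltr01).
  rewrite ler_wpM2l// divfK ?gt_eqF// ger0_norm ?subr_ge0//.
  rewrite -(@ler_pM2r _ x)// mulrBl mul1r divfK ?gt_eqF// ler_peMr ?subr_ge0// ltW//.
congr lint; apply/funext => x; rewrite shellIE ?ler1n// /shell_fun /=.
case: (leP (eta a x) 1) => h1 /=.
  by rewrite shell_cut0l// !mul0r.
case: (leP (eta a x) 4) => h4 /=; first by rewrite mul1r.
by rewrite shell_cut0r ?(ltW h4)// !mul0r.
Qed.

(** Mean zero allows subtracting the constant [tau 0]; on the bounded support the remaining phase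
    difference is of order [enorm y]. *)
Lemma shell_hat_small : exists2 c : R, 0 <= c & forall y, `|shell_hat y| <= c * enorm y.
Proof.
have [M [rho [M0 H]]] := bsuppP bh.
pose c := M * (2 * pi * `|rho|) * lint (@ballI R d rho).
exists c => [|y].
  by rewrite !mulr_ge0 ?pi_ge0// lint_ge0// => x; exact: ballI_ge0.
have -> : shell_hat y = lint (fun x => h x * (wave y x - tau 0)).
  transitivity (shell_hat y - lint (fun x => tau 0 * h x)).
    by rewrite lintZ// lint_shell_fun0 mulr0 subr0.
  rewrite -lintB//; last exact: bsuppZ.
  by congr lint; apply/funext => x; ring.
have -> : c * enorm y = lint (fun x : d.-tuple R => M * (2 * pi * `|rho|) * enorm y * ballI rho x).
  by rewrite lintZ; [rewrite /c; ring|exact: bsupp_ball].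
apply: lint_bound.
- apply: (bsuppM (C := 2)) => //.
    by apply: measurable_funB => //; exact: measurable_wave.
  move=> x; apply: (le_trans (ler_normB _ _)).
  by have := wave_le1 y x; have := tau_le1 0; lra.
- by apply: bsuppZ; exact: bsupp_ball.
- move=> x; rewrite normrM.
  have := H x; rewrite /ballI; case: (leP (enorm x) rho) => hx Hx; last first.
    have -> : `|h x| = 0 by apply/eqP; rewrite eq_le normr_ge0 andbT (le_trans Hx)// mulr0.
    by rewrite mul0r mulr0.
  rewrite !mulr1 in Hx *; rewrite -mulrA; apply: ler_pM => //.
  apply: (le_trans (tau_lip _ _)); rewrite subr0 !normrM (gtr0_norm (ltr0Sn _ _)) (ger0_norm (pi_ge0 _)).
  rewrite -!mulrA; do 2 (apply: ler_wpM2l; rewrite ?pi_ge0//); rewrite [leRHS]mulrC.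
  apply: (le_trans (edot_norm_le _ _)); rewrite ler_wpM2l ?enorm_ge0//.
  by apply: (le_trans hx); exact: ler_norm.
Qed.

(* Translating by half a period in the direction of [y] changes the sign of the wave. *)
Lemma shell_hat_large : exists2 c : R, 0 <= c & forall y, y != origin ->
  `|shell_hat y| <= c * enorm y `^ (- gamma).
Proof.
have [c c0 cP] := shell_fun_holder a0 hg.
have /andP[gm0 gm1] := holder_exp hg.
have b4 : bsupp (etaI a 4) by exact: bsupp_etaI.
have i4 : 0 <= lint (etaI a 4) by apply: lint_ge0 => x; exact: etaI_ge0.
exists (c * lint (etaI a 4)) => [|y y0]; first by rewrite mulr_ge0.
have n0 : 0 < enorm y by rewrite lt0r enorm_eq0 y0 enorm_ge0.
(* Chosen so that the translation by [dl = k y] shifts the phase by exactly [pi]. *)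
pose k := (2 * enorm y ^+ 2)^-1.
have k0 : 0 < k by rewrite invr_gt0 mulr_gt0// exprn_gt0.
pose dl : d.-tuple R := [tuple k * tnth y i | i < d].
pose T := affine [tuple (1 : R) | _ < d] dl.
have c1 : forall i : 'I_d, 0 < tnth [tuple (1 : R) | _ < d] i by move=> i; rewrite tnth_mktuple.
have p1 : (\prod_(i < d) tnth [tuple (1 : R) | _ < d] i)^-1 = 1.
  by rewrite big1 ?invr1// => i _; rewrite tnth_mktuple.
have Ti x i : tnth (T x) i = tnth x i + tnth dl i by rewrite !tnth_mktuple mul1r.
have bT (f : d.-tuple R -> R) : bsupp f -> bsupp (f \o T) by exact: bsupp_affine.
have lT (f : d.-tuple R -> R) : bsupp f -> lint (f \o T) = lint f.
  by move=> bf; rewrite lint_affine// p1 mul1r.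
have edl : 2 * pi * edot y dl = pi.
  have -> : edot y dl = k * edot y y.
    by rewrite /edot mulr_sumr; apply: eq_bigr => i _; rewrite tnth_mktuple mulrCA.
  rewrite -sqr_enorm /k; field; exact: lt0r_neq0.
have ndl : enorm dl <= (enorm y)^-1.
  rewrite enormZ gtr0_norm// /k.
  rewrite (_ : _ * _ = (enorm y)^-1 / 2); last by field; exact: lt0r_neq0.
  by rewrite ler_pdivrMr// ler_peMr ?invr_ge0 ?ltW// ltr1n.
have wT x : wave y (T x) = - wave y x.
  rewrite /wave -tau_pi -{3}edl -mulrDr; congr (tau (_ * _)).
  rewrite /edot -big_split/=; apply: eq_bigr => i _; rewrite Ti; ring.
have E : 2 * shell_hat y = lint (fun x => (h x - h (T x)) * wave y x).
  rewrite mulr2n mulrDl mul1r {2}/shell_hat -lT// -lintD//; last exact: bT.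
  by congr lint; apply/funext => x; rewrite /= wT; ring.
have dT x : euclid_dist x (T x) = enorm dl.
  rewrite euclid_distC euclid_distE; congr enorm; apply: eq_from_tnth => i.
  by rewrite tnth_mktuple Ti addrAC subrr add0r.
(* The difference vanishes unless [x] or its translate has [eta <= 4], so the pointwise Hoelder
   bound integrates to a fixed multiple of itself. *)
have hT x : `|h x - h (T x)| <= c * enorm y `^ (- gamma) * (etaI a 4 x + etaI a 4 (T x)).
  have B : `|h x - h (T x)| <= c * enorm y `^ (- gamma).
    apply: (le_trans (cP _ _)); rewrite ler_wpM2l// dT.
    rewrite powRN -[leRHS]powR_inv1 ?powR_ge0// -powRrM mulrC powRrM powR_inv1 ?enorm_ge0//.
    apply: ge0_ler_powR; rewrite ?nnegrE ?(ltW gm0) ?enorm_ge0 ?invr_ge0 ?enorm_ge0//.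
  have := shell_fun_bound a0 hg x; have := shell_fun_bound a0 hg (T x).
  have W : 0 <= c * enorm y `^ (- gamma) by rewrite mulr_ge0 ?powR_ge0.
  rewrite /etaI; case: (leP (eta a (T x)) 4) => h1; case: (leP (eta a x) 4) => h2 /= _ _.
  + by apply: (le_trans B); rewrite ler_peMr// lerDl.
  + by apply: (le_trans B); rewrite add0r mulr1.
  + by apply: (le_trans B); rewrite addr0 mulr1.
  rewrite /shell_fun !shell_cut0r ?(ltW h1) ?(ltW h2)// !mul0r subrr normr0.
  by rewrite addr0 mulr0.
have b2 : bsupp (fun x : d.-tuple R => etaI a 4 x + etaI a 4 (T x)).
  by apply: bsuppD => //; exact: (bT (etaI a 4)).
have : `|2 * shell_hat y| <= c * enorm y `^ (- gamma) * (lint (etaI a 4) + lint (etaI a 4)).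
  rewrite E -{2}(lT _ b4) -lintD//; last exact: (bT (etaI a 4)).
  rewrite -lintZ//; apply: lint_bound.
  - apply: (bsuppM (C := 1)); [|exact: measurable_wave|exact: wave_le1].
    by apply: bsuppB => //; exact: (bT h).
  - exact: bsuppZ.
  - move=> x; rewrite normrM; apply: le_trans (hT x).
    by rewrite ler_piMr// wave_le1.
rewrite normrM (gtr0_norm (ltr0Sn _ _)).
have -> : c * enorm y `^ (- gamma) * (lint (etaI a 4) + lint (etaI a 4)) =
  2 * (c * lint (etaI a 4) * enorm y `^ (- gamma)) by ring.
by rewrite ler_pM2l.
Qed.

(** Along the dyadic orbit of [x] the norm grows at least by the factor [q = 2 ^ amin] per step.
    Each term is therefore dominated by an increment of [lyap], and telescoping leaves a bound free
    of [N], [s] and [x]. *)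
Lemma shell_hat_sum : exists2 c : R, 0 <= c & forall (N : nat) (s : R) (x : d.-tuple R), 0 < s ->
  \sum_(0 <= k < N) `|shell_hat (dil a (s * 2 ^+ k)^-1 x)| <= c.
Proof.
have [c1 c10 H1] := shell_hat_small.
have [c2 c20 H2] := shell_hat_large.
have /andP[gm0 gm1] := holder_exp hg.
have al := amin_gt0 a0.
pose q : R := 2 `^ amin a.
have q1 : 1 < q.
  rewrite /q /powR gt_eqF// -[ltLHS](@expR0 R) ltr_expR; apply: mulr_gt0 => //; apply: ln_gt0; exact: ltr1n.
pose Q := q `^ gamma.
have Q1 : 0 < Q - 1.
  rewrite subr_gt0 /Q /powR gt_eqF ?(lt_trans ltr01 q1)// -(@expR0 R) ltr_expR mulr_gt0//.
  exact: ln_gt0.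
pose c := c1 + c2 + 1.
have c0 : 0 < c by rewrite ltr_wpDl// addr_ge0.
pose K := c * (4 * Q / (Q - 1)).
have K0 : 0 <= K.
  rewrite /K mulr_ge0 ?(ltW c0)// divr_ge0 ?(ltW Q1)// mulr_ge0// /Q powR_ge0//.
exists K => // N s x s0.
have [->|x0] := eqVneq x origin.
  rewrite big1 // => k _; apply/eqP; rewrite eq_le normr_ge0 andbT.
  by apply: (le_trans (H1 _)); rewrite dil0 enorm0 mulr0.
pose y k := dil a (s * 2 ^+ k)^-1 x.
have sk k : 0 < s * 2 ^+ k by rewrite mulr_gt0// exprn_gt0.
have y0 k : y k != origin by rewrite /y dil_eq0// invr_gt0.
have yn k : 0 < enorm (y k) by rewrite lt0r enorm_eq0 y0 enorm_ge0.
have yq k : q * enorm (y k) <= enorm (y k.+1).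
  have -> : y k.+1 = dil a 2^-1 (y k).
    by rewrite /y dilM ?invr_ge0 ?(ltW (sk _))// exprS mulrCA invfM.
  have h2 : (0 : R) < 2^-1 by rewrite invr_gt0.
  have h3 : (2^-1 : R) <= 1 by rewrite invf_le1// ler1n.
  have := enorm_dil_ge a (y k) h2 h3.
  rewrite -powR_inv1// -powRrM mulN1r opprK//.
have st k : `|shell_hat (y k)| <= K * (lyap gamma (enorm (y k.+1)) - lyap gamma (enorm (y k))).
  have B : `|shell_hat (y k)| / c <=
     4 * Q / (Q - 1) * (lyap gamma (q * enorm (y k)) - lyap gamma (enorm (y k))).
    apply: lyap_step => //.
      rewrite ler_pdivrMr// mulrC; apply: (le_trans (H1 _)).
      by rewrite ler_wpM2r ?enorm_ge0// /c; lra.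
    rewrite ler_pdivrMr// mulrC; apply: (le_trans (H2 _ (y0 k))).
    by rewrite ler_wpM2r ?powR_ge0// /c; lra.
  rewrite ler_pdivrMr// in B; apply: (le_trans B); rewrite mulrC mulrA -/K.
  rewrite ler_wpM2l// lerD2r; apply: lyap_homo => //.
  by rewrite mulr_ge0 ?enorm_ge0// ltW// (lt_trans ltr01).
apply: (@le_trans _ _ (\sum_(0 <= k < N) K * (lyap gamma (enorm (y k.+1)) - lyap gamma (enorm (y k))))).
  by apply: ler_sum => k _; exact: st.
rewrite -mulr_sumr telescope_sumr// ler_piMr//.
by rewrite lerBlDr (le_trans (lyap_le1 _ _))// lerDl lyap_ge0.
Qed.

End shell_transform.

(** * The truncated kernel and its dyadic decomposition *)

Section annulus_cut.
Context {R : realType} {d : nat} (a : d.-tuple R).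
Hypotheses (a0 : forall j, 0 < tnth a j).

Definition annulus_cut (eps r : R) (xi : d.-tuple R) : R :=
  if eps <= eta a xi <= r then eta a xi ^- d else 0.

Lemma measurable_annulus_cut eps r : measurable_fun setT (annulus_cut eps r).
Proof.
rewrite (_ : annulus_cut eps r = fun xi => if eps <= eta a xi <= r then eta a xi `^ (- d%:R) else 0).
  apply: measurable_fun_ifT => //; last first.
    apply: (measurableT_comp (measurable_powR _)); exact: measurable_eta.
  have me := measurable_eta a0.
  by apply: measurable_and; apply: measurable_fun_ler.
by apply/funext => xi; rewrite /annulus_cut powR_invn// eta_ge0.
Qed.

Lemma annulus_cut_ge0 eps r xi : 0 <= annulus_cut eps r xi.
Proof. by rewrite /annulus_cut; case: ifP => // _; rewrite invr_ge0 exprn_ge0// eta_ge0. Qed.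

Lemma annulus_cut_le eps r xi : 0 < eps -> annulus_cut eps r xi <= eps ^- d * etaI a r xi.
Proof.
move=> e0; rewrite /annulus_cut /etaI; case: (leP eps (eta a xi)) => h1 /=; last first.
  by rewrite mulr_ge0// invr_ge0 exprn_ge0// ltW.
case: (leP (eta a xi) r) => h2 /=; last by rewrite mulr0.
rewrite mulr1 lef_pV2 ?posrE ?exprn_gt0 ?(lt_le_trans e0)//.
by apply: lerXn2r; rewrite ?nnegrE ?(ltW e0)// (le_trans (ltW e0)).
Qed.

Lemma bsupp_annulus_cut eps r : 0 < eps -> 0 < r -> bsupp (annulus_cut eps r).
Proof.
move=> e0 r0; apply: (bsupp_le (measurable_annulus_cut eps r) (bsuppZ (eps ^- d) (bsupp_etaI a0 r0))).
move=> x; rewrite ger0_norm ?annulus_cut_ge0//; apply: le_trans (ler_norm _).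
exact: annulus_cut_le.
Qed.
End annulus_cut.

Section kernel_bound.
Context {R : realType} {d : nat} (a : d.-tuple R).
Hypotheses (a0 : forall j, 0 < tnth a j)
  (asum : \sum_(j < d) tnth a j = d%:R).
Variables (g : d.-tuple R -> R) (C gamma : R).
Hypothesis hg : holder_sphere g C gamma.
Hypothesis g0 : lint (fun x => ballI 1 x * g (eta_dir a x)) = 0.
Variable tau : R -> R.
Hypotheses (mtau : measurable_fun setT tau) (tau_le1 : forall t, `|tau t| <= 1)
  (tau_lip : forall s t, `|tau s - tau t| <= `|s - t|)
  (tau_pi : forall t, tau (t + pi) = - tau t).

Let C0 : 0 <= C. Proof. by case: hg. Qed.

Local Notation wave := (wave tau).
Local Notation V := (vol (R := R) (d := d)).

Lemma exists_dyadic_exponent (eps r : R) : 0 < eps -> eps <= r ->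
  exists N : nat, eps * 2 ^+ N <= r < eps * 2 ^+ N.+1.
Proof.
move=> e0 er.
have ex : exists n : nat, r < eps * 2 ^+ n.+1.
  exists (Num.truncn (r / eps)).
  rewrite -ltr_pdivrMl// mulrC; apply: (lt_le_trans (truncnS_gt _)).
  by rewrite -natrX ler_nat ltnW// ltn_expl.
exists (ex_minn ex); case: ex_minnP => n rn nmin; rewrite rn andbT.
case: n rn nmin => [|n] rn nmin; first by rewrite expr0 mulr1.
rewrite leNgt; apply/negP => h; have := nmin n h.
by rewrite ltnn.
Qed.

(** A Lipschitz substitute for the annulus cut, assembled from dilates of one shell function;
    [dyadE] telescopes it into a difference of two cutoffs. *)
Let dyad (eps : R) (N : nat) (xi : d.-tuple R) : R :=
  \sum_(0 <= k < N) (eps * 2 ^+ k) ^- d * shell_fun a g (dil a (eps * 2 ^+ k) xi).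

Let sh_dil (s : R) xi : 0 < s -> s ^- d * shell_fun a g (dil a s xi) =
  (theta (eta a xi / (s * 2)) - theta (eta a xi / s)) * (eta a xi ^- d * g (eta_dir a xi)).
Proof.
move=> s0; rewrite /shell_fun eta_dil// eta_dir_dil// /shell_cut.
rewrite (_ : eta a xi / (s * 2) = eta a xi / s / 2); last by field; rewrite gt_eqF.
rewrite -/(psi _) powR_invn ?divr_ge0 ?eta_ge0 ?(ltW s0)//.
(* At the origin both sides vanish, because [psi 0 = 0]. *)
have [->|e0] := eqVneq (eta a xi) 0.
  by rewrite mul0r psi0l// !mul0r mulr0.
rewrite exprMn exprVn; field.
by rewrite !expf_neq0// gt_eqF.
Qed.

Let dyadE (eps : R) N xi : 0 < eps -> dyad eps N xi =
  (theta (eta a xi / (eps * 2 ^+ N)) - theta (eta a xi / eps)) * (eta a xi ^- d * g (eta_dir a xi)).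
Proof.
move=> e0; rewrite /dyad.
have -> : eta a xi / eps = eta a xi / (eps * 2 ^+ 0) by rewrite expr0 mulr1.
rewrite -(telescope_sumr (fun k => theta (eta a xi / (eps * 2 ^+ k))))// mulr_suml.
apply: eq_bigr => k _; rewrite sh_dil; last by rewrite mulr_gt0// exprn_gt0.
by rewrite exprSr mulrA.
Qed.

Let bdyad (eps : R) N : 0 < eps -> bsupp (dyad eps N).
Proof.
move=> e0; apply: bsupp_sum => k; apply: bsuppZ.
apply: (@bsupp_dil _ _ a _ (shell_fun a g)); last exact: bsupp_shell_fun hg.
by rewrite mulr_gt0// exprn_gt0.
Qed.

(** The Jacobian of each dilation cancels its weight exactly, so every scale contributes the same
    transform, taken at a dilated frequency. *)
Let lint_dyad (eps : R) N x : 0 < eps -> lint (fun xi => dyad eps N xi * wave x xi) =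
  \sum_(0 <= k < N) shell_hat a g tau (dil a (eps * 2 ^+ k)^-1 x).
Proof.
move=> e0; pose F k xi := (eps * 2 ^+ k) ^- d *
  ((fun xi => shell_fun a g xi * wave (dil a (eps * 2 ^+ k)^-1 x) xi) \o dil a (eps * 2 ^+ k)) xi.
have sk k : 0 < eps * 2 ^+ k by rewrite mulr_gt0// exprn_gt0.
have bs k : bsupp (fun xi => shell_fun a g xi * wave (dil a (eps * 2 ^+ k)^-1 x) xi).
  apply: (bsuppM (C := 1)); first exact: bsupp_shell_fun hg.
    exact: measurable_wave.
  exact: wave_le1.
have bF k : bsupp (F k) by apply: bsuppZ; apply: bsupp_dil.
transitivity (lint (fun xi => \sum_(0 <= k < N) F k xi)).
  congr lint; apply/funext => xi; rewrite /dyad mulr_suml; apply: eq_bigr => k _.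
  rewrite /F /= -mulrA; congr (_ * (_ * _)); rewrite /wave; congr (tau (_ * _)).
  apply: eq_bigr => j _; rewrite !tnth_dil.
  rewrite mulrACA -powRM ?invr_ge0 ?(ltW (sk k))// mulVf ?gt_eqF// powR1 mul1r//.
rewrite lint_sum//; apply: eq_bigr => k _.
rewrite lintZ; last exact: bsupp_dil.
by rewrite (lint_dil asum)// mulrA mulVf ?mul1r// expf_neq0// gt_eqF.
Qed.

(** Sharp and Lipschitz cuts differ only for [t] between a scale and its double, the scale being
    [eps] or [s = eps 2^N]. There the difference is at most $2t^{-d}$, hence at most twice that
    scale to the power [-d]. *)
Let cut_dyad (eps : R) N (r t : R) : 0 < eps -> eps * 2 ^+ N <= r < eps * 2 ^+ N.+1 -> 0 <= t ->
  `|(if eps <= t <= r then t ^- d else 0) -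
    (theta (t / (eps * 2 ^+ N)) - theta (t / eps)) * t ^- d| <=
  2 * (eps ^- d * ((t <= 2 * eps)%R)%:R +
     (eps * 2 ^+ N) ^- d * ((t <= 2 * (eps * 2 ^+ N))%R)%:R).
Proof.
move=> e0 /andP[]; set s := eps * 2 ^+ N => sr rs t0.
have s0 : 0 < s by rewrite mulr_gt0// exprn_gt0.
have es : eps <= s by rewrite ler_peMr ?(ltW e0)// exprn_ege1// ler1n.
have rs2 : r < 2 * s by move: rs; rewrite exprS mulrCA.
have e2 : 0 <= eps ^- d by rewrite invr_ge0 exprn_ge0// ltW.
have s2 : 0 <= s ^- d by rewrite invr_ge0 exprn_ge0// ltW.
have R0 : 0 <= 2 * (eps ^- d * ((t <= 2 * eps)%R)%:R + s ^- d * ((t <= 2 * s)%R)%:R).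
  by rewrite mulr_ge0// addr_ge0// mulr_ge0.
have [te|te] := ltP t eps.
  rewrite /= !theta1 ?ler_pdivrMr ?mul1r ?(ltW te)//; last exact: le_trans (ltW te) es.
  by rewrite subrr mul0r subrr normr0.
have t1 : 0 < t by exact: lt_le_trans te.
have tV : 0 <= t ^- d by rewrite invr_ge0 exprn_ge0.
have big : `|(if t <= r then t ^- d else 0) - (theta (t / s) - theta (t / eps)) * t ^- d| <= 2 * t ^- d.
  have -> : (if t <= r then t ^- d else 0) - (theta (t / s) - theta (t / eps)) * t ^- d =
    (((t <= r)%R)%:R - (theta (t / s) - theta (t / eps))) * t ^- d.
    by case: (t <= r) => /=; rewrite [RHS]mulrBl ?mul1r ?mul0r.
  rewrite normrM (ger0_norm tV) ler_wpM2r//.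
  have := theta_ge0 (t / s); have := theta_le1 (t / s).
  have := theta_ge0 (t / eps); have := theta_le1 (t / eps).
  by case: (t <= r) => /= *; rewrite ler_norml; apply/andP; split; lra.
have mono u : 0 < u -> u <= t -> t ^- d <= u ^- d.
  move=> u0 ut; rewrite lef_pV2 ?posrE ?exprn_gt0//.
  by apply: lerXn2r; rewrite ?nnegrE ?(ltW u0) ?(ltW t1).
have [t2|t2] := leP t (2 * eps).
  apply: (le_trans big); rewrite ler_wpM2l// (le_trans (mono _ e0 te))//.
  by rewrite mulr1 lerDl mulr_ge0.
rewrite [theta (t / eps)]theta0; last by rewrite ler_pdivlMr// ltW.
have [ts|ts] := ltP t s.
  rewrite (le_trans (ltW ts) sr) theta1; last by rewrite ler_pdivrMr// mul1r ltW.
  by rewrite subr0 mul1r subrr normr0 mulr_ge0// addr_ge0// mulr_ge0.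
rewrite [theta (t / eps)]theta0 in big; last by rewrite ler_pdivlMr// ltW.
have [t3|t3] := leP t (2 * s).
  apply: (le_trans big); rewrite ler_wpM2l// (le_trans (mono _ s0 ts))//.
  by rewrite mulr1 lerDr mulr_ge0.
rewrite theta0; last by rewrite ler_pdivlMr// ltW.
rewrite (leNgt t r) (lt_trans rs2 t3) /= subrr mul0r subrr normr0.
by rewrite mulr_ge0// addr_ge0// mulr_ge0.
Qed.

(** The dyadic part is summed by [shell_hat_sum]. The edge terms need no cancellation, as $u^{-d}$
    times the volume of the set $\{\eta\le 2u\}$ is the same for all [u]. *)
Theorem kernel_bound : exists2 c : R, 0 <= c & forall (eps r : R) x, 0 < eps -> eps < r ->
  `|lint (fun xi => annulus_cut a eps r xi * g (eta_dir a xi) * wave x xi)| <= c.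
Proof.
have [c c0 cP] := shell_hat_sum a0 asum hg g0 mtau tau_le1 tau_lip tau_pi.
have V0 : 0 < V by exact: vol_gt0.
have CN : 0 <= C + `|g origin| by rewrite addr_ge0.
pose c' := c + (C + `|g origin|) * (2 * (2 ^+ d * V + 2 ^+ d * V)).
have c'0 : 0 <= c'.
  by rewrite addr_ge0// mulr_ge0// mulr_ge0// addr_ge0// mulr_ge0 ?exprn_ge0// ltW.
exists c' => // eps r x e0 er.
have r0 : 0 < r by exact: lt_trans er.
have [N HN] := exists_dyadic_exponent e0 (ltW er).
pose s := eps * 2 ^+ N.
have s0 : 0 < s by rewrite mulr_gt0// exprn_gt0.
pose f xi := annulus_cut a eps r xi * g (eta_dir a xi).
have bf : bsupp f.
  exact: (bsuppM (bsupp_annulus_cut a0 e0 r0) (measurable_holder_dir a0 hg) (holder_dir_bound a0 hg)).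
have bw k : bsupp k -> bsupp (fun xi => k xi * wave x xi).
  move=> bk; apply: (bsuppM (C := 1)) => //; first exact: measurable_wave.
  exact: wave_le1.
have -> : lint (fun xi => f xi * wave x xi) = lint (fun xi => dyad eps N xi * wave x xi) +
    lint (fun xi => (f xi - dyad eps N xi) * wave x xi).
  rewrite -lintD; [|by apply: bw; exact: bdyad|by apply: bw; apply: bsuppB => //; exact: bdyad].
  by congr lint; apply/funext => xi; ring.
apply: (le_trans (ler_normD _ _)); apply: lerD.
  rewrite lint_dyad//; apply: (le_trans (ler_norm_sum _ _ _)); exact: cP.
have be := bsupp_etaI a0 (mulr_gt0 (ltr0Sn R 1) e0).
have bs := bsupp_etaI a0 (mulr_gt0 (ltr0Sn R 1) s0).
pose E xi := 2 * (eps ^- d * etaI a (2 * eps) xi + s ^- d * etaI a (2 * s) xi).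
have bE : bsupp E by apply: bsuppZ; apply: bsuppD; exact: bsuppZ.
have lE : lint E = 2 * (2 ^+ d * V + 2 ^+ d * V).
  rewrite lintZ; last by apply: bsuppD; exact: bsuppZ.
  rewrite lintD; [|exact: bsuppZ|exact: bsuppZ].
  have cancel (u : R) : 0 < u -> u ^- d * lint (etaI a (2 * u)) = 2 ^+ d * V.
    move=> u0; rewrite (lint_etaI a0 asum) ?mulr_gt0// exprMn.
    rewrite -mulrA mulrCA; congr (_ * _).
    by rewrite mulrA mulVf ?mul1r// expf_neq0// gt_eqF.
  by rewrite !lintZ// !cancel.
rewrite -lE -lintZ//; apply: lint_bound.
- by apply: bw; apply: bsuppB => //; exact: bdyad.
- exact: bsuppZ.
- move=> xi; rewrite normrM; apply: (@le_trans _ _ `|f xi - dyad eps N xi|).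
    by rewrite ler_piMr// wave_le1.
  rewrite dyadE// /f mulrA -mulrBl normrM mulrC.
  apply: ler_pM => //; first exact: (holder_dir_bound a0 hg).
  by apply: cut_dyad => //; exact: eta_ge0.
Qed.

End kernel_bound.

Local Open Scope complex_scope.
Local Open Scope sesquilinear_scope.

(** * Symbols on the sphere *)

Section hsnorm.
Context {R : realType}.
Local Notation C := R[i].

Lemma normcE2 (z : C) : Normc.normc z ^+ 2 = complex.Re z ^+ 2 + complex.Im z ^+ 2.
Proof. by case: z => x y /=; rewrite sqr_sqrtr// addr_ge0 ?sqr_ge0. Qed.

Lemma normc_ge0 (z : C) : 0 <= Normc.normc z.
Proof. by case: z => x y; exact: sqrtr_ge0. Qed.

Lemma normc_real (x : R) : Normc.normc (x%:C : C) = `|x|.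
Proof. by rewrite /= expr0n addr0 sqrtr_sqr. Qed.

Lemma normc_sum I (s : seq I) (G : I -> C) :
  Normc.normc (\sum_(j <- s) G j) <= \sum_(j <- s) Normc.normc (G j).
Proof.
elim: s => [|j s IH]; first by rewrite !big_nil Normc.normc0.
rewrite !big_cons; apply: (le_trans (le_normcD _ _)); exact: lerD.
Qed.

Lemma normc_Re (z : C) : `|complex.Re z| <= Normc.normc z.
Proof.
rewrite -[leRHS]ger0_norm ?normc_ge0// -ler_sqr ?nnegrE// !real_normK ?num_real//.
by rewrite normcE2 lerDl sqr_ge0.
Qed.

Lemma normc_Im (z : C) : `|complex.Im z| <= Normc.normc z.
Proof.
rewrite -[leRHS]ger0_norm ?normc_ge0// -ler_sqr ?nnegrE// !real_normK ?num_real//.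
by rewrite normcE2 lerDr sqr_ge0.
Qed.

Lemma normc_ReIm (z : C) : Normc.normc z <= `|complex.Re z| + `|complex.Im z|.
Proof.
rewrite -ler_sqr ?nnegrE ?normc_ge0 ?addr_ge0// normcE2 sqrrD !real_normK ?num_real//.
by rewrite -addrA lerD2l lerDr mulrn_wge0 ?mulr_ge0.
Qed.

Lemma hsnorm_ge0 m n (A : 'M[C]_(m, n)) : 0 <= hsnorm A.
Proof. exact: sqrtr_ge0. Qed.

Lemma hsnorm_sq m n (A : 'M[C]_(m, n)) : hsnorm A ^+ 2 = \sum_i \sum_j Normc.normc (A i j) ^+ 2.
Proof. by rewrite sqr_sqrtr//; apply: sumr_ge0 => i _; apply: sumr_ge0 => j _; rewrite sqr_ge0. Qed.

Lemma hsnorm_entry m n (A : 'M[C]_(m, n)) i j : Normc.normc (A i j) <= hsnorm A.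
Proof.
rewrite -ler_sqr ?nnegrE ?normc_ge0 ?hsnorm_ge0// hsnorm_sq (bigD1 i)//= (bigD1 j)//=.
rewrite -addrA lerDl addr_ge0//.
  by apply: sumr_ge0 => k _; rewrite sqr_ge0.
by apply: sumr_ge0 => k _; apply: sumr_ge0 => k' _; rewrite sqr_ge0.
Qed.

Lemma hsnorm_row m n (A : 'M[C]_(m, n)) i : hsnorm (row i A) <= hsnorm A.
Proof.
rewrite -ler_sqr ?nnegrE ?hsnorm_ge0// !hsnorm_sq big_ord1 [leRHS](bigD1 i)//=.
under eq_bigr do rewrite mxE.
by rewrite lerDl; apply: sumr_ge0 => k _; apply: sumr_ge0 => k' _; rewrite sqr_ge0.
Qed.

Lemma hsnorm0 m n : hsnorm (0 : 'M[C]_(m, n)) = 0.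
Proof.
by rewrite /hsnorm big1 ?sqrtr0// => i _; rewrite big1// => j _; rewrite mxE Normc.normc0 expr0n.
Qed.

Lemma hsnorm_eq0 m n (A : 'M[C]_(m, n)) : hsnorm A = 0 -> A = 0.
Proof.
move=> A0; apply/matrixP => i j; rewrite mxE; apply: Normc.eq0_normc.
by apply/eqP; rewrite eq_le normc_ge0 andbT -A0 hsnorm_entry.
Qed.

Lemma hsnorm_delta l (j : 'I_l) : hsnorm (delta_mx 0 j : 'rV[C]_l) = 1.
Proof.
rewrite /hsnorm big_ord1 (bigD1 j)//= mxE !eqxx [Normc.normc _]Normc.normc1 expr1n big1 ?addr0 ?sqrtr1//.
by move=> i ij; rewrite mxE eqxx (negbTE ij) Normc.normc0 expr0n.
Qed.

Lemma hsnorm_dot l (v : 'rV[C]_l) : (v *m v^t*) 0 0 = (hsnorm v ^+ 2)%:C.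
Proof.
rewrite hsnorm_sq big_ord1 mxE rmorph_sum /=; apply: eq_bigr => j _.
by rewrite !mxE -normCK -add_Re2_Im2 normcE2.
Qed.

Section projection.
Variables (l : nat) (U : 'M[C]_l).
Local Notation P := (proj_ortho U).

Lemma proj_ortho_perp (v : 'rV[C]_l) : (v - v *m P) *m (v *m P)^t* = 0.
Proof.
have /orthomx1P h := proj_ortho_compl_sub U v.
have /submxP[X E] := proj_ortho_sub U v.
by rewrite [in X in _ *m X]E trmx_mul map_mxM mulmxA h mul0mx.
Qed.

Lemma proj_ortho_perp2 (v : 'rV[C]_l) : (v *m P) *m (v - v *m P)^t* = 0.
Proof.
have := congr1 (fun X => X^t*) (proj_ortho_perp v).
by rewrite trmx_mul map_mxM trmxCK trmx0 map_mx0.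
Qed.

Lemma hsnorm_pythagoras (v : 'rV[C]_l) :
  hsnorm v ^+ 2 = hsnorm (v *m P) ^+ 2 + hsnorm (v - v *m P) ^+ 2.
Proof.
apply: (@complexI R); rewrite rmorphD /= -!hsnorm_dot.
set p := v *m P; have vE : v = p + (v - p) by rewrite addrC subrK.
have h1 := proj_ortho_perp v; have h2 := proj_ortho_perp2 v.
rewrite -/p in h1 h2; rewrite {1 2}vE linearD /= map_mxD mulmxDl !mulmxDr.
by rewrite h1 h2 addr0 add0r mxE.
Qed.

Lemma hsnorm_proj (v : 'rV[C]_l) : hsnorm (v *m P) <= hsnorm v.
Proof.
by rewrite -ler_sqr ?nnegrE ?hsnorm_ge0// [leRHS]hsnorm_pythagoras lerDl sqr_ge0.
Qed.

(** The quadratic form of [1 - P] is the squared distance to the subspace; averaged over the sphere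
    it vanishes only if every such distance does. *)
Lemma dot_proj_compl (v : 'rV[C]_l) :
  (v *m (1%:M - P) *m v^t*) 0 0 = (hsnorm (v - v *m P) ^+ 2)%:C.
Proof.
rewrite -hsnorm_dot mulmxBr mulmx1; set p := v *m P.
have h1 := proj_ortho_perp v; rewrite -/p in h1.
have vE : v = p + (v - p) by rewrite addrC subrK.
by rewrite [in X in _ *m X]vE linearD /= map_mxD mulmxDr h1 add0r.
Qed.
End projection.

(** The Fredholm alternative in finite dimension; transposition turns it into an inclusion of row
    spaces, tested by the cokernel matrix. *)
Lemma column_solvable m n (M : 'M[C]_(m, n)) (b : 'cV[C]_m) :
  (forall v : 'rV[C]_m, v *m M = 0 -> v *m b = 0) -> exists x : 'cV[C]_n, M *m x = b.
Proof.
move=> h; suff /submxP[X XE] : (b^T <= M^T)%MS.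
  by exists X^T; apply: trmx_inj; rewrite trmx_mul trmxK.
rewrite submxE; set K := cokermx _; apply/eqP.
apply: trmx_inj; rewrite trmx0 trmx_mul trmxK; apply/row_matrixP => i.
rewrite row_mul row0; apply: h; rewrite -row_mul.
have : K^T *m M = 0 by rewrite -[M]trmxK -trmx_mul mulmx_coker trmx0.
by move=> ->; rewrite row0.
Qed.

End hsnorm.

Lemma theta_noninc (R : realType) (s t : R) : s <= t -> theta t <= theta s.
Proof.
move=> st; rewrite /theta ge_max le_max lexx/= le_max le_min !ge_min lexx/=.
by rewrite lerD2l lerN2 st !orbT.
Qed.

(** * Hoelder classes and means over directions *)

Section holder_class.
Context {R : realType} {d : nat}.
Variable gamma : R.
Hypothesis gm : 0 < gamma <= 1.
Implicit Types f : d.-tuple R -> R.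

Definition hs f : Prop := exists C, holder_sphere f C gamma.

Lemma hsD f h : hs f -> hs h -> hs (fun z => f z + h z).
Proof.
move=> [C [C0 _ Cb Cd]] [K [K0 _ Kb Kd]]; exists (C + K); split => //.
- exact: addr_ge0.
- by move=> z zS; apply: (le_trans (ler_normD _ _)); apply: lerD; [exact: Cb|exact: Kb].
- move=> z z' zS zS'; rewrite mulrDl opprD addrACA.
  by apply: (le_trans (ler_normD _ _)); apply: lerD; [exact: Cd|exact: Kd].
Qed.

Lemma hsZ (k : R) f : hs f -> hs (fun z => k * f z).
Proof.
move=> [C [C0 _ Cb Cd]]; exists (`|k| * C); split => //.
- exact: mulr_ge0.
- by move=> z zS; rewrite normrM ler_wpM2l// Cb.
- by move=> z z' zS zS'; rewrite -mulrBr normrM -mulrA ler_wpM2l// Cd.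
Qed.

Lemma hsN f : hs f -> hs (fun z => - f z).
Proof. by move=> /(hsZ (-1)) h; under [X in hs X]funext do rewrite -mulN1r. Qed.

Lemma hsB f h : hs f -> hs h -> hs (fun z => f z - h z).
Proof. by move=> hf /hsN; exact: hsD. Qed.

Lemma hs_cst (k : R) : hs (fun=> k).
Proof.
exists `|k|; split=> // z z' _ _; by rewrite subrr normr0 mulr_ge0 ?powR_ge0.
Qed.

Lemma hs_ext f h : (forall z, sphere z -> f z = h z) -> hs f -> hs h.
Proof.
move=> fh [C [C0 _ Cb Cd]]; exists C; split => // [z zS|z z' zS zS'].
  by rewrite -fh//; exact: Cb.
by rewrite -!fh//; exact: Cd.
Qed.

(* A local Hoelder estimate is global, because the function is bounded. *)
Lemma hs_local f (K r : R) : 0 < r -> 0 <= K -> (forall z, sphere z -> `|f z| <= K) ->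
  (forall z z', sphere z -> sphere z' -> euclid_dist z z' <= r ->
    `|f z - f z'| <= K * euclid_dist z z' `^ gamma) -> hs f.
Proof.
move=> r0 K0 fK fd; have [gm0 gm1] := andP gm.
have q0 : 0 < r `^ gamma by exact: powR_gt0.
have E : 0 <= 2 * K / r `^ gamma by rewrite divr_ge0 ?mulr_ge0// ltW.
exists (K + 2 * K / r `^ gamma); split=> //; first exact: addr_ge0.
  by move=> z zS; apply: (le_trans (fK _ zS)); rewrite lerDl.
move=> z z' zS zS'; rewrite mulrDl.
have [h|h] := leP (euclid_dist z z') r.
  by apply: (le_trans (fd _ _ zS zS' h)); rewrite lerDl mulr_ge0// powR_ge0.
apply: (@le_trans _ _ (2 * K)).
  by apply: (le_trans (ler_normB _ _)); have := fK _ zS; have := fK _ zS'; lra.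
rewrite ler_wpDl ?mulr_ge0 ?powR_ge0// mulrAC -mulrA ler_peMr ?mulr_ge0//.
rewrite ler_pdivlMr// mul1r; apply: ge0_ler_powR; rewrite ?nnegrE ?(ltW gm0) ?(ltW r0) ?euclid_dist_ge0//.
exact: ltW.
Qed.

End holder_class.

Section direction_mean.
Context {R : realType} {d : nat} (a : d.-tuple R).
Hypotheses (d0 : (0 < d)%N) (a0 : forall j, 0 < tnth a j)
  (asum : \sum_(j < d) tnth a j = d%:R).
Variable gamma : R.
Hypothesis gm : 0 < gamma <= 1.
Local Notation hs := (hs (d := d) gamma).

(** Not normalized: the constant [1] has mean [vol]. *)
Definition dmean (f : d.-tuple R -> R) : R := lint (fun x => ballI 1 x * f (eta_dir a x)).

Lemma bsupp_dmean f : hs f -> bsupp (fun x => ballI 1 x * f (eta_dir a x)).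
Proof.
move=> [C hf]; apply: (bsuppM (bsupp_ball 1) (measurable_holder_dir a0 hf)).
exact: holder_dir_bound hf.
Qed.

Lemma dmeanD f h : hs f -> hs h -> dmean (fun z => f z + h z) = dmean f + dmean h.
Proof.
move=> hf hh; rewrite /dmean -lintD; [|exact: bsupp_dmean|exact: bsupp_dmean].
by congr lint; apply/funext => x; rewrite mulrDr.
Qed.

Lemma dmeanZ k f : hs f -> dmean (fun z => k * f z) = k * dmean f.
Proof.
move=> hf; rewrite /dmean -lintZ; last exact: bsupp_dmean.
by congr lint; apply/funext => x; rewrite mulrCA.
Qed.

Lemma dmean0 : dmean (fun=> 0) = 0.
Proof. by rewrite -[RHS](@lint0 R d); congr lint; apply/funext => x; rewrite mulr0. Qed.

(** The shell function of [f] is nonnegative, has integral zero and is continuous on the whole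
    space. A positive value of [f] at [z] would make it positive near a point of the orbit of
    [z]. *)
Lemma dmean_eq0 f : hs f -> (forall z, sphere z -> 0 <= f z) -> f origin = 0 -> dmean f = 0 ->
  forall z, sphere z -> f z = 0.
Proof.
move=> [C hf] f0 forig mf z zS; apply/eqP; rewrite eq_le f0// andbT leNgt; apply/negP => fz.
have [c c0 cP] := shell_fun_holder a0 hf.
have h0 := lint_shell_fun0 a0 asum hf mf.
suff : 0 < lint (shell_fun a f) by rewrite h0 ltxx.
have [gm0 gm1] := andP gm.
(* The point of the orbit with [eta = 2], where [psi] is [theta 1 - theta 2 = 1]. *)
pose y := dil a 2^-1 z.
have ey : eta a y = 2 by rewrite eta_dil ?invr_gt0// (eta_sphere a0 zS) invrK mul1r.
have hy : 0 < shell_fun a f y.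
  rewrite /shell_fun ey eta_dir_dil ?invr_gt0// (eta_dir_sphere a0 zS) mulr_gt0//.
  rewrite /shell_cut mulr_gt0 ?powR_gt0// /psi divff// theta1// theta0// subr0 ltr01//.
pose b := shell_fun a f y / 2.
have b0 : 0 < b by rewrite divr_gt0.
pose r := (b / (c + 1)) `^ gamma^-1.
have c1 : 0 < c + 1 by rewrite ltr_wpDl.
have r0 : 0 < r by rewrite powR_gt0 ?divr_gt0.
apply: (@lint_gt0 _ _ _ y b r) => //; first exact: bsupp_shell_fun hf.
  move=> x; rewrite /shell_fun.
  have [->|x0] := eqVneq x origin.
    by rewrite eta_origin shell_cut0l// mul0r.
  rewrite mulr_ge0//; last by apply: f0; exact: sphere_eta_dir.
  rewrite /shell_cut mulr_ge0 ?powR_ge0// /psi subr_ge0 theta_noninc//.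
  by rewrite ler_pdivrMr// ler_peMr ?eta_ge0// ler1n.
move=> x xr; have := cP y x; rewrite euclid_distC => h.
have h2 : c * euclid_dist x y `^ gamma <= b.
  have : euclid_dist x y `^ gamma <= b / (c + 1).
    apply: (@le_trans _ _ (r `^ gamma)).
      by apply: ge0_ler_powR; rewrite ?nnegrE ?(ltW gm0) ?(ltW r0) ?euclid_dist_ge0.
    by rewrite /r -powRrM mulVf ?gt_eqF// powRr1// ltW// divr_gt0.
  rewrite ler_pdivlMr//; apply: le_trans.
  by rewrite mulrC ler_wpM2l ?powR_ge0// lerDl.
have := le_trans h h2; rewrite ler_norml => /andP[_]; rewrite {1}/b => h3.
have yE : shell_fun a f y = b + b by rewrite /b; field.
by rewrite yE in h3; move: h3; rewrite lerBlDr addrC -lerBlDr; rewrite /b; lra.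
Qed.

End direction_mean.

Section surface_mean.
Context {R : realType} {d : nat} (a : d.-tuple R).
Hypotheses (d0 : (0 < d)%N) (a0 : forall j, 0 < tnth a j)
  (asum : \sum_(j < d) tnth a j = d%:R).
Variable gamma : R.

(** [polar_ball] trades [eta_dir] for [normalize] and brings in the weight; the factor [d] is that
    of the cone formula for the surface measure. *)
Lemma surface_dmean f : hs (d := d) gamma f ->
  \int[surface_measure]_(z in sphere) (f z * weight a z) = d%:R * dmean a f.
Proof.
move=> [C hf].
rewrite /dmean (polar_ball d0 a0 asum hf).
apply: (@Rintegral_sphere _ _ (fun z => f z * weight a z) (C * d%:R)).
- apply: measurable_funM; first exact: measurable_holder hf.
  by apply: measurable_funTS; exact: measurable_weight.
- move=> z zS; rewrite normrM ler_pM//; first exact: (holder_bound hf).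
  by rewrite ger0_norm ?weight_ge0// (weight_le a0 asum)// zS.
- by rewrite /weight big1 ?mulr0// => j _; rewrite tnth_mktuple expr0n mulr0.
Qed.

End surface_mean.

Section complex_mean.
Context {R : realType} {d : nat} (a : d.-tuple R).
Hypotheses (d0 : (0 < d)%N) (a0 : forall j, 0 < tnth a j)
  (asum : \sum_(j < d) tnth a j = d%:R).
Variable gamma : R.
Hypothesis gm : 0 < gamma <= 1.
Local Notation C := R[i].
Implicit Types F H : d.-tuple R -> C.

Definition chs F : Prop := hs gamma (fun z => complex.Re (F z)) /\ hs gamma (fun z => complex.Im (F z)).

Definition cmean F : C := dmean a (fun z => complex.Re (F z)) +i* dmean a (fun z => complex.Im (F z)).

Lemma chs_cst (c : C) : chs (fun=> c).
Proof. by split; exact: hs_cst. Qed.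

Lemma chsD F H : chs F -> chs H -> chs (fun z => F z + H z).
Proof.
move=> [F1 F2] [H1 H2]; split.
  by under [X in hs _ X]funext do rewrite raddfD /=; exact: hsD.
by under [X in hs _ X]funext do rewrite raddfD /=; exact: hsD.
Qed.

Lemma cmeanD F H : chs F -> chs H -> cmean (fun z => F z + H z) = cmean F + cmean H.
Proof.
move=> [F1 F2] [H1 H2]; rewrite /cmean; simpc; congr (_ +i* _).
  rewrite -(dmeanD a0 F1 H1); congr (dmean a _); apply/funext => z.
  by rewrite raddfD.
rewrite -(dmeanD a0 F2 H2); congr (dmean a _); apply/funext => z.
by rewrite raddfD.
Qed.

Let ReM (c z : C) : complex.Re (c * z) = complex.Re c * complex.Re z + - complex.Im c * complex.Im z.
Proof. by case: c z => [x y] [u v] /=; rewrite mulNr. Qed.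

Let ImM (c z : C) : complex.Im (c * z) = complex.Re c * complex.Im z + complex.Im c * complex.Re z.
Proof. by case: c z => [x y] [u v] /=. Qed.

Lemma chsZ c F : chs F -> chs (fun z => c * F z).
Proof.
move=> [F1 F2]; split.
  under [X in hs _ X]funext do rewrite ReM.
  exact: (hsD gm (hsZ gm (complex.Re c) F1) (hsZ gm (- complex.Im c) F2)).
under [X in hs _ X]funext do rewrite ImM.
exact: (hsD gm (hsZ gm (complex.Re c) F2) (hsZ gm (complex.Im c) F1)).
Qed.

Lemma cmeanZ c F : chs F -> cmean (fun z => c * F z) = c * cmean F.
Proof.
move=> [F1 F2]; rewrite /cmean.
have -> : dmean a (fun z => complex.Re (c * F z)) =
   complex.Re c * dmean a (fun z => complex.Re (F z)) + - complex.Im c * dmean a (fun z => complex.Im (F z)).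
  rewrite -(dmeanZ a0 _ F1) -(dmeanZ a0 _ F2).
  rewrite -(dmeanD a0 (hsZ gm (complex.Re c) F1) (hsZ gm (- complex.Im c) F2)).
  by congr (dmean a _); apply/funext => z; rewrite ReM.
have -> : dmean a (fun z => complex.Im (c * F z)) =
   complex.Re c * dmean a (fun z => complex.Im (F z)) + complex.Im c * dmean a (fun z => complex.Re (F z)).
  rewrite -(dmeanZ a0 _ F1) -(dmeanZ a0 _ F2).
  rewrite -(dmeanD a0 (hsZ gm (complex.Re c) F2) (hsZ gm (complex.Im c) F1)).
  by congr (dmean a _); apply/funext => z; rewrite ImM.
case: c => x y /=; rewrite mulNr; simpc; exact: erefl.
Qed.

Lemma chs_sum I (s : seq I) (F : I -> d.-tuple R -> C) :
  (forall i, chs (F i)) -> chs (fun z => \sum_(i <- s) F i z).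
Proof.
move=> hF; elim: s => [|i s IH].
  by under [X in chs X]funext do rewrite big_nil; exact: chs_cst.
by under [X in chs X]funext do rewrite big_cons; exact: chsD.
Qed.

Lemma cmean0 : cmean (fun=> 0) = 0.
Proof. by rewrite /cmean !dmean0. Qed.

Lemma cmean_sum I (s : seq I) (F : I -> d.-tuple R -> C) :
  (forall i, chs (F i)) -> cmean (fun z => \sum_(i <- s) F i z) = \sum_(i <- s) cmean (F i).
Proof.
move=> hF; elim: s => [|i s IH].
  by under [X in cmean X]funext do rewrite big_nil; rewrite big_nil cmean0.
under [X in cmean X]funext do rewrite big_cons.
by rewrite big_cons cmeanD ?IH//; exact: chs_sum.
Qed.

Lemma cintegral_surface F : chs F ->
  cintegral surface_measure sphere (fun z => F z * (weight a z)%:C) = d%:R%:C * cmean F.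
Proof.
move=> [F1 F2]; rewrite /cintegral /cmean.
have -> : \int[surface_measure]_(x in sphere) complex.Re (F x * (weight a x)%:C) =
   d%:R * dmean a (fun z => complex.Re (F z)).
  rewrite -(surface_dmean d0 a0 asum F1); apply: eq_Rintegral => z _.
  by rewrite mulrC ReM /= oppr0 mul0r addr0 mulrC.
have -> : \int[surface_measure]_(x in sphere) complex.Im (F x * (weight a x)%:C) =
   d%:R * dmean a (fun z => complex.Im (F z)).
  rewrite -(surface_dmean d0 a0 asum F2); apply: eq_Rintegral => z _.
  by rewrite mulrC ImM /= mul0r addr0 mulrC.
by simpc.
Qed.

End complex_mean.

(** * The symbol composed with the orthogonal projection *)

Section symbol.
Context {R : realType} {d l k : nat} (a : d.-tuple R).
Hypotheses (d0 : (0 < d)%N) (a0 : forall j, 0 < tnth a j)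
  (asum : \sum_(j < d) tnth a j = d%:R).
Local Notation C := R[i].
Variables (Omega : d.-tuple R -> grassmannian R l k).
Hypothesis hOmega : hoelder_on sphere euclid_dist gr_dist Omega.
Variable B : d.-tuple R -> 'rV[C]_l -> C.
Hypotheses (hBlin : linear_family Omega B) (hBhoelder : hoelder_family Omega B).

Local Notation P z := (proj_ortho (Omega z)).

(** [B z] is meaningful on [Omega z] only. Composed with the projection it becomes linear on all
    vectors, hence determined by its values on the standard basis. *)
Definition bfun (z : d.-tuple R) (v : 'rV[C]_l) : C := B z (v *m P z).

Lemma bfun_linear z (c : C) (u v : 'rV[C]_l) : sphere z ->
  bfun z (c *: u + v) = c * bfun z u + bfun z v.
Proof.
by move=> zS; rewrite /bfun mulmxDl -scalemxAl hBlin// proj_ortho_sub.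
Qed.

Lemma bfun0 z : sphere z -> bfun z 0 = 0.
Proof.
move=> zS; have := bfun_linear 1 0 0 zS; rewrite scale1r addr0 mul1r.
by move=> /eqP; rewrite eq_sym -subr_eq0 addrK => /eqP.
Qed.

Lemma bfunE z (v : 'rV[C]_l) : sphere z ->
  bfun z v = \sum_(j < l) v 0 j * bfun z (delta_mx 0 j).
Proof.
move=> zS; rewrite {1}[v]row_sum_delta.
elim: (index_enum _) => [|j s IH]; first by rewrite !big_nil bfun0.
by rewrite !big_cons bfun_linear// IH.
Qed.

Lemma bfun_sub z v : sphere z -> (v <= Omega z)%MS -> bfun z v = B z v.
Proof. by move=> zS vO; rewrite /bfun proj_ortho_id. Qed.

End symbol.

Lemma powR_noninc_exp (R : realType) (t p q : R) : 0 <= t -> t <= 1 -> 0 < p -> p <= q -> t `^ q <= t `^ p.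
Proof.
move=> t0 t1 p0 pq; have [->|tn] := eqVneq t 0.
  by rewrite !powR0 ?gt_eqF// (lt_le_trans p0).
by apply: ger_powR => //; rewrite t1 andbT lt0r tn.
Qed.

Section symbol_holder.
Context {R : realType} {d l k : nat}.
Local Notation C := R[i].
Variables (Omega : d.-tuple R -> grassmannian R l k).
Hypothesis hOmega : hoelder_on sphere euclid_dist gr_dist Omega.
Variable B : d.-tuple R -> 'rV[C]_l -> C.
Hypotheses (hBlin : linear_family Omega B) (hBhoelder : hoelder_family Omega B).

Local Notation P z := (proj_ortho (Omega z)).
Local Notation bfun := (bfun Omega B).

Lemma delta_proj j z : delta_mx 0 j *m P z = row j (P z).
Proof. by rewrite rowE. Qed.

Lemma proj_entry_le i j z : Normc.normc (P z i j) <= 1.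
Proof.
have := hsnorm_entry (row i (P z)) 0 j; rewrite mxE => h; apply: (le_trans h).
by rewrite -delta_proj -(hsnorm_delta (R := R) i); exact: hsnorm_proj.
Qed.

(** Composition multiplies Hoelder exponents: a projected basis vector moves with exponent [bO], and
    [B] contributes [bB]. Capping both at [1] lets the exponents be compared on distances at most
    [1]. *)
Lemma symbol_holder : exists2 gamma : R, 0 < gamma <= 1 &
  (forall i j, chs gamma (fun z => P z i j)) /\
  (forall j, chs gamma (fun z => bfun z (delta_mx 0 j))).
Proof.
have [alO [CO [alO0 HO]]] := hOmega.
have [alB [CB [alB0 HB]]] := hBhoelder.
pose K1 := `|CO|; pose bO := Num.min 1 alO; pose bB := Num.min 1 alB.
have bO0 : 0 < bO by rewrite lt_min ltr01.
have bB0 : 0 < bB by rewrite lt_min ltr01.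
have bO1 : bO <= 1 by rewrite ge_min lexx.
have bB1 : bB <= 1 by rewrite ge_min lexx.
have bOl : bO <= alO by rewrite ge_min lexx orbT.
have bBl : bB <= alB by rewrite ge_min lexx orbT.
have K10 : 0 <= K1 by exact: normr_ge0.
have K11 : 1 <= 1 + K1 by rewrite lerDl.
have gO z z' : sphere z -> sphere z' -> euclid_dist z z' <= 1 ->
    hsnorm (P z - P z') <= K1 * euclid_dist z z' `^ bO.
  move=> zS zS' h; apply: (le_trans (HO _ _ zS zS' h)).
  apply: (@le_trans _ _ (K1 * euclid_dist z z' `^ alO)).
    by rewrite ler_wpM2r ?powR_ge0// ler_norm.
  by rewrite ler_wpM2l// powR_noninc_exp// euclid_dist_ge0.
pose gamma := bO * bB.
have gm0 : 0 < gamma by rewrite mulr_gt0.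
have gm1 : gamma <= 1 by rewrite mulr_ile1// ltW.
have gmO : gamma <= bO by rewrite ler_piMr// ltW.
have gm : 0 < gamma <= 1 by rewrite gm0.
exists gamma => //; split=> [i j|j].
  have dP z z' : sphere z -> sphere z' -> euclid_dist z z' <= 1 ->
      Normc.normc (P z i j - P z' i j) <= (1 + K1) * euclid_dist z z' `^ gamma.
    move=> zS zS' h.
    have := hsnorm_entry (P z - P z') i j; rewrite !mxE => h1; apply: (le_trans h1).
    apply: (le_trans (gO _ _ zS zS' h)); apply: ler_pM => //.
    - exact: powR_ge0.
    - by rewrite lerDr.
    - by apply: powR_noninc_exp => //; exact: euclid_dist_ge0.
  split; apply: (hs_local gm (K := 1 + K1) (r := 1)) => //.
  - exact: le_trans K11.
  - move=> z _; apply: (le_trans (normc_Re _)); exact: le_trans (proj_entry_le _ _ _) K11.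
  - move=> z z' zS zS' h; rewrite -raddfB; apply: (le_trans (normc_Re _)); exact: dP.
  - exact: le_trans K11.
  - move=> z _; apply: (le_trans (normc_Im _)); exact: le_trans (proj_entry_le _ _ _) K11.
  - move=> z z' zS zS' h; rewrite -raddfB; apply: (le_trans (normc_Im _)); exact: dP.
pose u z : 'rV[C]_l := delta_mx 0 j *m P z.
have u1 z : hsnorm (u z) <= 1 by rewrite -(hsnorm_delta (R := R) j); exact: hsnorm_proj.
pose KB := `|CB| * (1 + K1) `^ bB.
have p1 : 1 <= (1 + K1) `^ bB by rewrite -[leLHS](powRr0 (1 + K1)) ler_powR// ltW.
have CBK : `|CB| <= KB by rewrite ler_peMr.
have KB0 : 0 <= KB by rewrite mulr_ge0// powR_ge0.
(* Boundedness comes from the Hoelder condition itself: compare with the zero vector at the same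
   [z], at distance at most [1]. *)
have bnd z : sphere z -> Normc.normc (bfun z (delta_mx 0 j)) <= KB.
  move=> zS; apply: le_trans CBK.
  have uO : (u z <= Omega z)%MS by exact: proj_ortho_sub.
  have zE : euclid_dist z z = 0.
    rewrite euclid_distE (_ : tsub z z = origin) ?enorm0//.
    by apply: eq_from_tnth => i; rewrite !tnth_mktuple subrr.
  have DE : Num.sqrt (euclid_dist (z, u z).1 (z, (0 : 'rV[C]_l)).1 ^+ 2 +
      hsnorm ((z, u z).2 - (z, (0 : 'rV[C]_l)).2) ^+ 2) = hsnorm (u z).
    by rewrite /= zE expr0n add0r subr0 sqrtr_sqr ger0_norm ?hsnorm_ge0.
  have := HB (z, u z) (z, 0); rewrite DE /= => /(_ _ _ (u1 z)).
  have B0 : B z 0 = 0 by rewrite -(bfun0 hBlin zS) /bfun mul0mx.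
  rewrite B0 subr0 => H.
  apply: (le_trans (H _ _)).
  - by split.
  - by split; rewrite ?sub0mx// hsnorm0.
  apply: (@le_trans _ _ (`|CB| * hsnorm (u z) `^ alB)).
    by rewrite ler_wpM2r ?powR_ge0// ler_norm.
  rewrite ler_piMr//; apply: (@le_trans _ _ (1 `^ alB)); last by rewrite powR1.
  by apply: ge0_ler_powR; rewrite ?nnegrE ?(ltW alB0) ?hsnorm_ge0.
(* Then $(1+K_1)\,r^{b_O}=1$, so the pairs formed by [z] and its projected basis vector stay within
   distance [1], where the hypothesis on [B] applies. *)
pose r := (1 + K1) `^ (- bO^-1).
have K1p : 0 < 1 + K1 by exact: lt_le_trans K11.
have r0 : 0 < r by exact: powR_gt0.
have r1 : r <= 1 by rewrite -(powRr0 (1 + K1)) ler_powR// oppr_le0 invr_ge0 ltW.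
have rE : r `^ bO = (1 + K1)^-1.
  by rewrite -powRrM mulNr mulVf ?gt_eqF// powR_inv1// ltW.
have dB z z' : sphere z -> sphere z' -> euclid_dist z z' <= r ->
   Normc.normc (bfun z (delta_mx 0 j) - bfun z' (delta_mx 0 j)) <= KB * euclid_dist z z' `^ gamma.
  move=> zS zS' h.
  have h1 : euclid_dist z z' <= 1 by exact: le_trans r1.
  set t := euclid_dist z z' `^ bO.
  have e0 := euclid_dist_ge0 z z'.
  have t0 : 0 <= t by exact: powR_ge0.
  have et : euclid_dist z z' <= t.
    by rewrite -{1}(powRr1 e0) powR_noninc_exp.
  have ut : hsnorm (u z - u z') <= K1 * t.
    rewrite /u -mulmxBr -rowE; apply: (le_trans (hsnorm_row _ _)); exact: gO.
  set D := Num.sqrt (euclid_dist z z' ^+ 2 + hsnorm (u z - u z') ^+ 2).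
  have D0 : 0 <= D by exact: sqrtr_ge0.
  have Dt : D <= (1 + K1) * t.
    rewrite -ler_sqr ?nnegrE ?mulr_ge0 ?(ltW K1p)// sqr_sqrtr ?addr_ge0 ?sqr_ge0//.
    apply: (@le_trans _ _ (t ^+ 2 + (K1 * t) ^+ 2)).
      by apply: lerD; apply: lerXn2r; rewrite ?nnegrE ?hsnorm_ge0 ?mulr_ge0.
    rewrite mulrDl mul1r sqrrD -addrA lerD2l lerDr mulrn_wge0// mulr_ge0// mulr_ge0//.
  have D1 : D <= 1.
    apply: (le_trans Dt); rewrite mulrC -ler_pdivlMr// div1r -rE.
    by apply: ge0_ler_powR; rewrite ?nnegrE ?(ltW bO0) ?(ltW r0).
  have := HB (z, u z) (z', u z') _ _ D1; rewrite /= => H.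
  apply: (le_trans (H _ _)).
  - by split => //; exact: proj_ortho_sub.
  - by split => //; exact: proj_ortho_sub.
  rewrite -/D; apply: (@le_trans _ _ (`|CB| * D `^ alB)).
    by rewrite ler_wpM2r ?powR_ge0// ler_norm.
  rewrite /KB -mulrA ler_wpM2l//.
  apply: (@le_trans _ _ (D `^ bB)); first exact: powR_noninc_exp.
  apply: (@le_trans _ _ (((1 + K1) * t) `^ bB)).
    by apply: ge0_ler_powR; rewrite ?nnegrE ?(ltW bB0) ?mulr_ge0 ?(ltW K1p).
  by rewrite powRM ?(ltW K1p)// /t -powRrM.
split; apply: (hs_local gm (K := KB) (r := r)) => //.
- by move=> z zS; apply: (le_trans (normc_Re _)); exact: bnd.
- by move=> z z' zS zS' h; rewrite -raddfB; apply: (le_trans (normc_Re _)); exact: dB.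
- by move=> z zS; apply: (le_trans (normc_Im _)); exact: bnd.
- by move=> z z' zS zS' h; rewrite -raddfB; apply: (le_trans (normc_Im _)); exact: dB.
Qed.
End symbol_holder.

Section modified_symbol.
Context {R : realType} {d l k : nat} (a : d.-tuple R).
Hypotheses (d0 : (0 < d)%N) (a0 : forall j, 0 < tnth a j)
  (asum : \sum_(j < d) tnth a j = d%:R).
Local Notation C := R[i].
Variables (Omega : d.-tuple R -> grassmannian R l k).
Hypothesis hOmega : hoelder_on sphere euclid_dist gr_dist Omega.
Variable B : d.-tuple R -> 'rV[C]_l -> C.
Hypotheses (hBlin : linear_family Omega B) (hBhoelder : hoelder_family Omega B).

Local Notation P z := (proj_ortho (Omega z)).
Local Notation bfun := (bfun Omega B).

Lemma chs_ext (gamma : R) (F H : d.-tuple R -> C) : 0 < gamma <= 1 ->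
  (forall z, sphere z -> F z = H z) -> chs gamma F -> chs gamma H.
Proof.
move=> gm FH [F1 F2]; split.
  by apply: (hs_ext gm _ F1) => z zS; rewrite FH.
by apply: (hs_ext gm _ F2) => z zS; rewrite FH.
Qed.

(* Adding [(1 - P) n] to the symbol does not change it on [Omega]. Choosing [n] so that the mean
   vanishes is a linear system with matrix [M = mean (1 - P)], and it is solvable: if [v M = 0]
   then [v M v^*], the mean of [|v - v P|^2], is zero, so [v] lies in every [Omega z] and the
   weak cancellation condition makes the right-hand side orthogonal to [v]. *)
Theorem modified_symbol : weak_cancellation a Omega B ->
  exists (A : d.-tuple R -> 'cV[C]_l) (gamma : R), [/\ 0 < gamma <= 1,
    forall z v, sphere z -> (v <= Omega z)%MS -> B z v = (v *m A z) 0 0,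
    forall j, chs gamma (fun z => A z j 0) &
    forall j, cmean a (fun z => A z j 0) = 0].
Proof.
move=> wc.
have [gamma gm [hP hb]] := symbol_holder hOmega hBlin hBhoelder.
(* Everything is set to zero off the sphere, because [dmean_eq0] asks for the value [0] at the
   origin. *)
pose onS (z : d.-tuple R) : bool := enorm z == 1.
have onSP z : sphere z -> onS z by move=> zS; apply/eqP.
have offo : onS origin = false by rewrite /onS enorm0 eq_sym oner_eq0.
pose Q z : 'M[C]_l := if onS z then 1%:M - P z else 0.
pose A0 z : 'cV[C]_l := if onS z then \col_j bfun z (delta_mx 0 j) else 0.
have hQ i j : chs gamma (fun z => Q z i j).
  apply: (@chs_ext gamma (fun z => (1%:M : 'M[C]_l) i j + (-1) * P z i j)) => //.
    by move=> z zS; rewrite /Q onSP// !mxE mulN1r.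
  apply: chsD => //; first exact: chs_cst.
  exact: chsZ.
have hA0 j : chs gamma (fun z => A0 z j 0).
  apply: (@chs_ext gamma (fun z => bfun z (delta_mx 0 j))) => //.
  by move=> z zS; rewrite /A0 onSP// mxE.
pose M : 'M[C]_l := \matrix_(i, j) cmean a (fun z => Q z i j).
pose m : 'cV[C]_l := \col_j cmean a (fun z => A0 z j 0).
have MvE (u : 'rV[C]_l) (w : 'cV[C]_l) : (u *m M *m w) 0 0 = cmean a (fun z => (u *m Q z *m w) 0 0).
  transitivity (cmean a (fun z => \sum_j \sum_i (u 0 i * w j 0) * Q z i j)); last first.
    congr (cmean a _); apply/funext => z; rewrite mxE; apply: eq_bigr => j _.
    rewrite mxE mulr_suml; apply: eq_bigr => i _; ring.
  rewrite (cmean_sum a0 gm); last by move=> j; apply: chs_sum => // i; exact: chsZ.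
  rewrite mxE; apply: eq_bigr => j _; rewrite (cmean_sum a0 gm); last by move=> i; exact: chsZ.
  rewrite mxE mulr_suml; apply: eq_bigr => i _; rewrite (cmeanZ a0 gm)// mxE; ring.
have mvE (u : 'rV[C]_l) : (u *m m) 0 0 = cmean a (fun z => (u *m A0 z) 0 0).
  transitivity (cmean a (fun z => \sum_j u 0 j * A0 z j 0)); last first.
    by congr (cmean a _); apply/funext => z; rewrite mxE.
  rewrite (cmean_sum a0 gm); last by move=> j; exact: chsZ.
  by rewrite mxE; apply: eq_bigr => j _; rewrite (cmeanZ a0 gm)// mxE.
have ker (v : 'rV[C]_l) : v *m M = 0 -> v *m m = 0.
  move=> vM.
  pose f z : R := if onS z then hsnorm (v - v *m P z) ^+ 2 else 0.
  have fE z : (v *m Q z *m v^t*) 0 0 = (f z)%:C.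
    rewrite /Q /f; case: (onS z); first exact: dot_proj_compl.
    by rewrite mulmx0 mul0mx mxE.
  have hf : hs gamma f.
    have : chs gamma (fun z => (v *m Q z *m v^t*) 0 0).
      have -> : (fun z => (v *m Q z *m v^t*) 0 0) =
          fun z => \sum_j \sum_i (v 0 i * (v^t*) j 0) * Q z i j.
        apply/funext => z; rewrite mxE; apply: eq_bigr => j _.
        rewrite mxE mulr_suml; apply: eq_bigr => i _; ring.
      by apply: chs_sum => // j; apply: chs_sum => // i; exact: chsZ.
    by move=> [+ _]; congr hs; apply/funext => z; rewrite fE.
  have f0 : dmean a f = 0.
    have := MvE v (v^t*); rewrite vM mul0mx mxE => /(congr1 (@complex.Re R)) /= E.
    by rewrite E; congr dmean; apply/funext => z; rewrite fE.
  have fz := dmean_eq0 a0 asum gm hf _ _ f0.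
  have vV z : sphere z -> (v <= Omega z)%MS.
    move=> zS; have : f z = 0.
      apply: fz => //; last by rewrite /f offo.
      by move=> z' _; rewrite /f; case: ifP => // _; exact: sqr_ge0.
    rewrite /f onSP// => /eqP; rewrite sqrf_eq0 => /eqP /hsnorm_eq0 /eqP.
    by rewrite subr_eq0 => /eqP ->; exact: proj_ortho_sub.
  apply/rowP => i; rewrite !ord1 [RHS]mxE mvE.
  have h1 : chs gamma (fun z => (v *m A0 z) 0 0).
    have -> : (fun z => (v *m A0 z) 0 0) = fun z => \sum_j v 0 j * A0 z j 0.
      by apply/funext => z; rewrite mxE.
    by apply: chs_sum => // j; exact: chsZ.
  have := cintegral_surface d0 a0 asum h1.
  have vin : v \in \bigcap_(zeta in sphere) [set v | (v <= Omega zeta)%MS].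
    by rewrite inE => z zS; exact: vV.
  have := wc v vin => W.
  have -> : cintegral surface_measure sphere (fun z => (v *m A0 z) 0 0 * (weight a z)%:C) = 0.
    rewrite -W /cintegral; congr (_ +i* _); apply: eq_Rintegral => z; rewrite inE => zS.
      rewrite /A0 onSP// -(bfun_sub B zS (vV z zS)) (bfunE hBlin v zS) mxE.
      by under eq_bigr do rewrite mxE.
    rewrite /A0 onSP// -(bfun_sub B zS (vV z zS)) (bfunE hBlin v zS) mxE.
    by under eq_bigr do rewrite mxE.
  move=> /esym/eqP; rewrite mulf_eq0 => /orP[|/eqP //].
  by rewrite -[X in _ == X]/((0 : R)%:C) (inj_eq (@complexI R)) pnatr_eq0 gt_eqF.
have ker' (v : 'rV[C]_l) : v *m M = 0 -> v *m (- m) = 0.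
  by move=> /ker h; rewrite mulmxN h oppr0.
have [n nE] := column_solvable ker'.
exists (fun z => A0 z + Q z *m n), gamma; split => //.
- move=> z v zS vO; rewrite mulmxDr mulmxA.
  have -> : v *m Q z = 0 by rewrite /Q onSP// mulmxBr mulmx1 proj_ortho_id// subrr.
  rewrite mul0mx addr0 /A0 onSP// -(bfun_sub B zS vO) (bfunE hBlin v zS) mxE.
  by under [RHS]eq_bigr do rewrite mxE.
- move=> j.
  have -> : (fun z => (A0 z + Q z *m n) j 0) = fun z => A0 z j 0 + \sum_i n i 0 * Q z j i.
    by apply/funext => z; rewrite !mxE; congr (_ + _); apply: eq_bigr => i _; rewrite mulrC.
  by apply: chsD => //; apply: chs_sum => // i; exact: chsZ.
- move=> j.
  have -> : (fun z => (A0 z + Q z *m n) j 0) = fun z => A0 z j 0 + \sum_i n i 0 * Q z j i.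
    by apply/funext => z; rewrite !mxE; congr (_ + _); apply: eq_bigr => i _; rewrite mulrC.
  rewrite (cmeanD a0 (hA0 j)); last by apply: chs_sum => // i; exact: chsZ.
  rewrite (cmean_sum a0 gm); last by move=> i; exact: chsZ.
  have := congr1 (fun X : 'cV[C]_l => X j 0) nE; rewrite !mxE => E.
  rewrite [X in _ + X](_ : _ = - cmean a (fun z => A0 z j 0)) ?subrr// -E.
  by apply: eq_bigr => i _; rewrite (cmeanZ a0 gm)// mxE mulrC.
Qed.
End modified_symbol.

(** * Sufficiency of weak cancellation *)

Section trigonometric_phases.
Context {R : realType}.

Lemma lipschitz_of_derivative (f df : R -> R) : (forall x : R, is_derive x (1 : R) f (df x)) ->
  (forall x, `|df x| <= 1) -> forall s t, `|f s - f t| <= `|s - t|.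
Proof.
move=> fd d1.
suff H s t : s <= t -> `|f t - f s| <= `|t - s|.
  move=> s t; have [st|/ltW ts] := leP s t; last exact: H.
  by rewrite distrC [leRHS]distrC; exact: H.
move=> st; have [] := @MVT_segment R f df s t st.
- apply: continuous_subspaceT => x; apply: differentiable_continuous.
  by apply/derivable1_diffP; apply: ex_derive; exact: fd.
- by move=> c _ ->; rewrite normrM ler_piMl.
Qed.

Lemma cos_norm_le1 (t : R) : `|cos t| <= 1.
Proof. by rewrite ler_norml cos_geN1 cos_le1. Qed.

Lemma sin_norm_le1 (t : R) : `|sin t| <= 1.
Proof. by rewrite ler_norml sin_geN1 sin_le1. Qed.

Lemma cos_lip (s t : R) : `|cos s - cos t| <= `|s - t|.
Proof.
apply: (lipschitz_of_derivative (df := fun x => - sin x)) => x.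
by rewrite normrN sin_norm_le1.
Qed.

Lemma sin_lip (s t : R) : `|sin s - sin t| <= `|s - t|.
Proof. by apply: (lipschitz_of_derivative (df := cos)) => x; exact: cos_norm_le1. Qed.

Lemma measurable_cos : measurable_fun setT (@cos R).
Proof. by apply: continuous_measurable_fun; exact: continuous_cos. Qed.

Lemma measurable_sin : measurable_fun setT (@sin R).
Proof. by apply: continuous_measurable_fun; exact: continuous_sin. Qed.

Lemma cisD (s t : R) : cis (s + t) = cis s * cis t.
Proof. by rewrite /cis cosD sinD; simpc; congr (_ +i* _); rewrite addrC. Qed.

Lemma normc_cis (t : R) : Normc.normc (cis t) = 1.
Proof. by rewrite /cis /= cos2Dsin2 sqrtr1. Qed.

End trigonometric_phases.

(** * Complex-valued integrals and Fubini *)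

Section complex_measurable.
Context {disp} {T : measurableType disp} {R : realType}.
Local Notation C := R[i].

Definition cmeas (f : T -> C) : Prop :=
  measurable_fun setT (fun x => complex.Re (f x)) /\ measurable_fun setT (fun x => complex.Im (f x)).

Lemma cmeasD f g : cmeas f -> cmeas g -> cmeas (fun x => f x + g x).
Proof.
move=> [f1 f2] [g1 g2]; split.
  by under eq_fun do rewrite raddfD /=; exact: measurable_funD.
by under eq_fun do rewrite raddfD /=; exact: measurable_funD.
Qed.

Lemma cmeasM f g : cmeas f -> cmeas g -> cmeas (fun x => f x * g x).
Proof.
move=> [f1 f2] [g1 g2]; split.
  have -> : (fun x => complex.Re (f x * g x)) =
     fun x => complex.Re (f x) * complex.Re (g x) - complex.Im (f x) * complex.Im (g x).
    by apply/funext => x; case: (f x) (g x) => [? ?] [].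
  by apply: measurable_funB; apply: measurable_funM.
have -> : (fun x => complex.Im (f x * g x)) =
     fun x => complex.Re (f x) * complex.Im (g x) + complex.Im (f x) * complex.Re (g x).
  by apply/funext => x; case: (f x) (g x) => [? ?] [].
by apply: measurable_funD; apply: measurable_funM.
Qed.

Lemma cmeas_real (f : T -> R) : measurable_fun setT f -> cmeas (fun x => (f x)%:C).
Proof. by move=> mf; split => //=. Qed.

Lemma cmeas_cis (f : T -> R) : measurable_fun setT f -> cmeas (fun x => cis (f x)).
Proof.
move=> mf; split => /=; first exact: (measurableT_comp measurable_cos).
exact: (measurableT_comp measurable_sin).
Qed.

Variable mu : {measure set T -> \bar R}.

Lemma cintegrable_bound (f : T -> C) (g : T -> R) : cmeas f ->
  mu.-integrable setT (EFin \o g) -> (forall x, Normc.normc (f x) <= g x) ->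
  cintegrable mu setT f.
Proof.
move=> [f1 f2] Ig fg; split.
  apply: (le_integrable measurableT _ _ Ig); first exact/measurable_EFinP.
  move=> x _ /=; rewrite lee_fin; apply: (le_trans (normc_Re _)).
  exact: le_trans (fg x) (ler_norm _).
apply: (le_integrable measurableT _ _ Ig); first exact/measurable_EFinP.
move=> x _ /=; rewrite lee_fin; apply: (le_trans (normc_Im _)).
exact: le_trans (fg x) (ler_norm _).
Qed.

Lemma cintegrable_cmeas f : cintegrable mu setT f -> cmeas f.
Proof.
by move=> [f1 f2]; split; apply/measurable_EFinP; [exact: measurable_int f1|exact: measurable_int f2].
Qed.

Lemma cintegralD f g : cintegrable mu setT f -> cintegrable mu setT g ->
  cintegral mu setT (fun x => f x + g x) = cintegral mu setT f + cintegral mu setT g.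
Proof.
move=> [f1 f2] [g1 g2]; rewrite /cintegral; simpc; congr (_ +i* _).
  rewrite -RintegralD//; apply: eq_Rintegral => x _; by rewrite raddfD.
by rewrite -RintegralD//; apply: eq_Rintegral => x _; rewrite raddfD.
Qed.

Lemma cintegrableD f g : cintegrable mu setT f -> cintegrable mu setT g ->
  cintegrable mu setT (fun x => f x + g x).
Proof.
move=> [f1 f2] [g1 g2]; split.
  under [X in _.-integrable _ X]funext do rewrite raddfD EFinD.
  exact: integrableD.
under [X in _.-integrable _ X]funext do rewrite raddfD EFinD.
exact: integrableD.
Qed.

Lemma cintegral_sum I (s : seq I) (F : I -> T -> C) :
  (forall i, cintegrable mu setT (F i)) ->
  cintegrable mu setT (fun x => \sum_(i <- s) F i x) /\
  cintegral mu setT (fun x => \sum_(i <- s) F i x) = \sum_(i <- s) cintegral mu setT (F i).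
Proof.
move=> hF; elim: s => [|i s [IH1 IH2]].
  under [X in cintegrable _ _ X]funext do rewrite big_nil.
  under [X in cintegral _ _ X]funext do rewrite big_nil.
  rewrite big_nil; split; first by split; exact: integrable0.
  by rewrite /cintegral /Rintegral /= integral0.
under [X in cintegrable _ _ X]funext do rewrite big_cons.
under [X in cintegral _ _ X]funext do rewrite big_cons.
by rewrite big_cons cintegralD// IH2; split => //; exact: cintegrableD.
Qed.

Lemma cintegralZ (c : C) f : cintegrable mu setT f ->
  cintegral mu setT (fun x => c * f x) = c * cintegral mu setT f.
Proof.
move=> [f1 f2]; case: c => u v; rewrite /cintegral; simpc.
have Z (w : R) (h : T -> R) : mu.-integrable setT (EFin \o h) -> mu.-integrable setT (EFin \o (fun x => w * h x)).
  move=> Ih; have := integrableZl measurableT w Ih.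
  by congr (_.-integrable _ _).
congr (_ +i* _).
  rewrite -!RintegralZl// -RintegralB//; [|exact: Z|exact: Z].
  by apply: eq_Rintegral => x _; case: (f x).
rewrite -!RintegralZl// -RintegralD//; [|exact: Z|exact: Z].
by apply: eq_Rintegral => x _; case: (f x).
Qed.

(** Real and imaginary parts are estimated separately, at the cost of the factor [2]. *)
Lemma normc_cintegral (f : T -> C) (g : T -> R) : cmeas f ->
  mu.-integrable setT (EFin \o g) -> (forall x, Normc.normc (f x) <= g x) ->
  Normc.normc (cintegral mu setT f) <= 2 * \int[mu]_x g x.
Proof.
move=> mf Ig fg; have [f1 f2] := cintegrable_bound mf Ig fg.
apply: (le_trans (normc_ReIm _)); rewrite /cintegral /= mulr_natl mulr2n; apply: lerD.
  apply: (le_trans (le_normr_Rintegral measurableT f1)).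
  apply: le_Rintegral => //.
    apply: (le_integrable measurableT _ _ f1).
      by apply/measurable_EFinP; apply: measurableT_comp => //; exact: mf.1.
    by move=> x _ /=; rewrite normr_id.
  by move=> x _; apply: (le_trans (normc_Re _)).
apply: (le_trans (le_normr_Rintegral measurableT f2)).
apply: le_Rintegral => //.
  apply: (le_integrable measurableT _ _ f2).
    by apply/measurable_EFinP; apply: measurableT_comp => //; exact: mf.2.
  by move=> x _ /=; rewrite normr_id.
by move=> x _; apply: (le_trans (normc_Im _)).
Qed.

End complex_measurable.

Section complex_fubini.
Context {d1 d2} {T1 : measurableType d1} {T2 : measurableType d2} {R : realType}.
Variable m1 : {sigma_finite_measure set T1 -> \bar R}.
Variable m2 : {sigma_finite_measure set T2 -> \bar R}.

Lemma Rintegral_fubini (f : T1 * T2 -> R) : (m1 \x m2)%E.-integrable setT (EFin \o f) ->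
  (forall x, m2.-integrable setT (fun y => (f (x, y))%:E)) ->
  (forall y, m1.-integrable setT (fun x => (f (x, y))%:E)) ->
  m1.-integrable setT (fun x => (\int[m2]_y f (x, y))%:E) /\
  \int[m1]_x \int[m2]_y f (x, y) = \int[m2]_y \int[m1]_x f (x, y).
Proof.
move=> If I2 I1.
have E2 x : (\int[m2]_y f (x, y))%:E = (\int[m2]_y (f (x, y))%:E)%E.
  by rewrite /Rintegral fineK//; apply: integrable_fin_num => //; exact: I2.
have E1 y : (\int[m1]_x f (x, y))%:E = (\int[m1]_x (f (x, y))%:E)%E.
  by rewrite /Rintegral fineK//; apply: integrable_fin_num => //; exact: I1.
split.
  under [X in _.-integrable _ X]funext do rewrite E2.
  exact: (integrable_fubini_F If).
rewrite /Rintegral; congr fine.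
transitivity (\int[m1]_x \int[m2]_y (f (x, y))%:E)%E.
  by apply: eq_integral => x _; rewrite -E2.
rewrite (Fubini If); apply: eq_integral => y _.
by rewrite -E1.
Qed.

(** Domination by a product makes every section integrable, not just almost every one, so iterated
    real integrals can be handled pointwise. *)
Lemma cintegral_fubini (Phi : T1 * T2 -> R[i]) (f : T1 -> R) (g : T2 -> R) :
  cmeas Phi -> m1.-integrable setT (EFin \o f) -> m2.-integrable setT (EFin \o g) ->
  (forall x, 0 <= f x) -> (forall y, 0 <= g y) ->
  (forall x y, Normc.normc (Phi (x, y)) <= f x * g y) ->
  cintegrable m1 setT (fun x => cintegral m2 setT (fun y => Phi (x, y))) /\
  cintegral m1 setT (fun x => cintegral m2 setT (fun y => Phi (x, y))) =
  cintegral m2 setT (fun y => cintegral m1 setT (fun x => Phi (x, y))).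
Proof.
move=> mPhi If Ig f0 g0 H.
have key (h : T1 * T2 -> R) : measurable_fun setT h -> (forall x y, `|h (x, y)| <= f x * g y) ->
    [/\ (m1 \x m2)%E.-integrable setT (EFin \o h),
     (forall x, m2.-integrable setT (fun y => (h (x, y))%:E)) &
     (forall y, m1.-integrable setT (fun x => (h (x, y))%:E))].
  move=> mh hb; split.
  - apply/integrable12ltyP; first exact/measurable_EFinP.
    have mf := measurable_int _ If; have mg := measurable_int _ Ig.
    apply: (@le_lt_trans _ _ (\int[m1]_x ((f x)%:E * \int[m2]_y (g y)%:E))%E).
      apply: ge0_le_integral => //.
      + by move=> x _; apply: integral_ge0.
      + apply: (measurable_fun_fubini_tonelli_F (abse \o (EFin \o h))).
          by apply: measurableT_comp => //; exact/measurable_EFinP.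
        by move=> x; rewrite /= lee_fin.
      + exact: emeasurable_funM.
      + move=> x _; rewrite -ge0_integralZl//; last 2 first.
          by move=> y _; rewrite lee_fin.
          by rewrite lee_fin.
        apply: ge0_le_integral => //.
        * apply: measurableT_comp => //; apply/measurable_EFinP.
          exact: (measurableT_comp mh (pair1_measurable x)).
        * by apply: measurable_funeM.
        * by move=> y _ /=; rewrite lee_fin.
    have L := integrable_lty measurableT (integrableZl measurableT (fine (\int[m2]_y (g y)%:E)%E) If).
    apply: le_lt_trans L; rewrite le_eqVlt; apply/orP; left; apply/eqP.
    rewrite fineK; last exact: (integrable_fin_num measurableT Ig).
    by apply: eq_integral => x _; exact: muleC.
  - move=> x; apply: (le_integrable measurableT _ _ (integrableZl measurableT (f x) Ig)).
      apply/measurable_EFinP; exact: (measurableT_comp mh (pair1_measurable x)).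
    by move=> y _ /=; rewrite lee_fin (le_trans (hb x y))// ler_norm.
  - move=> y; apply: (le_integrable measurableT _ _ (integrableZl measurableT (g y) If)).
      apply/measurable_EFinP; exact: (measurableT_comp mh (pair2_measurable y)).
    by move=> x _ /=; rewrite lee_fin mulrC (le_trans (hb x y))// ler_norm.
have [m1' m2'] := mPhi.
have [A1 A2 A3] := key _ m1' (fun x y => le_trans (normc_Re _) (H x y)).
have [B1 B2 B3] := key _ m2' (fun x y => le_trans (normc_Im _) (H x y)).
have [P1 P2] := Rintegral_fubini A1 A2 A3; have [Q1 Q2] := Rintegral_fubini B1 B2 B3.
by split; [split|rewrite /cintegral /=; congr (_ +i* _)].
Qed.

End complex_fubini.

Section complex_kernel.
Context {R : realType} {d : nat} (a : d.-tuple R).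
Hypotheses (d0 : (0 < d)%N) (a0 : forall j, 0 < tnth a j)
  (asum : \sum_(j < d) tnth a j = d%:R).
Local Notation leb := (@lebesgue_tuple R d).
Variable gamma : R.
Hypothesis gm : 0 < gamma <= 1.
Variable F : d.-tuple R -> R[i].
Hypotheses (hF : chs gamma F) (F0 : cmean a F = 0).

Definition symbol_kernel (eps r : R) (xi : d.-tuple R) : R[i] :=
  (annulus_cut a eps r xi)%:C * F (eta_dir a xi).

Lemma cmeas_dir : cmeas (fun xi => F (eta_dir a xi)).
Proof.
case: hF => -[C1 h1] [C2 h2]; split; first exact: measurable_holder_dir h1.
exact: measurable_holder_dir h2.
Qed.

Lemma cmeas_symbol_kernel eps r : cmeas (symbol_kernel eps r).
Proof.
apply: cmeasM; last exact: cmeas_dir.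
by apply: cmeas_real; exact: measurable_annulus_cut.
Qed.

Lemma symbol_kernel_bound : exists2 K : R, 0 <= K & forall eps r xi, 0 < eps ->
  Normc.normc (symbol_kernel eps r xi) <= eps ^- d * K * etaI a r xi.
Proof.
case: hF => -[C1 h1] [C2 h2].
pose K := (C1 + `|complex.Re (F origin)|) + (C2 + `|complex.Im (F origin)|).
have K0 : 0 <= K by rewrite !addr_ge0//; [case: h1|case: h2].
exists K => // eps r xi e0.
rewrite /symbol_kernel Normc.normcM mulrAC; apply: ler_pM; try exact: normc_ge0.
  apply: le_trans (annulus_cut_le a r xi e0).
  by rewrite normc_real ger0_norm ?annulus_cut_ge0.
apply: (le_trans (normc_ReIm _)); apply: lerD.
  exact: (holder_dir_bound a0 h1).
exact: (holder_dir_bound a0 h2).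
Qed.

Lemma symbol_kernel_integrable eps r (z : d.-tuple R) : 0 < eps -> 0 < r ->
  cintegrable leb setT (fun xi => symbol_kernel eps r xi * cis (2 * pi * edot z xi)).
Proof.
move=> e0 r0; have [K K0 H] := symbol_kernel_bound.
apply: (cintegrable_bound (g := fun xi => eps ^- d * K * etaI a r xi)).
- apply: cmeasM; first exact: cmeas_symbol_kernel.
  apply: cmeas_cis; apply: measurable_funM => //.
  by apply: measurable_sum => i; apply: measurable_funM => //; exact: measurable_tnth.
- by apply: bsupp_integrable; apply: bsuppZ; exact: bsupp_etaI.
- by move=> xi; rewrite Normc.normcM normc_cis mulr1; exact: H.
Qed.

(** Real and imaginary parts of the symbol and of the phase give four real kernels, each with a
    cosine or a sine as [tau]. *)
Theorem complex_kernel_bound : exists2 c : R, 0 <= c & forall (eps r : R) z, 0 < eps -> eps < r ->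
  Normc.normc (cintegral leb setT (fun xi => symbol_kernel eps r xi * cis (2 * pi * edot z xi))) <= c.
Proof.
case: hF => -[C1 h1] [C2 h2].
have [Re0 Im0] : dmean a (fun z => complex.Re (F z)) = 0 /\ dmean a (fun z => complex.Im (F z)) = 0.
  by move: F0; rewrite /cmean => /eqP; rewrite eq_complex /= => /andP[/eqP -> /eqP ->].
have [c1 c10 k1] := kernel_bound a0 asum h1 Re0 (@measurable_cos R) (@cos_norm_le1 R) (@cos_lip R) (@cosDpi R).
have [c2 c20 k2] := kernel_bound a0 asum h2 Im0 (@measurable_sin R) (@sin_norm_le1 R) (@sin_lip R) (@sinDpi R).
have [c3 c30 k3] := kernel_bound a0 asum h1 Re0 (@measurable_sin R) (@sin_norm_le1 R) (@sin_lip R) (@sinDpi R).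
have [c4 c40 k4] := kernel_bound a0 asum h2 Im0 (@measurable_cos R) (@cos_norm_le1 R) (@cos_lip R) (@cosDpi R).
exists ((c1 + c2) + (c3 + c4)) => [|eps r z e0 er]; first by rewrite !addr_ge0.
have r0 : 0 < r by exact: lt_trans er.
have bs (g : d.-tuple R -> R) C (tau : R -> R) : holder_sphere g C gamma ->
    measurable_fun setT tau -> (forall t, `|tau t| <= 1) ->
    bsupp (fun xi => annulus_cut a eps r xi * g (eta_dir a xi) * wave tau z xi).
  move=> hg mt t1; apply: (bsuppM (C := 1)); [|exact: measurable_wave|by move=> x; exact: t1].
  apply: (bsuppM (bsupp_annulus_cut a0 e0 r0) (measurable_holder_dir a0 hg)).
  exact: holder_dir_bound hg.
apply: (le_trans (normc_ReIm _)); rewrite /cintegral /=; apply: lerD.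
- rewrite [X in `|X|](_ : _ = lint (fun xi => annulus_cut a eps r xi * complex.Re (F (eta_dir a xi)) * wave cos z xi)
     - lint (fun xi => annulus_cut a eps r xi * complex.Im (F (eta_dir a xi)) * wave sin z xi)).
    apply: (le_trans (ler_normB _ _)); apply: lerD; [exact: k1|exact: k2].
  rewrite -lintB; last 2 first.
  + exact: (bs _ _ _ h1 (@measurable_cos R) (@cos_norm_le1 R)).
  + exact: (bs _ _ _ h2 (@measurable_sin R) (@sin_norm_le1 R)).
  apply: eq_Rintegral => xi _; rewrite /symbol_kernel /wave /cis.
  by case: (F (eta_dir a xi)) => u v /=; ring.
- rewrite [X in `|X|](_ : _ = lint (fun xi => annulus_cut a eps r xi * complex.Re (F (eta_dir a xi)) * wave sin z xi)
     + lint (fun xi => annulus_cut a eps r xi * complex.Im (F (eta_dir a xi)) * wave cos z xi)).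
    apply: (le_trans (ler_normD _ _)); apply: lerD; [exact: k3|exact: k4].
  rewrite -lintD; last 2 first.
  + exact: (bs _ _ _ h1 (@measurable_sin R) (@sin_norm_le1 R)).
  + exact: (bs _ _ _ h2 (@measurable_cos R) (@cos_norm_le1 R)).
  apply: eq_Rintegral => xi _; rewrite /symbol_kernel /wave /cis.
  by case: (F (eta_dir a xi)) => u v /=; ring.
Qed.

End complex_kernel.

Section edot_measurable.
Context {R : realType} {d : nat}.

Lemma measurable_edot_const (x : d.-tuple R) : measurable_fun setT (fun y => edot y x).
Proof. by apply: measurable_sum => i; apply: measurable_funM => //; exact: measurable_tnth. Qed.

Lemma measurable_edot_pair : measurable_fun setT (fun z : d.-tuple R * d.-tuple R => edot z.1 z.2).
Proof.
apply: measurable_sum => i; apply: measurable_funM.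
  exact: (measurableT_comp (@measurable_tnth _ R d i) measurable_fst).
exact: (measurableT_comp (@measurable_tnth _ R d i) measurable_snd).
Qed.

Lemma edot_tsub (x y z : d.-tuple R) : edot (tsub x y) z = edot x z - edot y z.
Proof.
by rewrite /edot -sumrB; apply: eq_bigr => i _; rewrite tnth_mktuple mulrBl.
Qed.
End edot_measurable.

Lemma cmeas_comp {d1 d2} {T1 : measurableType d1} {T2 : measurableType d2} {R : realType}
  (f : T2 -> R[i]) (p : T1 -> T2) : cmeas f -> measurable_fun setT p -> cmeas (f \o p).
Proof.
move=> [f1 f2] mp; split; first exact: (measurableT_comp f1 mp).
exact: (measurableT_comp f2 mp).
Qed.

(** * The operator as a convolution *)

Section sufficiency.
Context {R : realType} {d l k : nat} (a : d.-tuple R).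
Hypotheses (d0 : (0 < d)%N) (a0 : forall j, 0 < tnth a j)
  (asum : \sum_(j < d) tnth a j = d%:R).
Local Notation C := R[i].
Local Notation leb := (@lebesgue_tuple R d).

Lemma measurable_hsnorm l' (f : d.-tuple R -> 'rV[C]_l') : (forall j, cmeas (fun x => f x 0 j)) ->
  measurable_fun setT (fun x => hsnorm (f x)).
Proof.
move=> mf.
rewrite (_ : (fun x => hsnorm (f x)) = fun x => (\sum_j (complex.Re (f x 0 j) ^+ 2 + complex.Im (f x 0 j) ^+ 2)) `^ 2^-1).
  apply: (measurableT_comp (measurable_powR _)); apply: measurable_sum => j.
  by apply: measurable_funD; apply: measurable_funX; case: (mf j).
apply/funext => x; rewrite powR12_sqrt; last first.
  by apply: sumr_ge0 => j _; rewrite addr_ge0 ?sqr_ge0.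
rewrite /hsnorm big_ord1; congr Num.sqrt; apply: eq_bigr => j _; exact: normcE2.
Qed.

Lemma hsnorm_le_sum l' (v : 'rV[C]_l') : hsnorm v <= \sum_j Normc.normc (v 0 j).
Proof.
have s0 (s : seq 'I_l') : 0 <= \sum_(j <- s) Normc.normc (v 0 j).
  by apply: sumr_ge0 => j _; exact: normc_ge0.
rewrite -ler_sqr ?nnegrE ?hsnorm_ge0// hsnorm_sq big_ord1.
elim: (index_enum _) => [|j s IH]; first by rewrite !big_nil expr0n.
rewrite !big_cons sqrrD -addrA lerD2l.
by apply: (le_trans IH); rewrite lerDr mulrn_wge0// mulr_ge0// normc_ge0.
Qed.

Lemma integrable_hsnorm l' (f : d.-tuple R -> 'rV[C]_l') : integrable_rV f ->
  leb.-integrable setT (EFin \o (fun x => hsnorm (f x))).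
Proof.
move=> If; have mf j : cmeas (fun x => f x 0 j) by apply: cintegrable_cmeas; exact: If.
pose g x : R := \sum_j (`|complex.Re (f x 0 j)| + `|complex.Im (f x 0 j)|).
have Ig : leb.-integrable setT (EFin \o g).
  rewrite (_ : EFin \o g = fun x => (\sum_j (`|complex.Re (f x 0 j)| + `|complex.Im (f x 0 j)|)%:E)%E).
    apply: integrable_sum => // j _; case: (If j) => I1 I2.
    apply: (integrableD measurableT (f := fun x => `|complex.Re (f x 0 j)|%:E)
      (g := fun x => `|complex.Im (f x 0 j)|%:E)).
      by apply: (integrable_abse (f := fun x => (complex.Re (f x 0 j))%:E)).
    by apply: (integrable_abse (f := fun x => (complex.Im (f x 0 j))%:E)).
  by apply/funext => x; rewrite /= sumEFin.
apply: (le_integrable measurableT _ _ Ig).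
  by apply/measurable_EFinP; exact: measurable_hsnorm.
move=> x _ /=; rewrite lee_fin ger0_norm ?hsnorm_ge0//; apply: le_trans (ler_norm _).
apply: (le_trans (hsnorm_le_sum _)); apply: ler_sum => j _; exact: normc_ReIm.
Qed.

Lemma normc_fourier_integrand l' (f : d.-tuple R -> 'rV[C]_l') j t y :
  Normc.normc (f y 0 j * cis t) <= hsnorm (f y).
Proof. by rewrite Normc.normcM normc_cis mulr1; exact: hsnorm_entry. Qed.

Variables (Omega : d.-tuple R -> grassmannian R l k).
Variable B : d.-tuple R -> 'rV[C]_l -> C.
Variables (A : d.-tuple R -> 'cV[C]_l) (gamma : R).
Hypotheses (gm : 0 < gamma <= 1)
  (AB : forall z v, sphere z -> (v <= Omega z)%MS -> B z v = (v *m A z) 0 0)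
  (hA : forall j, chs gamma (fun z => A z j 0)).

Local Notation K j := (symbol_kernel a (fun z => A z j 0)).

Definition component_kernel (j : 'I_l) (eps r : R) (z : d.-tuple R) : C :=
  cintegral leb setT (fun xi => K j eps r xi * cis (2 * pi * edot z xi)).

(** [W1] constrains the transform away from the origin; the origin lies outside the annulus because
    [eta] is [0 < eps] there. *)
Lemma Bop_integrand eps r f xi : 0 < eps -> W1 a Omega f ->
  (if eps <= eta a xi <= r then (eta a xi ^- d)%:C * B (eta_dir a xi) (fourier f xi) else 0) =
  \sum_j K j eps r xi * fourier f xi 0 j.
Proof.
move=> e0 [_ fW]; rewrite /symbol_kernel /annulus_cut.
case: ifP => [/andP[h _]|_]; last by rewrite big1// => j _; rewrite !mul0r.
have x0 : xi != origin.
  by apply/eqP => xE; move: h; rewrite xE eta_origin leNgt e0.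
rewrite AB; [|exact: sphere_eta_dir|exact: fW].
rewrite mxE mulr_sumr; apply: eq_bigr => j _; by rewrite mulrAC -mulrA.
Qed.

(** Insert the Fourier integral of [f] and exchange the order of integration: the truncated symbol
    is dominated by a bounded function of bounded support, and [f] is integrable. *)
Lemma Bop_convolution eps r f x : 0 < eps -> eps < r -> W1 a Omega f ->
  (forall j, cmeas (fun y => f y 0 j * component_kernel j eps r (tsub x y))) /\
  Bop a B eps r f x = \sum_j cintegral leb setT (fun y => f y 0 j * component_kernel j eps r (tsub x y)).
Proof.
move=> e0 er fW; have r0 : 0 < r by exact: lt_trans er.
have If := fW.1; have mf j : cmeas (fun x => f x 0 j) by apply: cintegrable_cmeas; exact: If.
have Ih := integrable_hsnorm If.
pose Phi j (z : d.-tuple R * d.-tuple R) : C :=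
  K j eps r z.1 * f z.2 0 j * cis (2 * pi * edot x z.1 - 2 * pi * edot z.2 z.1).
(* With the variables swapped, Fubini also yields integrability in [y] of the inner integral over
   frequencies. *)
pose Psi j (z : d.-tuple R * d.-tuple R) : C := Phi j (z.2, z.1).
have mswap : measurable_fun setT (fun z : d.-tuple R * d.-tuple R => (z.2, z.1)).
  by apply: measurable_fun_pair; [exact: measurable_snd|exact: measurable_fst].
have mPhi j : cmeas (Phi j).
  apply: cmeasM; first apply: cmeasM.
  - exact: (cmeas_comp (cmeas_symbol_kernel a0 (hA j) eps r) measurable_fst).
  - exact: (cmeas_comp (mf j) measurable_snd).
  - apply: cmeas_cis; apply: measurable_funB; apply: measurable_funM => //.
      have := measurableT_comp (measurable_edot_const x) (@measurable_fst _ _ (d.-tuple R) (d.-tuple R)).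
      by congr measurable_fun; apply/funext => z; rewrite /= edotC.
    exact: (measurableT_comp measurable_edot_pair mswap).
have mPsi j : cmeas (Psi j) by exact: (cmeas_comp (mPhi j) mswap).
have bnd j : exists kb : d.-tuple R -> R, [/\ leb.-integrable setT (EFin \o kb),
    forall xi, 0 <= kb xi & forall xi, Normc.normc (K j eps r xi) <= kb xi].
  have [Kc K0 H] := symbol_kernel_bound a0 (hA j).
  exists (fun xi => eps ^- d * Kc * etaI a r xi); split.
  - by apply: bsupp_integrable; apply: bsuppZ; exact: bsupp_etaI.
  - by move=> xi; rewrite !mulr_ge0 ?invr_ge0 ?exprn_ge0 ?etaI_ge0// ltW.
  - by move=> xi; exact: H.
have Fub j : [/\ cintegrable leb setT (fun xi => cintegral leb setT (fun y => Phi j (xi, y))),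
   cintegrable leb setT (fun y => cintegral leb setT (fun xi => Phi j (xi, y))) &
   cintegral leb setT (fun xi => cintegral leb setT (fun y => Phi j (xi, y))) =
   cintegral leb setT (fun y => cintegral leb setT (fun xi => Phi j (xi, y)))].
  have [kb [Ikb kb0 Hkb]] := bnd j.
  have Hn xi y : Normc.normc (Phi j (xi, y)) <= kb xi * hsnorm (f y).
    rewrite /Phi -mulrA Normc.normcM; apply: ler_pM; rewrite ?normc_ge0//.
    exact: normc_fourier_integrand.
  have [F1 F2] := cintegral_fubini (mPhi j) Ikb Ih kb0 (fun y => hsnorm_ge0 (f y)) Hn.
  have Hn' y xi : Normc.normc (Psi j (y, xi)) <= hsnorm (f y) * kb xi.
    by rewrite mulrC; exact: Hn.
  have [G1 _] := cintegral_fubini (mPsi j) Ih Ikb (fun y => hsnorm_ge0 (f y)) kb0 Hn'.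
  by split.
have E1 xi j : cintegral leb setT (fun y => Phi j (xi, y)) =
   K j eps r xi * fourier f xi 0 j * cis (2 * pi * edot x xi).
  rewrite mxE mulrAC -cintegralZ; last first.
    apply: (cintegrable_bound (g := fun y => hsnorm (f y))) => //.
      apply: cmeasM; first exact: mf.
      apply: cmeas_cis; apply: measurableT_comp => //; apply: measurable_funM => //.
      exact: measurable_edot_const.
    by move=> y; exact: normc_fourier_integrand.
  congr cintegral; apply/funext => y; rewrite /Phi /= cisD; ring.
have E2 y j : cintegral leb setT (fun xi => Phi j (xi, y)) =
    f y 0 j * component_kernel j eps r (tsub x y).
  rewrite -cintegralZ; last exact: (symbol_kernel_integrable a0 (hA j)).
  by congr cintegral; apply/funext => xi; rewrite /Phi /= edot_tsub mulrBr; ring.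
split=> [j|].
  have [_ G _] := Fub j; have := cintegrable_cmeas G.
  by congr cmeas; apply/funext => y; exact: E2.
rewrite /Bop /inv_fourier.
transitivity (cintegral leb setT (fun xi => \sum_j cintegral leb setT (fun y => Phi j (xi, y)))).
  congr cintegral; apply/funext => xi; rewrite Bop_integrand// mulr_suml.
  by apply: eq_bigr => j _; rewrite E1.
have F1 j : cintegrable leb setT (fun xi => cintegral leb setT (fun y => Phi j (xi, y))).
  by have [] := Fub j.
rewrite (cintegral_sum _ F1).2; apply: eq_bigr => j _.
have [_ _ ->] := Fub j.
by congr cintegral; apply/funext => y; exact: E2.
Qed.

Hypothesis cA : forall j, cmean a (fun z => A z j 0) = 0.

(** The sup norm of a convolution is at most the sup of the kernel times the $L_1$ norm, here for
    each coordinate and with the factor [2] of complex integrals. *)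
Theorem uniformly_bounded_of_mean_zero : uniformly_bounded a Omega B.
Proof.
have /choice[c cP] j : exists c : R, 0 <= c /\ forall eps r z, 0 < eps -> eps < r ->
    Normc.normc (component_kernel j eps r z) <= c.
  by have [c c0 H] := complex_kernel_bound a0 asum (hA j) (cA j); exists c.
exists (\sum_j 2 * c j) => eps r e0 er f fW.
have Ih := integrable_hsnorm fW.1.
pose I := \int[leb]_y hsnorm (f y).
have I0 : 0 <= I by apply: Rintegral_ge0 => x _; exact: hsnorm_ge0.
have NE : ('N[leb]_1[(fun x => (hsnorm (f x))%:E)] = I%:E)%E.
  rewrite Lnorm1 /I /Rintegral fineK; last exact: (integrable_fin_num measurableT Ih).
  by apply: eq_integral => x _; rewrite /= ger0_norm// hsnorm_ge0.
rewrite NE -EFinM.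
have B0 : (0 <= (\sum_j 2 * c j) * I)%R.
  by rewrite mulr_ge0// sumr_ge0// => j _; rewrite mulr_ge0//; case: (cP j).
(* The norm at [+oo] is [0] by convention on a space of measure zero; otherwise a bound at every
   point suffices. *)
rewrite unlock /Lnorm.body; case: ifPn => _; last by rewrite lee_fin.
apply/ess_supP; apply: nearW => x.
rewrite [X in (X <= _)%E](_ : _ = (Normc.normc (Bop a B eps r f x))%:E); last first.
  by rewrite /comp abse_EFin ger0_norm// normc_ge0.
have [mc E] := Bop_convolution x e0 er fW; rewrite lee_fin E.
rewrite mulr_suml.
apply: (le_trans (normc_sum _ _)); apply: ler_sum => j _.
have [cj0 Hc] := cP j.
apply: (le_trans (normc_cintegral (mc j) (g := fun y => c j * hsnorm (f y)) _ _)).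
- exact: (integrableZl measurableT (c j) Ih).
- move=> y; rewrite Normc.normcM mulrC; apply: ler_pM; rewrite ?normc_ge0//.
    exact: Hc.
  exact: hsnorm_entry.
- by rewrite RintegralZl// mulrA.
Qed.

End sufficiency.

(** * Necessity of weak cancellation *)

Section annulus_cut_integral.
Context {R : realType} {d : nat} (a : d.-tuple R).
Hypotheses (d0 : (0 < d)%N) (a0 : forall j, 0 < tnth a j)
  (asum : \sum_(j < d) tnth a j = d%:R).
Local Notation V := (vol (R := R) (d := d)).

(** The density $\eta^{-d}$ is invariant under dilations, so only the ratio of the radii counts. *)
Lemma lint_annulus_cut_dil (eps r t : R) : 0 < eps -> 0 < r -> 0 < t ->
  lint (annulus_cut a (t * eps) (t * r)) = lint (annulus_cut a eps r).
Proof.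
move=> e0 r0 t0.
have -> : annulus_cut a (t * eps) (t * r) = fun x => t ^- d * (annulus_cut a eps r \o dil a t) x.
  apply/funext => x; rewrite /annulus_cut /= eta_dil// ler_pdivlMr// ler_pdivrMr//.
  rewrite ![_ * t]mulrC; case: ifP => [/andP[h _]|_]; last by rewrite mulr0.
  rewrite expr_div_n; field.
  by rewrite !expf_neq0// gt_eqF// (lt_le_trans _ h)// mulr_gt0.
have bc := bsupp_annulus_cut a0 e0 r0.
rewrite lintZ; last exact: bsupp_dil.
by rewrite (lint_dil asum)// mulrA mulVf ?mul1r// expf_neq0// gt_eqF.
Qed.

(** Logarithmic divergence: each halving of the inner radius adds at least a fixed amount. The new
    shell ends at [3/4] of the old inner radius, which keeps it disjoint from the closed annulus
    already counted. *)
Lemma lint_annulus_cut_ge (K : nat) :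
  K%:R * (((3 / 4) ^+ d - 2^-1 ^+ d) * V) <= lint (annulus_cut a (2 ^- K) 1).
Proof.
have p0 k : 0 < 2 ^- k :> R by rewrite invr_gt0 exprn_gt0.
elim: K => [|K IH].
  by rewrite mul0r; apply: lint_ge0 => x; exact: annulus_cut_ge0.
pose s : R := 2 ^- K * 2^-1; pose t : R := 2 ^- K * (3 / 4).
have s0 : 0 < s by rewrite mulr_gt0// invr_gt0.
have t0 : 0 < t by rewrite mulr_gt0// divr_gt0.
have st : s <= t by rewrite ler_pM2l//; lra.
have tK : t < 2 ^- K by rewrite /t gtr_pMr//; lra.
have sE : 2 ^- K.+1 = s by rewrite /s exprS invfM mulrC.
have b1 := bsupp_annulus_cut a0 (p0 K) ltr01.
have b2 : bsupp (fun x => 2 ^+ K ^+ d * shellI a s t x).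
  by apply: bsuppZ; exact: bsupp_shellI.
apply: (@le_trans _ _ (lint (fun x => annulus_cut a (2 ^- K) 1 x + 2 ^+ K ^+ d * shellI a s t x))).
  rewrite lintD// lintZ; last exact: bsupp_shellI.
  rewrite (lint_shellI a0 asum)// -natr1 mulrDl mul1r; apply: lerD => //.
  have -> : t ^+ d - s ^+ d = (2 ^- K) ^+ d * ((3 / 4) ^+ d - 2^-1 ^+ d).
    by rewrite mulrBr -!exprMn.
  by rewrite !mulrA -exprMn mulfV ?expr1n ?mul1r// expf_neq0.
apply: lint_le; [exact: bsuppD|exact: (bsupp_annulus_cut a0 (p0 _) ltr01)|].
move=> x; rewrite shellIE// /annulus_cut sE.
case: (leP (2 ^- K) (eta a x)) => h1 /=.
  rewrite (_ : (s < eta a x <= t) = false) ?mulr0 ?addr0; last first.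
    by apply/negP => /andP[_ h]; have := le_lt_trans h tK; rewrite ltNge h1.
  by rewrite (le_trans st (le_trans (ltW tK) h1)).
rewrite add0r; case: (boolP (s < eta a x <= t)) => [/andP[h2 h3]|_]; last first.
  by rewrite mulr0; case: ifP => // _; rewrite invr_ge0 exprn_ge0// eta_ge0.
have e0 : 0 < eta a x by exact: lt_trans h2.
rewrite (ltW h2) mulr1 /=.
have h4 : eta a x <= 1.
  by apply: (le_trans (ltW h1)); rewrite invf_le1 ?exprn_gt0// exprn_ege1// ler1n.
rewrite h4 (_ : 2 ^+ K ^+ d = (2 ^- K) ^- d); last by rewrite exprVn invrK.
rewrite lef_pV2 ?posrE ?exprn_gt0//.
by apply: lerXn2r; rewrite ?nnegrE ?ltW.
Qed.

Variable gamma : R.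
Hypothesis gm : 0 < gamma <= 1.

(** Over [eps < eta <= r] the integral vanishes by [lint_mean_zero]. The annulus also contains the
    level [eta = eps], which is enclosed in shells [s < eta <= eps] whose volume tends to [0] as [s]
    approaches [eps]. *)
Lemma lint_cut_mean_zero (g : d.-tuple R -> R) (eps r : R) : hs gamma g -> dmean a g = 0 ->
  0 < eps -> eps <= r -> lint (fun x => annulus_cut a eps r x * g (eta_dir a x)) = 0.
Proof.
move=> [C hg] g0 e0 er; have r0 : 0 < r by exact: lt_le_trans er.
(* Freezing the power below [eps] makes the radial factor bounded everywhere. *)
pose p (t : R) : R := Num.max eps t `^ (- d%:R).
have mp : measurable_fun setT p.
  by apply: (measurableT_comp (measurable_powR _)); exact: measurable_maxr.
have mx t : eps <= Num.max eps t by rewrite le_max lexx.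
have E0 : 0 <= eps ^- d by rewrite invr_ge0 exprn_ge0// ltW.
have inv (u v : R) : 0 < u -> u <= v -> v ^- d <= u ^- d.
  move=> u0 uv; rewrite lef_pV2 ?posrE ?exprn_gt0 ?(lt_le_trans u0)//.
  by apply: lerXn2r; rewrite ?nnegrE ?(ltW u0) ?(le_trans (ltW u0)).
have pE t : p t = Num.max eps t ^- d.
  by rewrite /p powR_invn// (le_trans (ltW e0)).
have pC t : `|p t| <= eps ^- d.
  rewrite pE ger0_norm; first exact: inv.
  by rewrite invr_ge0 exprn_ge0// (le_trans (ltW e0)).
pose K : R := eps ^- d * d%:R / eps.
have K0 : 0 <= K by rewrite /K divr_ge0 ?(ltW e0)// mulr_ge0.
have lip x y : eps < x <= r -> eps < y <= r -> `|p x - p y| <= K * `|x - y|.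
  suff W u v : eps < u -> u <= v -> `|p u - p v| <= K * `|u - v|.
    move=> /andP[x1 _] /andP[y1 _]; have [xy|yx] := leP x y; first exact: W.
    by rewrite distrC [`|x - y|]distrC; apply: W => //; exact: ltW.
  move=> eu uv; have u0 : 0 < u by exact: lt_trans eu.
  have v0 : 0 < v by exact: lt_le_trans uv.
  rewrite !pE (max_r (ltW eu)) (max_r (le_trans (ltW eu) uv)).
  rewrite ger0_norm ?subr_ge0; last exact: inv.
  rewrite distrC ger0_norm ?subr_ge0//.
  have -> : u ^- d - v ^- d = u ^- d * (1 - (u / v) ^+ d).
    by rewrite mulrBr mulr1 expr_div_n mulrA mulVf ?mul1r// expf_neq0// gt_eqF.
  have uv1 : 0 <= u / v <= 1.
    by rewrite divr_ge0 ?(ltW u0) ?(ltW v0)//= ler_pdivrMr// mul1r.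
  rewrite /K -!mulrA; apply: ler_pM.
  - by rewrite invr_ge0 exprn_ge0// ltW.
  - by rewrite subr_ge0 exprn_ile1//; case/andP: uv1.
  - by apply: inv => //; exact: ltW.
  - apply: (le_trans (bernoulli_le d uv1)); rewrite ler_wpM2l//.
    have -> : 1 - u / v = (v - u) / v by field; rewrite gt_eqF.
    rewrite mulrC ler_wpM2r ?subr_ge0// lef_pV2 ?posrE//.
    by apply: (le_trans (ltW eu)).
have Z := lint_mean_zero a0 asum (measurable_holder_dir a0 hg) (holder_dir_bound a0 hg)
   (holder_dir_invariant a0 g) g0 mp pC e0 er lip K0.
pose N := C + `|g origin|.
have N0 : 0 <= N by apply: le_trans (holder_dir_bound a0 hg origin); exact: normr_ge0.
pose f x := annulus_cut a eps r x * g (eta_dir a x).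
pose q x := shellI a eps r x * (p (eta a x) * (g \o eta_dir a) x).
have bf : bsupp f.
  exact: (bsuppM (bsupp_annulus_cut a0 e0 r0) (measurable_holder_dir a0 hg) (holder_dir_bound a0 hg)).
have bq : bsupp q.
  apply: (bsuppM (C := eps ^- d * N)); first exact: bsupp_shellI.
    apply: measurable_funM; last exact: (measurable_holder_dir a0 hg).
    by apply: (measurableT_comp mp); exact: measurable_eta.
  by move=> x; rewrite normrM; apply: ler_pM => //; exact: (holder_dir_bound a0 hg).
have -> : lint f = lint (fun x => f x - q x) by rewrite lintB// Z subr0.
apply/eqP; rewrite -normr_le0.
have bound s : 0 < s -> s < eps -> `|lint (fun x => f x - q x)| <= eps ^- d * N * V * (eps ^+ d - s ^+ d).
  move=> s0 se.
  have -> : eps ^- d * N * V * (eps ^+ d - s ^+ d) = lint (fun x => eps ^- d * N * shellI a s eps x).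
    rewrite lintZ; last exact: bsupp_shellI.
    by rewrite (lint_shellI a0 asum)//; ring.
  apply: lint_bound; [exact: bsuppB|by apply: bsuppZ; exact: bsupp_shellI|].
  move=> x; rewrite /f /q !shellIE ?(ltW se)// /annulus_cut pE /=.
  case: (ltgtP (eta a x) eps) => h /=.
  - rewrite !mul0r subrr normr0 mulr_ge0// mulr_ge0//.
  - case: ifP => _; last by rewrite !mul0r subrr normr0 !mulr_ge0.
    by rewrite mul1r subrr normr0 !mulr_ge0.
  - rewrite h er se /= mul0r subr0 mulr1 normrM; apply: ler_pM => //; last exact: (holder_dir_bound a0 hg).
    by rewrite ger0_norm.
pose b := eps ^- d * N * V.
have b0 : 0 <= b by rewrite mulr_ge0 ?mulr_ge0// ltW// vol_gt0.
have lim : b * (eps ^+ d - (eps - t) ^+ d) @[t --> 0^'+] --> b * (eps ^+ d - (eps - 0) ^+ d).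
  apply: cvgM; first exact: cvg_cst.
  apply: cvgB; first exact: cvg_cst.
  apply: cvg_at_right_filter.
  apply: (@continuous_comp R R R (fun t => eps - t) (fun x => x ^+ d) 0).
    by apply: cvgB; [exact: cvg_cst|exact: cvg_id].
  exact: exprn_continuous.
rewrite subr0 subrr mulr0 in lim.
apply: ler_cvg_to (cvg_cst _) lim _.
near=> t; apply: bound.
  by rewrite subr_gt0; near: t; exact: nbhs_right_lt.
by rewrite ltrBlDr ltrDl; near: t; exact: nbhs_right_gt.
Unshelve. all: by end_near. Qed.

(** Subtracting the average [dmean a g / V] reduces this to mean zero. *)
Lemma lint_cut_mean (g : d.-tuple R -> R) (eps r : R) : hs gamma g ->
  0 < eps -> eps <= r ->
  lint (fun x => annulus_cut a eps r x * g (eta_dir a x)) = dmean a g / V * lint (annulus_cut a eps r).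
Proof.
move=> hg e0 er; have r0 : 0 < r by exact: lt_le_trans er.
have V0 : 0 < V by exact: vol_gt0.
pose c := dmean a g / V.
have hc : hs gamma (fun _ : d.-tuple R => c) by exact: hs_cst.
have hgc : hs gamma (fun z => g z - c) by exact: hsB.
have m0 : dmean a (fun z => g z - c) = 0.
  rewrite (dmeanD a0 hg (hsN gm hc)) (_ : dmean a (fun=> - c) = - dmean a g) ?subrr//.
  rewrite /dmean (_ : (fun x => _) = fun x => (- c) * ballI 1 x); last by apply/funext => x; rewrite mulrC.
  by rewrite lintZ; [rewrite -/(vol) /c mulNr divfK ?gt_eqF|exact: bsupp_ball].
have := lint_cut_mean_zero hgc m0 e0 er.
have [C hg'] := hg.
have bc := bsupp_annulus_cut a0 e0 r0.
rewrite (_ : (fun x => _) = fun x => annulus_cut a eps r x * g (eta_dir a x) - c * annulus_cut a eps r x); last first.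
  by apply/funext => x; rewrite mulrBr [c * _]mulrC.
rewrite lintB; last 2 first.
- exact: (bsuppM bc (measurable_holder_dir a0 hg') (holder_dir_bound a0 hg')).
- exact: bsuppZ.
by rewrite lintZ// => /subr0_eq.
Qed.

End annulus_cut_integral.

Section kernel_near_zero.
Context {R : realType} {d : nat} (a : d.-tuple R).
Hypotheses (d0 : (0 < d)%N) (a0 : forall j, 0 < tnth a j)
  (asum : \sum_(j < d) tnth a j = d%:R).
Local Notation C := R[i].
Local Notation leb := (@lebesgue_tuple R d).
Local Notation V := (vol (R := R) (d := d)).

Lemma enorm_le_eta (x : d.-tuple R) (t : R) : 0 < t -> t <= 1 -> eta a x <= t -> enorm x <= t `^ amin a.
Proof.
move=> t0 t1; rewrite (eta_le a0)// => h.
have t1' : 1 <= t^-1 by rewrite invf_ge1.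
rewrite -(dilK a x t0); apply: (le_trans (enorm_dil_le a (dil a t x) t1')).
rewrite -powR_inv1 ?(ltW t0)// -powRrM mulN1r opprK.
by apply: ler_piMr => //; exact: powR_ge0.
Qed.

Lemma normc_cis_sub1 (s : R) : Normc.normc (cis s - 1) <= 2 * `|s|.
Proof.
apply: (le_trans (normc_ReIm _)); rewrite mulr_natl mulr2n /=; apply: lerD.
  by have := cos_lip s 0; rewrite cos0 subr0.
by have := sin_lip s 0; rewrite sin0 !subr0.
Qed.

Variable gamma : R.
Hypothesis gm : 0 < gamma <= 1.
Variable F : d.-tuple R -> C.
Hypothesis hF : chs gamma F.

Lemma cintegral_symbol_kernel (eps r : R) : 0 < eps -> eps <= r ->
  cintegral leb setT (symbol_kernel a F eps r) = (lint (annulus_cut a eps r) / V)%:C * cmean a F.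
Proof.
move=> e0 er; case: hF => h1 h2.
have E (g : d.-tuple R -> R) : hs gamma g ->
    lint (fun x => annulus_cut a eps r x * g (eta_dir a x)) = lint (annulus_cut a eps r) / V * dmean a g.
  by move=> hg; rewrite (lint_cut_mean a0 asum gm hg e0 er) [LHS]mulrC mulrA [LHS]mulrAC.
rewrite /cintegral /cmean; simpc; congr (_ +i* _); rewrite -E//; apply: eq_Rintegral => x _.
  by rewrite /symbol_kernel; case: (F _) => u v /=; rewrite mul0r subr0.
by rewrite /symbol_kernel; case: (F _) => u v /=; rewrite mul0r addr0.
Qed.

Lemma symbol_kernel_near_zero : exists2 M : R, 0 <= M & forall (eps t : R) z,
  0 < eps -> eps <= t -> t <= 1 -> enorm z <= 2 ->
  Normc.normc (cintegral leb setT (fun xi => symbol_kernel a F eps t xi * cis (2 * pi * edot z xi))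
     - (lint (annulus_cut a eps t) / V)%:C * cmean a F) <= M * t `^ amin a * lint (annulus_cut a eps t).
Proof.
case: (hF) => -[C1 h1] [C2 h2].
pose N := (C1 + `|complex.Re (F origin)|) + (C2 + `|complex.Im (F origin)|).
have N0 : 0 <= N by rewrite !addr_ge0//; [case: h1|case: h2].
have pi0 : 0 <= pi :> R by exact: pi_ge0.
pose M := 2 * (N * (2 * (2 * pi * 2))).
exists M => [|eps t z e0 et t1 z2]; first by rewrite /M !mulr_ge0.
have t0 : 0 < t by exact: lt_le_trans et.
have bc := bsupp_annulus_cut a0 e0 t0.
rewrite -(cintegral_symbol_kernel e0 et).
have I1 := symbol_kernel_integrable a0 hF z e0 t0.
have I0 : cintegrable leb setT (symbol_kernel a F eps t).
  have := symbol_kernel_integrable a0 hF origin e0 t0.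
  congr cintegrable; apply/funext => xi.
  by rewrite edot0l ?enorm0// mulr0 /cis cos0 sin0 mulr1.
pose D xi := symbol_kernel a F eps t xi * cis (2 * pi * edot z xi) + (-1) * symbol_kernel a F eps t xi.
have IN : cintegrable leb setT (fun xi => (-1) * symbol_kernel a F eps t xi).
  case: I0 => i1 i2; split.
    have := integrableN i1; congr (_.-integrable _ _); apply/funext => x /=.
    by rewrite mulN1r raddfN.
  have := integrableN i2; congr (_.-integrable _ _); apply/funext => x /=.
  by rewrite mulN1r raddfN.
rewrite -[X in _ - X]mul1r -mulNr -cintegralZ// -cintegralD//.
have Iq : leb.-integrable setT (EFin \o (fun xi => N * (2 * (2 * pi * 2)) * t `^ amin a * annulus_cut a eps t xi)).
  by apply: bsupp_integrable; exact: bsuppZ.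
apply: (le_trans (normc_cintegral _ Iq _)).
- exact: (cintegrable_cmeas (cintegrableD I1 IN)).
- move=> xi; rewrite (_ : _ + _ = (annulus_cut a eps t xi)%:C * F (eta_dir a xi) *
    (cis (2 * pi * edot z xi) - 1)); last by rewrite /symbol_kernel; ring.
  rewrite !Normc.normcM.
  have c0 := annulus_cut_ge0 a0 eps t xi.
  have -> : Normc.normc (annulus_cut a eps t xi)%:C = annulus_cut a eps t xi.
    by rewrite normc_real ger0_norm.
  have [ce|/negP ce] := boolP (eps <= eta a xi <= t); last first.
    by rewrite /annulus_cut (negbTE (introN idP ce)) !mul0r mulr0.
  have xt : enorm xi <= t `^ amin a by case/andP: ce => _; exact: enorm_le_eta.
  rewrite [leRHS]mulrC -mulrA ler_wpM2l// -[leRHS]mulrA; apply: ler_pM; rewrite ?normc_ge0//.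
    apply: (le_trans (normc_ReIm _)); apply: lerD; first exact: (holder_dir_bound a0 h1).
    exact: (holder_dir_bound a0 h2).
  apply: (le_trans (normc_cis_sub1 _)); rewrite -[leRHS]mulrA ler_wpM2l//.
  rewrite normrM ger0_norm ?mulr_ge0// -[leRHS]mulrA ler_wpM2l ?mulr_ge0//.
  by apply: (le_trans (edot_norm_le _ _)); apply: ler_pM; rewrite ?enorm_ge0.
- rewrite -/(lint _) lintZ// /M; rewrite le_eqVlt; apply/orP; left; apply/eqP; ring.
Qed.

End kernel_near_zero.

(** * Testing on the indicator of the unit ball *)

Section necessity.
Context {R : realType} {d l k : nat} (a : d.-tuple R).
Hypotheses (d0 : (0 < d)%N) (a0 : forall j, 0 < tnth a j)
  (asum : \sum_(j < d) tnth a j = d%:R).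
Local Notation C := R[i].
Local Notation leb := (@lebesgue_tuple R d).
Local Notation V := (vol (R := R) (d := d)).

(** The exceptional set is null and the unit ball is not, so some point of the ball obeys the
    essential bound. *)
Lemma exists_le_ess_sup (g : d.-tuple R -> R) (c : R) : (forall x, 0 <= g x) ->
  ('N[leb]_+oo[(fun x => (g x)%:E)] <= c%:E)%E -> exists2 x, enorm x <= 1 & g x <= c.
Proof.
move=> g0; have mB : measurable [set x : d.-tuple R | (enorm x <= 1)%R] := measurable_ball_enorm _.
have bE : (leb [set x : d.-tuple R | (enorm x <= 1)%R] = V%:E)%E.
  rewrite /vol /lint /Rintegral fineK; last first.
    exact: (integrable_fin_num measurableT (bsupp_integrable (bsupp_ball 1))).
  rewrite -[X in leb X]setIT -integral_indic//; apply: eq_integral => x _.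
  by rewrite /ballI indicE mem_setE.
have V0 : (0 < leb [set: d.-tuple R])%E.
  apply: (@lt_le_trans _ _ V%:E); first by rewrite lte_fin vol_gt0.
  by rewrite -bE; apply: le_measure; rewrite ?inE.
rewrite unlock /Lnorm.body V0 => /ess_supP [N [mN N0 H]].
apply/not_exists2P => K.
have : (leb [set x : d.-tuple R | (enorm x <= 1)%R] <= leb N)%E.
  apply: le_measure; rewrite ?inE// => x /= x1; apply: H => /=.
  rewrite ger0_norm// lee_fin => gc; by have [] := K x.
by rewrite N0 bE lee_fin leNgt vol_gt0.
Qed.

Definition ball_vector (v : 'rV[C]_l) (x : d.-tuple R) : 'rV[C]_l := (ballI 1 x)%:C *: v.

Lemma cintegrable_ballI : cintegrable leb setT (fun x => (ballI 1 x)%:C).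
Proof.
apply: (cintegrable_bound (g := ballI 1)).
- by apply: cmeas_real; exact: measurable_ballI.
- exact: bsupp_integrable (bsupp_ball 1).
- by move=> x; rewrite normc_real ger0_norm// ballI_ge0.
Qed.

Lemma cintegral_ballI : cintegral leb setT (fun x => (ballI 1 x)%:C) = V%:C.
Proof. by rewrite /cintegral /= /Rintegral integral0. Qed.

(** The transform is everywhere a scalar multiple of [v], which lies in every [Omega z]. *)
Lemma ball_vector_W1 (Omega : d.-tuple R -> grassmannian R l k) (v : 'rV[C]_l) :
  (forall z, sphere z -> (v <= Omega z)%MS) -> W1 a Omega (ball_vector v).
Proof.
move=> vO; split=> [j|xi x0].
  have -> : (fun x => ball_vector v x 0 j) = fun x => v 0 j * (ballI 1 x)%:C.
    by apply/funext => x; rewrite mxE mulrC.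
  apply: (cintegrable_bound (g := fun x => Normc.normc (v 0 j) * ballI 1 x)).
  - apply: cmeasM; last by apply: cmeas_real; exact: measurable_ballI.
    by split; exact: measurable_cst.
  - by apply: bsupp_integrable; apply: bsuppZ; exact: bsupp_ball.
  - move=> x; rewrite Normc.normcM ler_wpM2l ?normc_ge0//.
    by rewrite normc_real ger0_norm// ballI_ge0.
have -> : fourier (ball_vector v) xi =
    cintegral leb setT (fun x => (ballI 1 x)%:C * cis (- (2 * pi * edot x xi))) *: v.
  apply/rowP => j; rewrite !mxE [RHS]mulrC -cintegralZ.
    by congr cintegral; apply/funext => x; rewrite mxE; ring.
  apply: (cintegrable_bound (g := ballI 1)).
  - apply: cmeasM; first by apply: cmeas_real; exact: measurable_ballI.
    apply: cmeas_cis; apply: measurableT_comp => //; apply: measurable_funM => //.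
    exact: measurable_edot_const.
  - exact: bsupp_integrable (bsupp_ball 1).
  - move=> x; rewrite Normc.normcM normc_cis mulr1.
    by rewrite normc_real ger0_norm// ballI_ge0.
by apply: scalemx_sub; apply: vO; exact: sphere_eta_dir.
Qed.

Variable gamma : R.
Hypothesis gm : 0 < gamma <= 1.
Variables (Omega : d.-tuple R -> grassmannian R l k).
Variable B : d.-tuple R -> 'rV[C]_l -> C.
Variable A : d.-tuple R -> 'cV[C]_l.
Hypotheses (AB : forall z v, sphere z -> (v <= Omega z)%MS -> B z v = (v *m A z) 0 0)
  (hA : forall j, chs gamma (fun z => A z j 0)).

(** Two points of the unit ball differ by at most [2], so the kernel may be replaced by its
    approximation near zero. Integrating that constant over the ball gives a factor [V], which
    cancels the [V] in the approximation. *)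
Lemma Bop_ball_vector (v : 'rV[C]_l) : (forall z, sphere z -> (v <= Omega z)%MS) ->
  exists2 M : R, 0 <= M & forall eps t x, 0 < eps -> eps < t -> t <= 1 -> enorm x <= 1 ->
  Normc.normc (Bop a B eps t (ball_vector v) x -
     (lint (annulus_cut a eps t))%:C * \sum_j v 0 j * cmean a (fun z => A z j 0))
  <= M * t `^ amin a * lint (annulus_cut a eps t).
Proof.
move=> vO; have V0 : 0 < V by exact: vol_gt0.
have vW := ball_vector_W1 vO.
have /choice[c cP] j : exists c : R, 0 <= c /\ forall (eps t : R) z,
    0 < eps -> eps <= t -> t <= 1 -> enorm z <= 2 ->
    Normc.normc (component_kernel a A j eps t z -
      (lint (annulus_cut a eps t) / V)%:C * cmean a (fun z => A z j 0)) <=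
      c * t `^ amin a * lint (annulus_cut a eps t).
  have [M M0 H] := symbol_kernel_near_zero a0 asum gm (hA j).
  by exists M; split=> // *; exact: H.
pose M := \sum_j 2 * (Normc.normc (v 0 j) * c j * V).
have M0 : 0 <= M.
  by apply: sumr_ge0 => j _; rewrite !mulr_ge0 ?normc_ge0 ?(ltW V0)//; case: (cP j).
exists M => // eps t x e0 et t1 x1; have t0 : 0 < t by exact: lt_trans et.
set L := lint _.
have [mc ->] := Bop_convolution a0 AB hA x e0 et vW.
rewrite mulr_sumr -sumrB.
apply: (le_trans (normc_sum _ _)); rewrite /M -mulrA mulr_suml; apply: ler_sum => j _.
have [c0 H] := cP j; set m := cmean a _; set q := (L / V)%:C * m.
pose h y := ball_vector v y 0 j * component_kernel a A j eps t (tsub x y)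
   + (- (v 0 j * q)) * (ballI 1 y)%:C.
have hE y : h y = v 0 j * (ballI 1 y)%:C * (component_kernel a A j eps t (tsub x y) - q).
  by rewrite /h /ball_vector mxE; ring.
have Ib : leb.-integrable setT (EFin \o (fun y => Normc.normc (v 0 j) * (c j * t `^ amin a * L) * ballI 1 y)).
  by apply: bsupp_integrable; apply: bsuppZ; exact: bsupp_ball.
have mh : cmeas h.
  apply: cmeasD; first exact: mc.
  by apply: cmeasM; [split; exact: measurable_cst|apply: cmeas_real; exact: measurable_ballI].
have hb y : Normc.normc (h y) <= Normc.normc (v 0 j) * (c j * t `^ amin a * L) * ballI 1 y.
  rewrite hE !Normc.normcM [leRHS]mulrAC.
  rewrite normc_real [X in _ * X * _]ger0_norm ?ballI_ge0//.
  rewrite /ballI; case: (leP (enorm y) 1) => y1; last by rewrite mulr0 !mul0r.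
  rewrite mulr1 ler_wpM2l ?normc_ge0//; apply: H => //; first exact: ltW.
  
  have := enorm_le_sub (tsub x y) x.
  have -> : enorm (tsub (tsub x y) x) = enorm y.
    rewrite -[RHS]mul1r -(normrN1 R) -enormZ; congr enorm.
    by apply: eq_from_tnth => i; rewrite !tnth_mktuple; ring.
  by move=> /le_trans; apply; rewrite -[2]/(1 + 1); apply: lerD.
have Ih := cintegrable_bound mh Ib hb.
have Iq : cintegrable leb setT (fun y => (v 0 j * q) * (ballI 1 y)%:C).
  apply: (cintegrable_bound (g := fun y => Normc.normc (v 0 j * q) * ballI 1 y)).
  - by apply: cmeasM; [split; exact: measurable_cst|apply: cmeas_real; exact: measurable_ballI].
  - by apply: bsupp_integrable; apply: bsuppZ; exact: bsupp_ball.
  - move=> y; rewrite Normc.normcM ler_wpM2l ?normc_ge0//.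
    by rewrite normc_real ger0_norm// ballI_ge0.
have -> : cintegral leb setT (fun y => ball_vector v y 0 j * component_kernel a A j eps t (tsub x y))
    - L%:C * (v 0 j * m) = cintegral leb setT h.
  have -> : L%:C * (v 0 j * m) = cintegral leb setT (fun y => (v 0 j * q) * (ballI 1 y)%:C).
    rewrite (cintegralZ _ cintegrable_ballI) cintegral_ballI /q rmorphM /= fmorphV.
    by field; rewrite -[0]/((0 : R)%:C) (inj_eq (@complexI R)) gt_eqF.
  apply/eqP; rewrite subr_eq -cintegralD//; apply/eqP; congr cintegral; apply/funext => y.
  by rewrite /h; ring.
apply: (le_trans (normc_cintegral mh Ib hb)); rewrite -/(lint _) lintZ; last exact: bsupp_ball.
rewrite -/(vol) le_eqVlt; apply/orP; left; apply/eqP; ring.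
Qed.

(** If the mean [m] were nonzero, a fixed small [t] would keep the error below half the main term.
    At some point of the unit ball the operator would then be at least half of [L |m|], and [L]
    grows without bound as [eps] decreases. *)
Theorem mean_zero_of_uniformly_bounded (v : 'rV[C]_l) : uniformly_bounded a Omega B ->
  (forall z, sphere z -> (v <= Omega z)%MS) ->
  \sum_j v 0 j * cmean a (fun z => A z j 0) = 0.
Proof.
move=> [Cb ub] vO; set m := \sum_j _.
apply/eqP/negPn/negP => m0.
have n0 : 0 < Normc.normc m.
  by rewrite lt_def normc_ge0 andbT; apply: contra m0 => /eqP/Normc.eq0_normc ->.
set n := Normc.normc m in n0.
have [M M0 H] := Bop_ball_vector vO; have vW := ball_vector_W1 vO.
have am0 := amin_gt0 a0.
(* The intended value of $t^{\mathrm{amin}}$: it satisfies both [M * s <= n / 2] and [s <= 1]. *)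
pose s := (n / 2) / (M + n).
have Mn : 0 < M + n by exact: ltr_wpDl.
have s0 : 0 < s by rewrite !divr_gt0.
have s1 : s <= 1 by rewrite ler_pdivrMr// mul1r; lra.
have sM : M * s <= n / 2.
  rewrite /s mulrA ler_pdivrMr// mulrC ler_wpM2l ?divr_ge0 ?(ltW n0)//; lra.
pose t := s `^ (amin a)^-1.
have t0 : 0 < t by exact: powR_gt0.
have tE : t `^ amin a = s by rewrite /t -powRrM mulVf ?gt_eqF// powRr1// ltW.
have t1 : t <= 1.
  have -> : 1 = 1 `^ (amin a)^-1 :> R by rewrite powR1.
  apply: ge0_ler_powR; rewrite ?nnegrE ?invr_ge0 ?(ltW am0) ?(ltW s0) ?ler01//.
have Ih := integrable_hsnorm vW.1.
pose I := \int[leb]_y hsnorm (ball_vector v y).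
have NE : ('N[leb]_1[(fun x => (hsnorm (ball_vector v x))%:E)] = I%:E)%E.
  rewrite Lnorm1 /I /Rintegral fineK; last exact: (integrable_fin_num measurableT Ih).
  by apply: eq_integral => x _; rewrite /= ger0_norm// hsnorm_ge0.
pose c0 := ((3 / 4) ^+ d - 2^-1 ^+ d) * V.
have c00 : 0 < c0.
  rewrite mulr_gt0 ?vol_gt0// subr_gt0 ltrXn2r ?nnegrE -?lt0n//; lra.
have key (K : nat) : K.+1%:R * (c0 * (n / 2)) <= Cb * I.
  (* After rescaling [t] to [1], this leaves [K.+1] dyadic annuli between the two radii. *)
  pose eps := t * 2 ^- K.+1; pose L := lint (annulus_cut a (2 ^- K.+1) 1).
  have e0 : 0 < eps by rewrite mulr_gt0// invr_gt0 exprn_gt0.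
  have et : eps < t by rewrite /eps gtr_pMr// invf_lt1 ?exprn_gt0// exprn_egt1// ltr1n.
  have LE : lint (annulus_cut a eps t) = L.
    rewrite /eps -{2}[t]mulr1 (lint_annulus_cut_dil a0 asum)// invr_gt0 exprn_gt0//.
  have := ub _ _ e0 et _ vW; rewrite NE -EFinM.
  move=> /(exists_le_ess_sup (fun x => normc_ge0 _))[x x1 Bx].
  have := H _ _ x e0 et t1 x1; rewrite LE tE => Hx.
  have L0 : 0 <= L by apply: lint_ge0 => y; exact: annulus_cut_ge0.
  have Ln : L * n <= Cb * I + n / 2 * L.
    have -> : L * n = Normc.normc (L%:C * m).
      by rewrite Normc.normcM normc_real ger0_norm.
    have -> : L%:C * m = Bop a B eps t (ball_vector v) x + - (Bop a B eps t (ball_vector v) x - L%:C * m).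
      by ring.
    apply: (le_trans (le_normcD _ _)); apply: lerD => //.
    rewrite normcN; apply: (le_trans Hx); exact: ler_wpM2r.
  have := lint_annulus_cut_ge a0 asum K.+1; rewrite -/c0 -/L => Lc.
  rewrite mulrA; apply: (@le_trans _ _ (L * (n / 2))).
    by apply: ler_wpM2r => //; rewrite divr_ge0// ltW.
  lra.
have y0 : 0 < c0 * (n / 2) by rewrite mulr_gt0// divr_gt0.
have := key (Num.truncn (Cb * I / (c0 * (n / 2)))).
by rewrite -ler_pdivlMr// leNgt truncnS_gt.
Qed.

End necessity.

Theorem theorem2p1 (R : realType) (d l k : nat)
    (hd : (0 < d)%N) (hl : (0 < l)%N) (hk : (0 < k)%N) (hkl : (k <= l)%N)
    (a : d.-tuple R)
    (ha : forall j, 0 < tnth a j) (hsum : \sum_(j < d) tnth a j = d%:R)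
    (Omega : d.-tuple R -> grassmannian R l k)
    (hOmega : hoelder_on sphere euclid_dist gr_dist Omega)
    (B : d.-tuple R -> 'rV[R[i]]_l -> R[i])
    (hBlin : linear_family Omega B)
    (hBhoelder : hoelder_family Omega B) :
  uniformly_bounded a Omega B <-> weak_cancellation a Omega B.
Proof.
split=> [ub v|wc]; last first.
  have [A [gamma [gm AB hA cA]]] := modified_symbol hd ha hsum hOmega hBlin hBhoelder wc.
  exact: (uniformly_bounded_of_mean_zero ha hsum AB hA cA).
rewrite inE => vO.
have [gamma gm [_ hb]] := symbol_holder hOmega hBlin hBhoelder.
(* In this direction the symbol is left uncorrected: [A] is [B] composed with the projection. *)
pose A z : 'cV[R[i]]_l := \col_j bfun Omega B z (delta_mx 0 j).
have AB z w : sphere z -> (w <= Omega z)%MS -> B z w = (w *m A z) 0 0.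
  move=> zS wO; rewrite -(bfun_sub B zS wO) (bfunE hBlin w zS) mxE.
  by under [RHS]eq_bigr do rewrite mxE.
have hA j : chs gamma (fun z => A z j 0).
  by under [X in chs _ X]funext do rewrite mxE; exact: hb.
have m0 := mean_zero_of_uniformly_bounded hd ha hsum gm AB hA ub vO.
have h1 : chs gamma (fun z => (v *m A z) 0 0).
  under [X in chs _ X]funext do rewrite mxE.
  by apply: (chs_sum gm) => j; exact: chsZ.
have := cintegral_surface hd ha hsum h1.
have -> : cmean a (fun z => (v *m A z) 0 0) = 0.
  rewrite -m0; under [X in cmean _ X]funext do rewrite mxE.
  rewrite (cmean_sum ha gm); last by move=> j; exact: chsZ.
  by apply: eq_bigr => j _; rewrite (cmeanZ ha gm).
rewrite mulr0 => <-; rewrite /cintegral; congr (_ +i* _); apply: eq_Rintegral => z;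
  by rewrite inE => zS; rewrite -(AB z v zS (vO z zS)).
Qed.
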